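(* Let $V,H,\partial H$ be complex Hilbert spaces, with $V,H$ separable and $V$ continuously and densely imbedded in $H$. Let $L:V\to\partial H$ be a bounded linear operator whose range is dense in $\partial H$ and whose kernel is dense in $H$. Let $a,b:V\times V\to\mathbb C$ be continuous sesquilinear forms. Consider on $W:=\{(f_2,f_3)^\top\in V\times\partial H: Lf_2=f_3\}$ the sesquilinear form $$\tilde b\big((f_2,Lf_2),(g_2,Lg_2)\big):=b(f_2,g_2),$$ and assume that $\tilde b$ is $H\times\partial H$-elliptic. Set $$\mathcal V:=\{(f_1,f_2,f_3)^\top\in V\times V\times\partial H: Lf_2=f_3\},\qquad \mathcal H:=V\times H\times\partial H,$$ and let $\mathfrak a$ be the sesquilinear form with domain $\mathcal V$ given by $$\mathfrak a(\mathfrak u,\mathfrak v):=-(u_2\mid v_1)_V+a(u_1,v_2)+b(u_2,v_2),\qquad \mathfrak u=(u_1,u_2,u_3)^\top,\ \mathfrak v=(v_1,v_2,v_3)^\top\in\mathcal V.$$ Then the operator associated with $\mathfrak a$ on $\mathcal H$ is closed. It generates an analytic $C_0$-semigroup $(e^{-t\mathfrak a})_{t\ge0}$ on $\mathcal H$. This semigroup is contractive if $\tilde b$ is accretive and $\mathrm{Re}\,a(u,v)=\mathrm{Re}(v\mid u)_V$ for all $u,v\in V$. If additionally there is a constant $M_b>0$ such that $|\mathrm{Im}\,b(u,u)|\le M_b\|u\|_H\|u\|_V$ for all $u\in V$, then the operator associated with $\mathfrak a$ generates a cosine operator function on $\mathcal H$, too.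
   Context: $W$ carries the norm of $V\times\partial H$, $\mathcal V$ the norm of $V\times V\times\partial H$, and $\mathcal H$ the product Hilbert space structure; $\mathcal V$ is dense in $\mathcal H$. The form $\tilde b$ is $H\times\partial H$-elliptic if there exist $\delta>0$, $\omega\in\mathbb R$ with $\mathrm{Re}\,\tilde b(w,w)+\omega\|w\|^2_{H\times\partial H}\ge\delta\|w\|_W^2$ for all $w\in W$; it is accretive if $\mathrm{Re}\,\tilde b(w,w)\ge0$ for all $w\in W$. The operator $\mathcal A$ on $\mathcal H$ associated with $\mathfrak a$ is defined by $D(\mathcal A):=\{\mathfrak u\in\mathcal V:\exists\,\mathfrak z\in\mathcal H\text{ s.t. }\mathfrak a(\mathfrak u,\mathfrak v)=(\mathfrak z\mid\mathfrak v)_{\mathcal H}\ \forall\mathfrak v\in\mathcal V\}$, $\mathcal A\mathfrak u:=\mathfrak z$. By convention, ''the operator associated with $\mathfrak a$ generates $(e^{-t\mathfrak a})_{t\ge0}$ (resp. a cosine operator function)'' means that $-\mathcal A$ is the infinitesimal generator of that semigroup (resp. cosine operator function). *)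

(* Defs.v *)
From HB Require Import structures.
From mathcomp Require Import all_boot all_order all_algebra.
From mathcomp Require Import complex ring.
From mathcomp Require Import all_classical all_reals all_analysis.
Set Implicit Arguments.
Unset Strict Implicit.
Unset Printing Implicit Defensive.
Import Order.TTheory GRing.Theory Num.Theory numFieldNormedType.Exports.
Local Open Scope classical_set_scope.
Local Open Scope ring_scope.
Local Open Scope complex_scope.

(* Norms of normed modules over R[i] are R[i]-valued (and real, hence
   comparable: x <= y in R[i] iff Im x = Im y and Re x <= Re y).
   The inner product is linear in its first argument. *)
HB.mixin Record hasInner (R : realType) V & NormedModule R[i] V := {
  inner : {dot V for Num.conj} ;
  sqr_normE : forall x : V, `|x| ^+ 2 = inner x x
}.

#[short(type="hilbertType")]
HB.structure Definition Hilbert (R : realType) :=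
  {V of CompleteNormedModule R[i] V & hasInner R V}.

(* The library norms U * V with the maximum norm; the alias hprod U V carries
   the inner product (x1|y1) + (x2|y2) and the associated norm instead. *)
Section HilbertSum.
Variables (R : realType) (U V : hilbertType R).

Definition hprod : Type := (U * V)%type.

HB.instance Definition _ := GRing.Lmodule.on hprod.

Definition hprod_inner (x y : hprod) : R[i] :=
  inner x.1 y.1 + inner x.2 y.2.

Let hprod_inner_bilinear :
  bilinear_for *%R (Num.conj \; *%R) hprod_inner.
Proof.
split=> [y k x z|x k y z]; rewrite /hprod_inner /=.
  rewrite !linearPl /= !mulrDr; exact: addrACA.
rewrite !linearPr /= !mulrDr; exact: addrACA.
Qed.

HB.instance Definition _ := bilinear_isBilinear.Build
  R[i] hprod hprod R[i] *%R (Num.conj \; *%R) hprod_inner hprod_inner_bilinear.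

Let hprod_inner_hermitian (x y : hprod) :
  hprod_inner x y = (-1) ^+ false * Num.conj (hprod_inner y x).
Proof.
by rewrite /hprod_inner (hermC inner) (hermC inner x.2) !mul1r rmorphD.
Qed.

HB.instance Definition _ := isHermitianSesquilinear.Build
  R[i] hprod false Num.conj hprod_inner hprod_inner_hermitian.

Let hprod_inner_gt0 (u : hprod) : u != 0 -> 0 < hprod_inner u u.
Proof.
move=> u0; rewrite lt_def /hprod_inner addr_ge0 ?dnorm_ge0// andbT.
rewrite paddr_eq0 ?dnorm_ge0// !dnorm_eq0.
by apply: contra u0 => /andP[/eqP u1 /eqP u2]; rewrite [u]surjective_pairing u1 u2.
Qed.

HB.instance Definition _ :=
  isDotProduct.Build R[i] hprod hprod_inner hprod_inner_gt0.

Definition hprod_norm (x : hprod) : R[i] := sqrtC (hprod_inner x x).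

Lemma hprod_norm_ge0 x : 0 <= hprod_norm x.
Proof. by rewrite sqrtC_ge0 dnorm_ge0. Qed.

Lemma hprod_sqr_norm x : hprod_norm x ^+ 2 = `|x.1| ^+ 2 + `|x.2| ^+ 2.
Proof. by rewrite sqrtCK !sqr_normE. Qed.

Let hprod_ler_normD x y : hprod_norm (x + y) <= hprod_norm x + hprod_norm y.
Proof.
have [x0 y0] := (hprod_norm_ge0 x, hprod_norm_ge0 y).
rewrite -ler_sqr ?nnegrE ?addr_ge0 ?hprod_norm_ge0// sqrrD !hprod_sqr_norm.
apply: (@le_trans _ _ ((`|x.1| + `|y.1|) ^+ 2 + (`|x.2| + `|y.2|) ^+ 2)).
  by apply: lerD; rewrite ler_sqr ?nnegrE ?addr_ge0//; exact: ler_normD.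
have -> : (`|x.1| + `|y.1|) ^+ 2 + (`|x.2| + `|y.2|) ^+ 2 =
    (`|x.1| ^+ 2 + `|x.2| ^+ 2) + (`|x.1| * `|y.1| + `|x.2| * `|y.2|) *+ 2
    + (`|y.1| ^+ 2 + `|y.2| ^+ 2) by ring.
rewrite lerD2r lerD2l lerMn2r /=.
rewrite -ler_sqr ?nnegrE ?addr_ge0 ?mulr_ge0// exprMn !hprod_sqr_norm -subr_ge0.
have -> : (`|x.1| ^+ 2 + `|x.2| ^+ 2) * (`|y.1| ^+ 2 + `|y.2| ^+ 2)
    - (`|x.1| * `|y.1| + `|x.2| * `|y.2|) ^+ 2 =
    (`|x.1| * `|y.2| - `|x.2| * `|y.1|) ^+ 2 by ring.
by rewrite real_exprn_even_ge0// rpredB// rpredM ?normr_real.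
Qed.

Let hprod_normrZ (l : R[i]) x : hprod_norm (l *: x) = `|l| * hprod_norm x.
Proof.
apply: (pexpIrn (n := 2)) => //; rewrite ?nnegrE ?mulr_ge0 ?hprod_norm_ge0//.
by rewrite exprMn !hprod_sqr_norm /= !normrZ !exprMn mulrDr.
Qed.

Let hprod_normr0_eq0 x : hprod_norm x = 0 -> x = 0.
Proof. by move/eqP; rewrite sqrtC_eq0 dnorm_eq0 => /eqP. Qed.

HB.instance Definition _ := Lmodule_isNormed.Build R[i] hprod
  hprod_ler_normD hprod_normrZ hprod_normr0_eq0.

Lemma hprod_normE (x : hprod) : `|x| = sqrtC (`|x.1| ^+ 2 + `|x.2| ^+ 2).
Proof. by rewrite !sqr_normE. Qed.

Let hprod_le1 (x : hprod) : `|x.1| <= `|x|.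
Proof.
rewrite -ler_sqr ?nnegrE// [X in _ <= X]hprod_sqr_norm lerDl.
exact: exprn_ge0.
Qed.

Let hprod_le2 (x : hprod) : `|x.2| <= `|x|.
Proof.
rewrite -ler_sqr ?nnegrE// [X in _ <= X]hprod_sqr_norm lerDr.
exact: exprn_ge0.
Qed.

Let hprod_leD (x : hprod) : `|x| <= `|x.1| + `|x.2|.
Proof.
rewrite -ler_sqr ?nnegrE ?addr_ge0// [X in X <= _]hprod_sqr_norm sqrrD.
by rewrite addrAC lerDl mulrn_wge0// mulr_ge0.
Qed.

Let hprod_complete (F : set_system hprod) :
  ProperFilter F -> cauchy F -> cvg F.
Proof.
move=> FF /cauchy_ballP Fc.
have c1 : cauchy ((fun x : hprod => x.1) @ F).
  apply/cauchy_ballP => e e0; near_simpl.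
  have := Fc _ e0; rewrite !near2E /=; apply: filterS => -[x y] /=.
  rewrite -!ball_normE /=; apply: le_lt_trans.
  exact: (hprod_le1 (x - y)).
have c2 : cauchy ((fun x : hprod => x.2) @ F).
  apply/cauchy_ballP => e e0; near_simpl.
  have := Fc _ e0; rewrite !near2E /=; apply: filterS => -[x y] /=.
  rewrite -!ball_normE /=; apply: le_lt_trans.
  exact: (hprod_le2 (x - y)).
have v1 : cvg (x.1 @[x --> F]) := @cauchy_cvg _ _ _ c1.
pose l1 := lim (x.1 @[x --> F]).
have cl1 : x.1 @[x --> F] --> l1 by exact: v1.
have v2 : cvg (x.2 @[x --> F]) := @cauchy_cvg _ _ _ c2.
pose l2 := lim (x.2 @[x --> F]).
have cl2 : x.2 @[x --> F] --> l2 by exact: v2.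
apply: (@cvgP _ _ ((l1, l2) : hprod)); apply/cvgrPdist_lt => e e0.
have e2 : 0 < e / 2 by rewrite divr_gt0.
move/cvgrPdist_lt : cl1 => /(_ _ e2) /= h1.
move/cvgrPdist_lt : cl2 => /(_ _ e2) /= h2.
near=> x.
apply: (le_lt_trans (hprod_leD _)); rewrite [e]splitr; apply: ltrD.
- by near: x; exact: h1.
- by near: x; exact: h2.
Unshelve. all: by end_near. Qed.

HB.instance Definition _ := Uniform_isComplete.Build hprod hprod_complete.

Let hprod_sqr_normE (x : hprod) : `|x| ^+ 2 = hprod_inner x x.
Proof. exact: sqrtCK. Qed.

HB.instance Definition _ := hasInner.Build R hprod hprod_sqr_normE.

End HilbertSum.

Definition separable (T : topologicalType) :=
  exists2 S : set T, countable S & dense S.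

Definition bounded_op (R : realType) (X Y : normedModType R[i]) (f : X -> Y) :=
  exists M : R, forall x, `|f x| <= M%:C * `|x|.

(* Unbounded operators on X are represented by their graphs, sets of pairs
   (x, A x) with x in D(A). *)
Section Operators.
Variables (R : realType) (X : normedModType R[i]).

Definition closed_op (A : set (X * X)) := closed A.

Definition opp_op (A : set (X * X)) : set (X * X) :=
  [set p | A (p.1, - p.2)].

(* Only the values T t for 0 <= t are relevant. *)
Definition C0_semigroup (T : R -> {linear X -> X}) :=
  [/\ forall t, 0 <= t -> bounded_op (T t),
      forall x, T 0 x = x,
      forall s t x, 0 <= s -> 0 <= t -> T (s + t) x = T s (T t x)
    & forall x, T t x @[t --> 0^'+] --> x].

Definition semigroup_generator (T : R -> {linear X -> X}) : set (X * X) :=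
  [set p | t^-1%:C *: (T t p.1 - p.1) @[t --> 0^'+] --> p.2].

Definition contractive (T : R -> {linear X -> X}) :=
  forall t x, 0 <= t -> `|T t x| <= `|x|.

(* The open sector of the nonzero z with |arg z| < theta; meaningful for
   theta <= pi. *)
Definition sector (theta : R) : set R[i]^o :=
  [set z | exists r phi : R,
     [/\ 0 < r, `|phi| < theta & z = r%:C * (cos phi +i* sin phi)]].

(* Complex differentiability at z in operator norm. *)
Definition op_derivable_at (S : R[i] -> {linear X -> X}) (z : R[i]) :=
  exists2 D : {linear X -> X}, bounded_op D &
    forall e : R, 0 < e -> \forall h \near (0 : R[i]^o)^',
      forall x, `|h^-1 *: (S (z + h) x - S z x) - D x| <= e%:C * `|x|.

Definition analytic_semigroup (T : R -> {linear X -> X}) :=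
  C0_semigroup T /\
  exists (theta : R) (S : R[i] -> {linear X -> X}),
    [/\ 0 < theta <= pi / 2,
        forall t x, 0 <= t -> S t%:C x = T t x,
        forall z, sector theta z -> bounded_op (S z) /\ op_derivable_at S z,
        forall z w x, sector theta z -> sector theta w ->
          S (z + w) x = S z (S w x)
      & forall theta' x, 0 < theta' < theta ->
          S z x @[z --> within (sector theta') (nbhs (0 : R[i]^o))] --> x].

Definition cosine_function (C : R -> {linear X -> X}) :=
  [/\ forall t, bounded_op (C t),
      forall x, C 0 x = x,
      forall s t x, C (t + s) x + C (t - s) x = 2 *: C t (C s x)
    & forall x, continuous (fun t => C t x)].

Definition cosine_generator (C : R -> {linear X -> X}) : set (X * X) :=
  [set p | (2 / t ^+ 2)%:C *: (C t p.1 - p.1) @[t --> 0^'] --> p.2].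

End Operators.

(* Forms with a domain: f is defined on the subspace D of the Hilbert space E,
   with the norm of E, and D is embedded in X by iota. *)
Section Forms.
Variables (R : realType) (E X : hilbertType R).
Variables (D : set E) (iota : E -> X) (f : E -> E -> R[i]).

Definition elliptic :=
  exists delta omega : R, 0 < delta /\
    forall w, D w ->
      delta%:C * `|w| ^+ 2 <= 'Re (f w w) + omega%:C * `|iota w| ^+ 2.

Definition accretive := forall w, D w -> 0 <= 'Re (f w w).

Definition associated_op : set (X * X) :=
  [set p | exists2 u, D u /\ iota u = p.1 &
     forall v, D v -> f u v = inner p.2 (iota v)].

End Forms.

Section Problem.
Variables (R : realType) (V H dH : hilbertType R).
Variables (j : V -> H) (L : V -> dH) (a b : V -> V -> R[i]).

Definition W_space : set (hprod V dH) := [set w | L w.1 = w.2].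

Definition W_emb (w : hprod V dH) : hprod H dH := (j w.1, w.2).

Definition b_tilde (w w' : hprod V dH) : R[i] := b w.1 w'.1.

(* Triples (f1, f2, f3) are left-nested pairs. *)
Definition calV : set (hprod (hprod V V) dH) := [set u | L u.1.2 = u.2].

Definition calV_emb (u : hprod (hprod V V) dH) : hprod (hprod V H) dH :=
  ((u.1.1, j u.1.2), u.2).

Definition a_frak (u v : hprod (hprod V V) dH) : R[i] :=
  - inner u.1.2 v.1.1 + a u.1.1 v.1.2 + b u.1.2 v.1.2.

End Problem.

(* Main.v *)
Require Import Defs.
From HB Require Import structures.
From mathcomp Require Import all_boot all_order all_algebra.
From mathcomp Require Import complex ring lra.
From mathcomp Require cyclic separable cyclotomic.
From mathcomp Require Import all_classical all_reals all_analysis.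
Set Implicit Arguments.
Unset Strict Implicit.
Unset Printing Implicit Defensive.
Import Order.TTheory GRing.Theory Num.Theory numFieldNormedType.Exports.
Local Open Scope classical_set_scope.
Local Open Scope ring_scope.
Local Open Scope complex_scope.

(* The third component of an element of the form domain is determined by the
   second one, so the form lives on the Hilbert space V x V, embedded in
   V x H x dH by (u1, u2) |-> (u1, j u2, L u2), which has dense range;
   it is elliptic relative to the norm of V x H x dH, hence Lax-Milgram gives
   the resolvents J(z) = (1 + z A)^-1 for small z in a sector, with
   |J(z)| <= 1 + c |z|.

   The semigroup is the limit of J(z / 2^k)^(2^k). The analytic estimate
   n |J^n - J^(n+1)| <= C, with J = J(z / n), comes from duality: with
   x_k = J^k x and y_l = (J^* )^l y, the values of the form at (x_k, y_l) with
   k + l = n - 1 coincide, and averaging them bounds them by the two energies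
   sum |x_k|_V^2 and sum |y_l|_V^2, each of which telescopes.

   The cosine function is the limit of the Chebyshev polynomials T_n of the
   Crank-Nicolson step c(h) = 2 J(h^2 / 4) - 1, with n h -> t. Their boundedness
   for n h <= T is the heart of the matter. The energy |u|^2 + Re f(w, w) of the
   scheme is not conserved, but its increments are the antisymmetric quantities
   Re (f(w_(k+1), w_k) - f(w_k, w_(k+1))); for a periodic sequence these sum up,
   after a discrete Fourier transform, to a combination of the numbers
   Im f(W, W), which the condition |Im f(u, u)| <= m |u|_H |u|_V turns into a
   geometric mean of the two energies. Linear weights make the sequence
   periodic and give the boundedness of the time averages of the energy for
   the scheme and its adjoint; averaging the duality pairing of the two then
   bounds T_n(c(h)) itself on a short time interval, and the addition formula
   extends the bound to every T. *)

(** * Real norms, sesquilinear forms and inner products *)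

(** Both limits are built from the graph of A and its resolvents alone. Rates exist on D(A^2), where
    one step has a defect of order z w A^2 or h^4 A^2; uniform bounds and density carry convergence
    to the whole space.

    Giving up half of the ellipticity constant keeps z f coercive, up to a lower order term, in a
    thin sector, so the implicit Euler scheme runs with complex steps and yields S(z) directly.
    Differentiability in operator norm then rests on the boundedness of A^2 S(z/2), which the
    smoothing estimate supplies.

    For the cosine function the obstacle is the lack of symmetry of f. The hypothesis on Im f
    concerns diagonal values f(u, u) only; the Fourier transform in time is what turns the
    antisymmetric increments into diagonal values. *)

(* The norms of normed modules over [R[i]] are [R[i]]-valued; [nm] is the real
   number behind them. *)
Definition nm (R : rcfType) (V : normedZmodType R[i]) (x : V) : R :=
  complex.Re `|x|.

Section Nm.
Variables (R : rcfType) (V : normedZmodType R[i]).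
Implicit Types x y : V.

Lemma nmE x : `|x| = (nm x)%:C.
Proof. by rewrite RRe_real ?normr_real. Qed.

Lemma nm_ge0 x : 0 <= nm x.
Proof. by rewrite -lecR -nmE; exact: normr_ge0. Qed.

Lemma nmD x y : nm (x + y) <= nm x + nm y.
Proof. by rewrite -lecR rmorphD /= -!nmE ler_normD. Qed.

Lemma nmN x : nm (- x) = nm x.
Proof. by rewrite /nm normrN. Qed.

Lemma nmBC x y : nm (x - y) = nm (y - x).
Proof. by rewrite /nm distrC. Qed.

Lemma nmB x y : nm (x - y) <= nm x + nm y.
Proof. by rewrite -(nmN y) nmD. Qed.

Lemma nm0 : nm (0 : V) = 0.
Proof. by rewrite /nm normr0. Qed.

Lemma nm_eq0 x : nm x = 0 -> x = 0.
Proof. by move=> h; apply/eqP; rewrite -normr_eq0 nmE h. Qed.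

Lemma nm_tri y x z : nm (x - z) <= nm (x - y) + nm (y - z).
Proof. by have := nmD (x - y) (y - z); rewrite addrA subrK. Qed.

Lemma nm_le_dist x y : nm x <= nm y + nm (x - y).
Proof. by have := nmD y (x - y); rewrite addrC subrK. Qed.

End Nm.

Section NmC.
Variable R : realType.
Implicit Types (z w : R[i]) (r : R).

Lemma nmM z w : nm (z * w) = nm z * nm w.
Proof. by apply: complexI; rewrite rmorphM /= -!nmE normrM. Qed.

Lemma nmC r : nm (r%:C) = `|r|.
Proof. by rewrite /nm normc_def /= expr0n addr0 sqrtr_sqr. Qed.

Lemma nmC_ge0 r : 0 <= r -> nm (r%:C) = r.
Proof. by rewrite nmC => /ger0_norm. Qed.

Lemma nm_nat n : nm (n%:R : R[i]) = n%:R.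
Proof. by rewrite -(rmorph_nat (real_complex R)) nmC_ge0. Qed.

Lemma nm1 : nm (1 : R[i]) = 1.
Proof. by rewrite (nmC 1) normr1. Qed.

Lemma nmV z : nm z^-1 = (nm z)^-1.
Proof. by apply: complexI; rewrite /= -nmE normfV nmE fmorphV. Qed.

Lemma nmJ z : nm (Num.conj z) = nm z.
Proof. by rewrite /nm norm_conjC. Qed.

Lemma sqr_nmC z : nm z ^+ 2 = complex.Re z ^+ 2 + complex.Im z ^+ 2.
Proof. by apply: complexI; rewrite add_Re2_Im2 nmE rmorphXn. Qed.

Lemma nm_gt0 z : z != 0 -> 0 < nm z.
Proof.
move=> z0; rewrite lt_def nm_ge0 andbT; apply: contra z0 => /eqP h.
by apply/eqP; apply: nm_eq0.
Qed.

Lemma Re_nm z : `|complex.Re z| <= nm z.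
Proof. by rewrite -lecR -nmE normc_ge_Re. Qed.

Lemma Im_nm z : `|complex.Im z| <= nm z.
Proof.
rewrite -(@ler_pXn2r _ 2) ?nnegrE ?nm_ge0// sqr_nmC real_normK ?num_real//.
by rewrite lerDr sqr_ge0.
Qed.

Lemma nm_ReIm z : nm z <= `|complex.Re z| + `|complex.Im z|.
Proof.
rewrite -(@ler_pXn2r _ 2) ?nnegrE ?nm_ge0 ?addr_ge0// sqr_nmC sqrrD.
by rewrite !real_normK ?num_real// addrAC lerDl mulrn_wge0// mulr_ge0.
Qed.

Lemma cReD z w : complex.Re (z + w) = complex.Re z + complex.Re w.
Proof. by case: z w => [a b] [c d]. Qed.
Lemma cReN z : complex.Re (- z) = - complex.Re z.
Proof. by case: z. Qed.
Lemma cImD z w : complex.Im (z + w) = complex.Im z + complex.Im w.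
Proof. by case: z w => [a b] [c d]. Qed.
Lemma cImN z : complex.Im (- z) = - complex.Im z.
Proof. by case: z. Qed.
Lemma cReM z w : complex.Re (z * w)
  = complex.Re z * complex.Re w - complex.Im z * complex.Im w.
Proof. by case: z w => [a b] [c d]. Qed.
Lemma cImM z w : complex.Im (z * w)
  = complex.Re z * complex.Im w + complex.Im z * complex.Re w.
Proof. by case: z w => [a b] [c d]. Qed.
Lemma cReCM r z : complex.Re (r%:C * z) = r * complex.Re z.
Proof. by rewrite cReM /= mul0r subr0. Qed.
Lemma cImCM r z : complex.Im (r%:C * z) = r * complex.Im z.
Proof. by rewrite cImM /= mul0r addr0. Qed.
Lemma cReJ z : complex.Re (Num.conj z) = complex.Re z.
Proof. by case: z. Qed.
Lemma cImJ z : complex.Im (Num.conj z) = - complex.Im z.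
Proof. by case: z. Qed.

Lemma conjCr r : Num.conj (r%:C : R[i]) = r%:C.
Proof. exact: conjc_real. Qed.

End NmC.

Lemma nmZ (R : realType) (V : normedModType R[i]) (a : R[i]) (x : V) :
  nm (a *: x) = nm a * nm x.
Proof. by apply: complexI; rewrite rmorphM /= -!nmE normrZ. Qed.

Section Sesq.
Variables (R : realType) (E : lmodType R[i]).
Implicit Types (f : E -> E -> R[i]) (u v : E).

Definition sesq f :=
  [/\ forall u u' v, f (u + u') v = f u v + f u' v,
      forall u v v', f u (v + v') = f u v + f u v',
      forall c u v, f (c *: u) v = c * f u v
    & forall c u v, f u (c *: v) = Num.conj c * f u v].

Definition adj f u v := Num.conj (f v u).

Lemma sesq_adj f : sesq f -> sesq (adj f).
Proof.
move=> [Dl Dr Zl Zr]; split=> *; rewrite /adj ?Dl ?Dr ?Zl ?Zr ?rmorphD ?rmorphM //.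
by rewrite /= conjCK.
Qed.

Lemma adjK f : adj (adj f) = f.
Proof. by apply/funext => u; apply/funext => v; rewrite /adj conjCK. Qed.

Variable f : E -> E -> R[i].
Hypothesis sf : sesq f.

Lemma sesqDl u u' v : f (u + u') v = f u v + f u' v. Proof. by case: sf. Qed.
Lemma sesqDr u v v' : f u (v + v') = f u v + f u v'. Proof. by case: sf. Qed.
Lemma sesqZl c u v : f (c *: u) v = c * f u v. Proof. by case: sf. Qed.
Lemma sesqZr c u v : f u (c *: v) = Num.conj c * f u v. Proof. by case: sf. Qed.
Lemma sesqNl u v : f (- u) v = - f u v.
Proof. by rewrite -scaleN1r sesqZl mulN1r. Qed.
Lemma sesqNr u v : f u (- v) = - f u v.
Proof. by rewrite -scaleN1r sesqZr rmorphN1 mulN1r. Qed.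
Lemma sesq0l v : f 0 v = 0.
Proof. by rewrite -(scale0r 0) sesqZl mul0r. Qed.
Lemma sesq0r v : f v 0 = 0.
Proof. by rewrite -(scale0r 0) sesqZr rmorph0 mul0r. Qed.
Lemma sesq_suml I (r : seq I) (F : I -> E) v :
  f (\sum_(i <- r) F i) v = \sum_(i <- r) f (F i) v.
Proof.
by elim: r => [|i r IH]; rewrite ?big_nil ?sesq0l// !big_cons sesqDl IH.
Qed.
Lemma sesq_sumr I (r : seq I) (F : I -> E) v :
  f v (\sum_(i <- r) F i) = \sum_(i <- r) f v (F i).
Proof.
by elim: r => [|i r IH]; rewrite ?big_nil ?sesq0r// !big_cons sesqDr IH.
Qed.
Definition sesqE := (sesqDl, sesqDr, sesqNl, sesqNr, sesqZl, sesqZr).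
End Sesq.

Section Inner.
Variables (R : realType) (X : hilbertType R).
Implicit Types x y : X.

Lemma sesq_inner : sesq (@inner R X).
Proof.
split=> *; rewrite ?linearDl ?linearDr ?linearZl_LR ?linearZr_LR //.
Qed.

Definition innerE := sesqE sesq_inner.

Lemma innerC x y : inner x y = Num.conj (inner y x).
Proof. by rewrite (hermC inner) mul1r. Qed.

Definition rip x y : R := complex.Re (inner x y).

Lemma inner_nm x : inner x x = (nm x ^+ 2)%:C.
Proof. by rewrite -sqr_normE nmE rmorphXn. Qed.

Lemma sqr_nm x : nm x ^+ 2 = rip x x.
Proof. by rewrite /rip inner_nm. Qed.

Lemma ripC x y : rip x y = rip y x.
Proof. by rewrite /rip innerC cReJ. Qed.
Lemma ripDl x x' y : rip (x + x') y = rip x y + rip x' y.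
Proof. by rewrite /rip innerE cReD. Qed.
Lemma ripDr x x' y : rip y (x + x') = rip y x + rip y x'.
Proof. by rewrite /rip innerE cReD. Qed.
Lemma ripNl x y : rip (- x) y = - rip x y.
Proof. by rewrite /rip innerE cReN. Qed.
Lemma ripNr x y : rip x (- y) = - rip x y.
Proof. by rewrite /rip innerE cReN. Qed.
Lemma ripZl (r : R) x y : rip (r%:C *: x) y = r * rip x y.
Proof. by rewrite /rip innerE cReCM. Qed.
Lemma ripZr (r : R) x y : rip x (r%:C *: y) = r * rip x y.
Proof. by rewrite /rip innerE conjCr cReCM. Qed.
Definition ripE := (ripDl, ripDr, ripNl, ripNr, ripZl, ripZr).

Lemma rip_le x y : rip x y <= nm x * nm y.
Proof.
have [y0|y0] := eqVneq (nm y) 0.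
  by rewrite y0 (nm_eq0 y0) /rip (sesq0r sesq_inner) mulr0.
have [x0|x0] := eqVneq (nm x) 0.
  by rewrite x0 (nm_eq0 x0) /rip (sesq0l sesq_inner) mul0r.
have px : 0 < nm x * nm y by rewrite mulr_gt0// lt_def ?x0 ?y0 nm_ge0.
(* The expansion equals 2 |x| |y| (|x| |y| - Re (x|y)). *)
have := sqr_ge0 (nm ((nm y)%:C *: x - (nm x)%:C *: y)).
rewrite sqr_nm !ripE -!sqr_nm (ripC y x) => h.
rewrite -subr_ge0 -(pmulr_rge0 _ px); nra.
Qed.

(** Multiplying [x] by the conjugate of (x|y) makes the product real and nonnegative, which reduces
    the complex inequality to [rip_le]. *)
Lemma nm_inner_le x y : nm (inner x y) <= nm x * nm y.
Proof.
have [->|c0] := eqVneq (inner x y) 0; first by rewrite nm0 mulr_ge0 ?nm_ge0.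
have := rip_le (Num.conj (inner x y) *: x) y.
rewrite /rip innerE mulrC -normCK nmE nmZ nmJ -rmorphXn /= expr2 -mulrA.
by rewrite ler_pM2l// nm_gt0.
Qed.

Lemma inner_ext x y : (forall v, inner x v = inner y v) -> x = y.
Proof.
move=> h; apply/eqP; rewrite -subr_eq0; apply/eqP; apply: nm_eq0.
have : nm (x - y) ^+ 2 = 0 by rewrite sqr_nm /rip !sesqDl ?sesqNl ?h ?subrr; try exact: sesq_inner.
by move/eqP; rewrite sqrf_eq0 => /eqP.
Qed.

Lemma sqr_nmD x y : nm (x + y) ^+ 2 = nm x ^+ 2 + 2 * rip x y + nm y ^+ 2.
Proof. by rewrite !sqr_nm !ripE (ripC y x); ring. Qed.

Lemma sqr_nmB x y : nm (x - y) ^+ 2 = nm x ^+ 2 - 2 * rip x y + nm y ^+ 2.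
Proof. by rewrite !sqr_nm !ripE (ripC y x); ring. Qed.

Lemma sqr_nmB_le x y : nm (x - y) ^+ 2 <= 2 * nm x ^+ 2 + 2 * nm y ^+ 2.
Proof. by have := sqr_ge0 (nm (x + y)); rewrite sqr_nmB sqr_nmD; lra. Qed.

End Inner.

(** Pairing both sides with an arbitrary vector turns a vector identity into one between complex
    numbers, within reach of [ring]. *)
Ltac vec := apply: inner_ext => ?; rewrite !innerE; try ring.

(** * Limits of sequences of vectors *)

Section RealEps.
Variable R : realType.

Lemma exp_small (q e : R) : 0 <= q < 1 -> 0 < e ->
  exists n0, forall n, (n0 <= n)%N -> q ^+ n <= e.
Proof.
move=> /andP[q0 q1] e0.
have /cvg_expr/cvgrPdist_le/(_ e e0) : `|q| < 1 by rewrite ger0_norm.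
case=> n0 _ h; exists n0 => n n0n.
by have := h n n0n; rewrite /= sub0r normrN ger0_norm// exprn_ge0.
Qed.

Lemma inv_small (C e : R) : 0 < e ->
  exists n0, forall n, (n0 <= n)%N -> C / n.+1%:R <= e.
Proof.
move=> e0; exists (Num.bound `|C / e|) => n hn.
rewrite ler_pdivrMr ?ltr0n// mulrC -ler_pdivrMr//.
rewrite (le_trans (ler_norm _))// (le_trans (ltW (archi_boundP (normr_ge0 _))))//.
by rewrite ler_nat (leq_trans hn).
Qed.

Lemma sqr_small (e : R) : 0 < e -> exists2 d : R, 0 < d & forall x : R, x ^+ 2 <= d -> x <= e.
Proof.
move=> e0; exists (e ^+ 2); first by rewrite exprn_gt0.
move=> x h; have [x0|x0] := ltP x 0; first by rewrite ltW// (lt_trans x0).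
by rewrite -(@ler_pXn2r _ 2)// nnegrE// ltW.
Qed.

End RealEps.

Section Tends.
Variables (R : realType) (X : normedModType R[i]).
Implicit Types (u v : nat -> X) (x l : X).

(** Real epsilons and large inequalities keep all limit arguments in the scope of [lra]; filters
    appear only at the interface with the stated definitions. *)
Definition tends u l := forall e : R, 0 < e ->
  exists n0, forall n, (n0 <= n)%N -> nm (u n - l) <= e.

Lemma tends_near (u : nat -> X) l e x c : tends u l -> 0 < e ->
    (exists n0, forall n, (n0 <= n)%N -> nm (u n - x) <= c) ->
  nm (l - x) <= c + e.
Proof.
move=> ul e0 [n0 h0]; have [n1 h1] := ul _ e0.
have h := nm_tri (u (maxn n0 n1)) l x.
by rewrite (le_trans h)// addrC lerD ?h0 ?leq_maxl// nmBC h1// leq_maxr.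
Qed.

Lemma tends_le (u : nat -> X) l x c : tends u l ->
    (exists n0, forall n, (n0 <= n)%N -> nm (u n - x) <= c) ->
  nm (l - x) <= c.
Proof.
by move=> ul h; apply/ler_addgt0Pr => e e0; exact: tends_near h.
Qed.

Lemma tends_uniq u l l' : tends u l -> tends u l' -> l = l'.
Proof.
move=> ul ul'; apply/eqP; rewrite -subr_eq0; apply/eqP; apply: nm_eq0.
apply/eqP; rewrite eq_le nm_ge0 andbT; apply/ler_addgt0Pr => e e0.
by rewrite add0r; apply: tends_le ul _; exact: ul'.
Qed.

Lemma tends_cst x : tends (fun=> x) x.
Proof. by move=> e e0; exists 0%N => n _; rewrite subrr nm0 ltW. Qed.

Lemma tends_ext u v l : (exists n0, forall n, (n0 <= n)%N -> u n = v n) ->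
  tends u l -> tends v l.
Proof.
move=> [n0 h0] ul e e0; have [n1 h1] := ul _ e0; exists (maxn n0 n1) => n.
by rewrite geq_max => /andP[a b]; rewrite -h0// h1.
Qed.

Lemma tends_comp u l (s : nat -> nat) : (forall n, n <= s n)%N ->
  tends u l -> tends (u \o s) l.
Proof.
move=> hs ul e e0; have [n0 h0] := ul _ e0; exists n0 => n hn.
by apply: h0; exact: leq_trans hn (hs n).
Qed.

Lemma tendsD u v l l' : tends u l -> tends v l' ->
  tends (fun n => u n + v n) (l + l').
Proof.
move=> ul vl e e0; have e2 : 0 < e / 2 by rewrite divr_gt0.
have [n0 h0] := ul _ e2; have [n1 h1] := vl _ e2.
exists (maxn n0 n1) => n; rewrite geq_max => /andP[a b].
rewrite opprD addrACA (le_trans (nmD _ _))//.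
by rewrite [leRHS]splitr lerD ?h0 ?h1.
Qed.

Lemma tends_small u v l : tends u l ->
  (forall e : R, 0 < e -> exists n0, forall n, (n0 <= n)%N -> nm (v n - u n) <= e) ->
  tends v l.
Proof.
move=> ul uv e e0; have e2 : 0 < e / 2 by rewrite divr_gt0.
have [n0 h0] := ul _ e2; have [n1 h1] := uv _ e2.
exists (maxn n0 n1) => n; rewrite geq_max => /andP[a b].
by rewrite (le_trans (nm_tri (u n) _ _))// [leRHS]splitr lerD ?h0 ?h1.
Qed.

End Tends.

Section TendsMap.
Variables (R : realType) (X Y : normedModType R[i]).

(** Serves for products of strongly convergent operator sequences: the outer operators vary with [n]
    but share one Lipschitz constant. *)
Lemma tends_lip (B : nat -> X -> Y) (u : nat -> X) l l' K :
    (exists n0, forall n, (n0 <= n)%N ->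
      forall x y, nm (B n x - B n y) <= K * nm (x - y)) ->
    tends u l -> tends (fun n => B n l) l' -> tends (fun n => B n (u n)) l'.
Proof.
move=> [n0 h0] ul Bl; apply: tends_small Bl _ => e e0.
have K0 : 0 < `|K| + 1 by rewrite ltr_wpDl.
have [n1 h1] := ul _ (divr_gt0 e0 K0); exists (maxn n0 n1) => n.
rewrite geq_max => /andP[a b]; rewrite (le_trans (h0 _ a _ _))//.
have := h1 _ b; rewrite ler_pdivlMr// mulrC => h; apply: le_trans h.
by rewrite ler_wpM2r ?nm_ge0// (le_trans (ler_norm K))// lerDl.
Qed.

Lemma tends_map (B : X -> Y) (u : nat -> X) l K :
    (forall x y, nm (B x - B y) <= K * nm (x - y)) ->
  tends u l -> tends (fun n => B (u n)) (B l).
Proof.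
move=> h ul; apply: (@tends_lip (fun=> B) u l _ K) => //; last exact: tends_cst.
by exists 0%N.
Qed.

End TendsMap.

Lemma tendsZ (R : realType) (X : normedModType R[i]) (u : nat -> X) l (a : R[i]) :
  tends u l -> tends (fun n => a *: u n) (a *: l).
Proof.
by apply: (@tends_map _ _ _ _ _ _ (nm a)) => x y; rewrite -scalerBr nmZ.
Qed.

(** * Filter limits restated with real epsilon and delta *)

Section Filters.
Variables (R : realType) (X : normedModType R[i]).

Lemma nbhs_nm (x : X) (P : set X) :
  (exists2 e : R, 0 < e & forall y, nm (x - y) < e -> P y) <-> nbhs x P.
Proof.
split=> [[e e0 h]|/nbhs_ballP[e e0]].
  apply/nbhs_ballP; exists e%:C; rewrite /= ?ltcR// => y.
  by rewrite -ball_normE /= nmE ltcR; exact: h.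
rewrite -ball_normE => h; have e_re : (complex.Re e)%:C = e.
  by rewrite RRe_real// gtr0_real.
exists (complex.Re e); first by rewrite -ltcR e_re.
by move=> y hy; apply: h; rewrite /= nmE -e_re ltcR.
Qed.

Lemma cvg_nm (T : Type) (F : set_system T) (g : T -> X) (l : X) : Filter F ->
  g @ F --> l <-> forall e : R, 0 < e -> F [set t | nm (g t - l) <= e].
Proof.
move=> FF; split=> [/cvgrPdist_le h e e0|h].
  have := h e%:C; rewrite ltcR => /(_ e0); apply: filterS => t /=.
  by rewrite nmE lecR nmBC.
apply/cvgrPdist_le => e e0; have e_re : (complex.Re e)%:C = e.
  by rewrite RRe_real// gtr0_real.
have /h : 0 < complex.Re e by rewrite -ltcR e_re.
by apply: filterS => t /=; rewrite nmE -{2}e_re lecR nmBC.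
Qed.

Lemma cvg_right0 (g : R -> X) (l : X) : g t @[t --> 0^'+] --> l <->
  forall e : R, 0 < e -> exists2 d : R, 0 < d &
    forall t, 0 < t < d -> nm (g t - l) <= e.
Proof.
split=> [/cvg_nm h e /h|h].
  rewrite /at_right withinE => -[B /nbhs_ballP[d d0 dB] BE].
  exists d => // t /andP[t0 td].
  suff : (B `&` [set u | 0 < u]) t by rewrite -BE => -[].
  split=> //; apply: dB; rewrite -ball_normE /= sub0r normrN.
  by rewrite gtr0_norm.
apply/cvg_nm => e /h[d d0 hd].
apply/nbhs_ballP; exists d => //= t; rewrite -ball_normE /= sub0r normrN => td t0.
by apply: hd; rewrite t0 -(gtr0_norm t0).
Qed.

Lemma cvg_dnbhs0 (g : R -> X) (l : X) : g t @[t --> 0^'] --> l <->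
  forall e : R, 0 < e -> exists2 d : R, 0 < d &
    forall t, t != 0 -> `|t| < d -> nm (g t - l) <= e.
Proof.
split=> [/cvg_nm h e /h|h].
  rewrite /dnbhs withinE => -[B /nbhs_ballP[d d0 dB] BE].
  exists d => // t t0 td.
  suff : (B `&` [set u | u != 0]) t by rewrite -BE => -[].
  by split=> //; apply: dB; rewrite -ball_normE /= sub0r normrN.
apply/cvg_nm => e /h[d d0 hd].
apply/nbhs_ballP; exists d => //= t; rewrite -ball_normE /= sub0r normrN => td t0.
exact: hd.
Qed.

Lemma bounded_opP (Y : normedModType R[i]) (f : X -> Y) (K : R) :
  (forall x, nm (f x) <= K * nm x) -> bounded_op f.
Proof. by move=> h; exists K => x; rewrite !nmE -rmorphM lecR. Qed.

End Filters.

Section Complete.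
Variables (R : realType) (X : completeNormedModType R[i]).
Implicit Types (u : nat -> X).

Lemma cauchy_tends u : (forall e : R, 0 < e -> exists n0, forall m n,
    (n0 <= m)%N -> (n0 <= n)%N -> nm (u m - u n) <= e) ->
  exists l, tends u l.
Proof.
move=> h; have : cauchy (u @ \oo).
  apply/cauchy_ballP => e e0; near_simpl.
  have e_re : (complex.Re e)%:C = e by rewrite RRe_real// gtr0_real.
  have e0' : 0 < complex.Re e / 2 by rewrite divr_gt0// -ltcR e_re.
  have [n0 h0] := h _ e0'.
  exists ([set n | n0 <= n]%N, [set n | n0 <= n]%N) => /=.
    by split; exists n0.
  move=> [m n] /= [hm hn]; rewrite -ball_normE /= nmE -[e]e_re ltcR.
  rewrite (le_lt_trans (h0 _ _ hm hn))// ltr_pdivrMr// mulr2n mulrDr mulr1.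
  by rewrite ltrDl -ltcR e_re.
move=> /cauchy_cvg c; exists (lim (u @ \oo)) => e e0.
move/cvgrPdist_le : c => /(_ e%:C); rewrite ltcR => /(_ e0) [n0 _ hn].
by exists n0 => n /hn /=; rewrite nmE lecR nmBC.
Qed.

Lemma geom_tends u (C q : R) n0 : 0 <= q < 1 ->
    (forall n, (n0 <= n)%N -> nm (u n.+1 - u n) <= C * q ^+ n) ->
  exists2 l, tends u l &
    forall n, (n0 <= n)%N -> nm (u n - l) <= C * q ^+ n / (1 - q).
Proof.
move=> /andP[q0 q1] h; have q1' : 0 < 1 - q by rewrite subr_gt0.
have C0 : 0 <= C * q ^+ n0 by rewrite (le_trans _ (h _ (leqnn _)))// nm_ge0.
(* The partial geometric sum is kept exactly, so that the induction on [k] closes with an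
   equality. *)
have step n k : (n0 <= n)%N ->
    nm (u (n + k)%N - u n) <= C * q ^+ n * (1 - q ^+ k) / (1 - q).
  move=> hn; elim: k => [|k IH].
    by rewrite addn0 subrr nm0 expr0 subrr mulr0 mul0r.
  rewrite (le_trans (nm_tri (u (n + k)%N) _ _))//.
  have hk : nm (u (n + k.+1)%N - u (n + k)%N) <= C * q ^+ (n + k).
    by rewrite addnS h// (leq_trans hn)// leq_addr.
  rewrite (le_trans (lerD hk IH))// le_eqVlt; apply/orP; left; apply/eqP.
  by rewrite exprD exprS; field; rewrite gt_eqF.
have stepb n k : (n0 <= n)%N ->
    nm (u (n + k)%N - u n) <= C * q ^+ n / (1 - q).
  move=> hn; rewrite (le_trans (step _ _ hn))// ler_pM2r ?invr_gt0//.
  have Cn : 0 <= C * q ^+ n by rewrite (le_trans _ (h _ hn))// nm_ge0.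
  by rewrite ler_piMr// gerBl exprn_ge0.
have [l ul] : exists l, tends u l.
  apply: cauchy_tends => e e0.
  have cpos : 0 < (`|C| + 1) / (1 - q) * 2.
    by rewrite mulr_gt0// divr_gt0// ltr_wpDl.
  have [n1 h1] := exp_small (q := q) (e := e / ((`|C| + 1) / (1 - q) * 2))
    ltac:(by rewrite q0) (divr_gt0 e0 cpos).
  pose N := maxn n0 n1.
  have hN m : (N <= m)%N -> nm (u m - u N) <= e / 2.
    move=> /subnKC <-; rewrite (le_trans (stepb _ _ _))// ?leq_maxl//.
    have := h1 N (leq_maxr _ _); rewrite ler_pdivlMr// => h2.
    rewrite ler_pdivlMr//; apply: le_trans h2.
    rewrite !mulrA !ler_pM2r ?invr_gt0//.
    by rewrite mulrC ler_wpM2l ?exprn_ge0// (le_trans (ler_norm C))// lerDl.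
  exists N => m n hm hn; rewrite (le_trans (nm_tri (u N) _ _))// [leRHS]splitr.
  by rewrite lerD ?hN// nmBC hN.
exists l => // n hn; rewrite nmBC; apply: tends_le ul _; exists n => m /subnKC <-.
exact: stepb.
Qed.

End Complete.

Section StrongLimit.
Variables (R : realType) (X : completeNormedModType R[i]).

(** The usual three-term estimate: approximate [x] by a point of [D], where convergence is known, at
    a cost uniform in [n]. It is applied with D = D(A^2). *)
Lemma strong_limit (B : nat -> {linear X -> X}) (D : set X) (K : R) n0 :
    (forall n, (n0 <= n)%N -> forall x, nm (B n x) <= K * nm x) ->
    (forall x (e : R), 0 < e -> exists2 y, D y & nm (x - y) <= e) ->
    (forall x, D x -> exists l, tends (fun n => B n x) l) ->
  forall x, exists l, tends (fun n => B n x) l.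
Proof.
move=> hK dD cD x; apply: cauchy_tends => e e0.
have K0 : 0 < (`|K| + 1) * 4 by rewrite mulr_gt0// ltr_wpDl.
have [y Dy xy] := dD x _ (divr_gt0 e0 K0).
have [l yl] := cD _ Dy; have e4 : 0 < e / 4 by rewrite divr_gt0.
have [n1 h1] := yl _ e4; exists (maxn n0 n1) => m n.
rewrite !geq_max => /andP[m0 m1] /andP[k0 k1].
have hB k : (n0 <= k)%N -> nm (B k x - B k y) <= e / 4.
  move=> hk; rewrite -linearB (le_trans (hK _ hk _))//.
  move: xy; rewrite ler_pdivlMr// => xy; rewrite ler_pdivlMr//.
  have := ler_wpM2r (nm_ge0 (x - y)) (ler_norm K).
  by have := nm_ge0 (x - y); lra.
have hl k : (n0 <= k)%N -> (n1 <= k)%N -> nm (B k x - l) <= e / 2.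
  move=> a b; rewrite (le_trans (nm_tri (B k y) _ _))//.
  by rewrite (le_trans (lerD (hB _ a) (h1 _ b)))//; lra.
rewrite (le_trans (nm_tri l _ _))// [leRHS]splitr lerD ?hl//.
by rewrite nmBC hl.
Qed.

End StrongLimit.

Section IterLinear.
Variables (R : realType) (X : lmodType R[i]) (n : nat) (B : {linear X -> X}).

Lemma iter_linear : linear (iter n B).
Proof. by move=> a x y; elim: n => //= k ->; rewrite linearP. Qed.

HB.instance Definition _ :=
  GRing.isLinear.Build R[i] X X *:%R (iter n B) iter_linear.

End IterLinear.

(** * Riesz representation and the Lax-Milgram theorem *)

Section Riesz.
Variables (R : realType) (E : hilbertType R).

(** The representing vector minimises |v|^2 - 2 l(v), which is bounded below by - M^2; the
    parallelogram identity makes minimising sequences Cauchy. *)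
Lemma riesz_real (l : E -> R) (M : R) :
    (forall u v, l (u + v) = l u + l v) ->
    (forall (r : R) u, l (r%:C *: u) = r * l u) ->
    (forall u, l u <= M * nm u) ->
  exists g, forall v, rip g v = l v.
Proof.
move=> lD lZ lM; pose J v := nm v ^+ 2 - 2 * l v.
have Jlb v : - M ^+ 2 <= J v.
  by rewrite /J; have := lM v; have := sqr_ge0 (nm v - M); nra.
have Ji : has_inf (range J).
  by split; [exists (J 0), 0|exists (- M ^+ 2) => _ [v _ <-]].
pose m := inf (range J).
have mJ v : m <= J v by apply: ge_inf; [exact: Ji.2|exists v].
have /choice[u uP] n : exists v, J v <= m + n.+1%:R^-1.
  have n0 : 0 < n.+1%:R^-1 :> R by rewrite invr_gt0.
  by have [_ [v _ <-]] := inf_adherent n0 Ji; exists v; exact: ltW.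
have JD v w (t : R) : J (v + t%:C *: w) = J v + 2 * t * (rip v w - l w) + t ^+ 2 * nm w ^+ 2.
  by rewrite /J sqr_nmD lD lZ ripZr nmZ nmC exprMn real_normK ?num_real//; ring.
have [g ug] : exists g, tends u g.
  apply: cauchy_tends => e e0; have [d d0 hd] := sqr_small e0.
  have [n0 h0] := inv_small 4 d0; exists n0 => i j hi hj.
  apply: hd; rewrite sqr_nmB.
  (* J at the midpoint is (J(u_i) + J(u_j)) / 2 - |u_i - u_j|^2 / 4; as it is at least [m], the
     squared distance is at most 2/(i+1) + 2/(j+1). *)
  have := mJ (u i + (1 / 2)%:C *: (u j - u i)); rewrite JD ripDr ripNr -sqr_nm sqr_nmB.
  have := uP i; have := uP j; have := h0 _ hi; have := h0 _ hj.
  have -> : l (u j - u i) = l (u j) - l (u i).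
    by rewrite lD -scaleN1r (_ : -1 = (-1)%:C) ?lZ ?mulN1r// rmorphN1.
  rewrite (ripC (u j)) /J.
  by move: (j.+1%:R^-1) (i.+1%:R^-1) => ej ei; lra.
exists g => v; apply/eqP; rewrite -subr_eq0 -normr_eq0 eq_le normr_ge0 andbT.
apply/ler_addgt0Pr => e e0; rewrite add0r.
have e2 : 0 < e / 2 by rewrite divr_gt0.
have V0 : 0 < nm v + 1 by rewrite ltr_wpDl ?nm_ge0.
have [n0 h0] := ug _ (divr_gt0 e2 V0).
have [d d0 hd] := sqr_small e2.
have [n1 h1] := inv_small (nm v ^+ 2 + 1) d0.
pose n := maxn n0 n1.
have W0 : 0 < nm v ^+ 2 + 1 by rewrite ltr_wpDl ?sqr_ge0.
have small : `|rip (u n) v - l v| <= e / 2.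
  apply: hd; apply: le_trans (h1 n (leq_maxr _ _)).
  rewrite real_normK ?num_real// mulrC -ler_pdivrMr//.
  (* Nearly the minimiser of J along the line u_n + t v; the added 1 covers v = 0. *)
  pose dn := rip (u n) v - l v; pose t : R := - dn / (nm v ^+ 2 + 1).
  have := mJ (u n + t%:C *: v); rewrite JD -/dn; have := uP n.
  have tW : t * (nm v ^+ 2 + 1) = - dn by rewrite /t mulfVK// gt_eqF.
  have : t ^+ 2 * nm v ^+ 2 = - dn * t - t ^+ 2.
    by rewrite -tW; ring.
  move=> -> a b; have : - (dn * t) = dn ^+ 2 / (nm v ^+ 2 + 1).
    by rewrite /t; ring.
  move=> <-; have := sqr_ge0 t.
  by move: (n.+1%:R^-1) a b => en; lra.
have -> : rip g v - l v = rip (g - u n) v + (rip (u n) v - l v).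
  by rewrite ripDl ripNl; ring.
rewrite (le_trans (ler_normD _ _))// [leRHS]splitr lerD//.
have := h0 n (leq_maxl _ _); rewrite ler_pdivlMr// nmBC.
have := nm_ge0 (g - u n).
rewrite /rip => p; apply: le_trans.
rewrite (le_trans (Re_nm _))// (le_trans (nm_inner_le _ _))//.
by rewrite ler_wpM2l// lerDl.
Qed.

Definition antilinear (l : E -> R[i]) :=
  (forall u v, l (u + v) = l u + l v) /\ (forall c u, l (c *: u) = Num.conj c * l u).

Lemma riesz (l : E -> R[i]) (M : R) : antilinear l ->
    (forall u, nm (l u) <= M * nm u) ->
  exists g, forall v, inner g v = l v.
Proof.
move=> [lD lZ] lM.
have [g gP] := @riesz_real (fun v => complex.Re (l v)) M
  ltac:(by move=> u v /=; rewrite lD cReD)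
  ltac:(by move=> r u /=; rewrite lZ conjCr cReCM)
  ltac:(by move=> u /=; rewrite (le_trans (ler_norm _))// (le_trans (Re_nm _))).
exists g => v; apply/eqP; rewrite eq_complex; apply/andP; split; apply/eqP.
  exact: gP.
(* Testing with i v turns the real part of the product into its imaginary part. *)
have := gP ('i%C *: v); rewrite /rip innerE lZ !cReM cReJ cImJ /=.
by rewrite !mul0r !sub0r mulN1r opprK mulN1r opprK.
Qed.

Variables (f : E -> E -> R[i]) (M d : R).
Hypotheses (sf : sesq f) (fM : forall u v, nm (f u v) <= M * nm u * nm v)
  (d0 : 0 < d) (fd : forall u, d * nm u ^+ 2 <= complex.Re (f u u)).

Lemma coercive_inj u u' : (forall v, f u v = f u' v) -> u = u'.
Proof.
move=> h; apply/eqP; rewrite -subr_eq0; apply/eqP; apply: nm_eq0.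
have := fd (u - u'); rewrite sesqDl// sesqNl// h subrr /= => h2.
have : nm (u - u') ^+ 2 <= 0 by rewrite -(pmulr_rle0 _ d0).
by rewrite le_eqVlt ltNge sqr_ge0 orbF sqrf_eq0 => /eqP.
Qed.

(* Richardson iteration: [u - rho (T u - g)] is a contraction, where [T]
   represents [f] and [rho = d / K^2]. *)
Lemma lax_milgram (l : E -> R[i]) (N : R) : antilinear l ->
    (forall u, nm (l u) <= N * nm u) ->
  exists u, forall v, f u v = l v.
Proof.
move=> al lN; have [g gP] := riesz al lN.
have /choice[T TP] u : exists g, forall v, inner g v = f u v.
  apply: (@riesz _ (M * nm u)) => [|v]; last exact: fM.
  by split=> *; rewrite sesqE.
(* Adding [d] ensures K >= d, so that 1 - d^2 / K^2, the squared contraction factor, is not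
   negative. *)
pose K := `|M| + d; have K0 : 0 < K by rewrite ltr_wpDl.
have fK u v : nm (f u v) <= K * nm u * nm v.
  rewrite (le_trans (fM _ _))// -!mulrA ler_wpM2r ?mulr_ge0 ?nm_ge0//.
  by rewrite (le_trans (ler_norm M))// lerDl ltW.
have TB u u' v : inner (T u - T u') v = f (u - u') v.
  by rewrite !innerE !TP !(sesqE sf).
have TK u u' : nm (T u - T u') <= K * nm (u - u').
  have := fK (u - u') (T u - T u'); rewrite -TB inner_nm nmC_ge0 ?sqr_ge0//.
  have [->|t0] := eqVneq (nm (T u - T u')) 0.
    by rewrite mulr_ge0 ?nm_ge0// ltW.
  by rewrite expr2 ler_pM2r// lt_def t0 nm_ge0.
pose rho := d / K ^+ 2; pose q2 := 1 - d ^+ 2 / K ^+ 2.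
have rho0 : 0 < rho by rewrite divr_gt0// exprn_gt0.
have q2b : 0 <= q2 < 1.
  rewrite subr_ge0 ltrBlDr ltrDl divr_gt0 ?exprn_gt0// andbT.
  rewrite ler_pdivrMr ?exprn_gt0// mul1r ler_pXn2r ?nnegrE ?(ltW d0) ?(ltW K0)//.
  by rewrite /K lerDr.
pose q := Num.sqrt q2.
have qb : 0 <= q < 1.
  move/andP: q2b => [a b]; rewrite sqrtr_ge0 /= -(@ltr_pXn2r _ 2) ?nnegrE ?sqrtr_ge0//.
  by rewrite sqr_sqrtr// expr1n.
pose u n := iter n (fun u => u - rho%:C *: (T u - g)) 0.
have uS n : u n.+1 - u n = - (rho%:C *: (T (u n) - g)).
  by rewrite /u iterS addrAC subrr sub0r.
have step n : nm (u n.+2 - u n.+1) <= q * nm (u n.+1 - u n).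
  have -> : u n.+2 - u n.+1
      = (u n.+1 - u n) - rho%:C *: (T (u n.+1) - T (u n)).
    rewrite !uS !scalerBr !opprB addrA addrAC [in RHS]addrC.
    by vec.
  have [q0 q1] := andP qb.
  rewrite -(@ler_pXn2r _ 2) ?nnegrE ?mulr_ge0 ?nm_ge0// exprMn.
  rewrite sqr_sqrtr ?(andP q2b).1// sqr_nmB ripZr nmZ nmC_ge0 ?(ltW rho0)//.
  set s := T _ - T _; set dd := u n.+1 - u n.
  have h1 : nm s ^+ 2 <= K ^+ 2 * nm dd ^+ 2.
    by rewrite -exprMn ler_pXn2r ?nnegrE ?mulr_ge0 ?nm_ge0 ?TK// ltW.
  have h2 : d * nm dd ^+ 2 <= rip dd s by rewrite ripC /rip TB.
  have e1 : rho * K ^+ 2 = d by rewrite /rho mulfVK// gt_eqF// exprn_gt0.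
  have e2 : q2 = 1 - rho * d by rewrite /q2 /rho; ring.
  have h1' := ler_wpM2l (sqr_ge0 rho) h1; have h2' := ler_wpM2l (ltW rho0) h2.
  have : rho ^+ 2 * (K ^+ 2 * nm dd ^+ 2) = rho * d * nm dd ^+ 2.
    by rewrite -[in RHS]e1; ring.
  by rewrite e2 => h3; rewrite h3 in h1'; move: h1' h2'; clearbody rho; lra.
have geo n : nm (u n.+1 - u n) <= nm (u 1%N - u 0%N) * q ^+ n.
  elim: n => [|n IH]; first by rewrite expr0 mulr1.
  rewrite (le_trans (step _))// exprS mulrCA ler_wpM2l//.
  by case/andP: qb.
have [w uw _] := geom_tends qb (fun n (_ : (0 <= n)%N) => geo n).
exists w => v; rewrite -gP -TP; congr (inner _ v).
have Tw : tends (fun n => T (u n)) (T w) by apply: tends_map uw => x y; exact: TK.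
apply: tends_uniq Tw _ => e e0.
have [n0 h0] := uw (rho * e / 2) ltac:(by rewrite divr_gt0// mulr_gt0).
exists n0 => n hn; rewrite -(ler_pM2l rho0) -[X in X * _](ger0_norm (ltW rho0)).
rewrite -nmC -nmZ -nmN -uS (le_trans (nm_tri w _ _))//.
by have := h0 _ hn; have := h0 n.+1 (leqW hn); rewrite (nmBC w); lra.
Qed.

End Riesz.

(** * Resolvents of the operator associated with a form *)

Section Cone.
Variable R : realType.
Implicit Types (e r t : R) (z : R[i]).

(** For e > 0, the closed sector of half-angle atan e around the positive axis, as an inequality
    free of arguments of complex numbers. *)
Definition cone e z : bool :=
  `|complex.Im z| <= e * complex.Re z.

Definition adm e r z : bool := cone e z && (nm z <= r).

Lemma cone_Re e z : 0 < e -> cone e z -> 0 <= complex.Re z.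
Proof. by move=> e0 h; rewrite -(pmulr_rge0 _ e0) (le_trans _ h). Qed.

Lemma cone_nm e z : 0 < e -> e <= 1 -> cone e z -> nm z <= 2 * complex.Re z.
Proof.
move=> e0 e1 h; have r0 := cone_Re e0 h; rewrite (le_trans (nm_ReIm z))//.
rewrite (ger0_norm r0); have : e * complex.Re z <= complex.Re z by rewrite ler_piMl.
by move: h; rewrite /cone; lra.
Qed.

Lemma cone_Re_gt0 e z : 0 < e -> e <= 1 -> cone e z -> z != 0 -> 0 < complex.Re z.
Proof.
move=> e0 e1 h /nm_gt0; have := cone_nm e0 e1 h; lra.
Qed.

Lemma coneJ e z : cone e (Num.conj z) = cone e z.
Proof. by rewrite /cone cReJ cImJ normrN. Qed.

Lemma admJ e r z : adm e r (Num.conj z) = adm e r z.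
Proof. by rewrite /adm coneJ nmJ. Qed.

Lemma posC_neq0 t : 0 < t -> (t%:C : R[i]) != 0.
Proof. by move=> t0; apply: lt0r_neq0; rewrite ltcR. Qed.

Lemma adm_pos e r t : 0 <= e -> 0 <= t -> t <= r -> adm e r t%:C.
Proof. by move=> *; rewrite /adm /cone /= normr0 mulr_ge0//= nmC_ge0. Qed.

End Cone.

Section FormResolvent.
Variables (R : realType) (E X : hilbertType R) (iota : {linear E -> X}).

(** The conditions are invariant under [adj], so each estimate also holds for the adjoint form with
    the same constants. [fb_epsM] keeps z f coercive for z in the cone, up to a multiple of |iota
    u|^2. *)
Record form_bounds (f : E -> E -> R[i]) (M d om eps : R) : Prop := FormBounds {
  fb_sesq : sesq f;
  fb_M0 : 0 <= M;
  fb_d0 : 0 < d;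
  fb_om0 : 0 <= om;
  fb_eps0 : 0 < eps;
  fb_eps1 : eps <= 1;
  fb_epsM : eps * M <= d / 2;
  fb_iota : forall u, nm (iota u) <= M * nm u;
  fb_bounded : forall u v, nm (f u v) <= M * nm u * nm v;
  fb_elliptic : forall u,
    d * nm u ^+ 2 <= complex.Re (f u u) + om * nm (iota u) ^+ 2 }.

Lemma form_bounds_adj f M d om eps :
  form_bounds f M d om eps -> form_bounds (adj f) M d om eps.
Proof.
case=> *; split=> //; first exact: sesq_adj.
- by move=> u v; rewrite /adj nmJ mulrAC.
- by move=> u; rewrite /adj cReJ.
Qed.

Variables (f : E -> E -> R[i]) (M d om eps : R).
Hypothesis fb : form_bounds f M d om eps.

(** Chosen to give om |z| <= 1/2 for admissible z; the added 1 covers om = 0. *)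
Definition step_radius : R := (2 * (om + 1))^-1.

Let step_adm := adm eps step_radius.

Lemma step_radius_gt0 : 0 < step_radius.
Proof. by rewrite invr_gt0 mulr_gt0// ltr_wpDl// (fb_om0 fb). Qed.

Lemma step_om z : step_adm z -> om * nm z <= 1 / 2.
Proof.
move=> /andP[_ h]; have o0 := fb_om0 fb.
have : nm z * (2 * (om + 1)) <= 1.
  by rewrite -ler_pdivlMr ?div1r// mulr_gt0// ltr_wpDl.
by have := nm_ge0 z; lra.
Qed.

(** Re (z f) = Re z Re f - Im z Im f, and on the cone the second product is at most eps M Re z
    |u|^2, that is, half of what ellipticity provides. *)
Lemma Re_zf z u : cone eps z ->
  complex.Re z * (d / 2) * nm u ^+ 2
    <= complex.Re (z * f u u) + om * nm z * nm (iota u) ^+ 2.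
Proof.
move=> cz; have r0 := cone_Re (fb_eps0 fb) cz.
have := ler_wpM2l r0 (fb_elliptic fb u); rewrite cReM => h1.
have fI : `|complex.Im (f u u)| <= M * nm u ^+ 2.
  by rewrite (le_trans (Im_nm _))// expr2 mulrA (fb_bounded fb).
have h2 : complex.Im z * complex.Im (f u u) <= complex.Re z * (d / 2) * nm u ^+ 2.
  rewrite (le_trans (ler_norm _))// normrM.
  rewrite (le_trans (ler_pM _ _ cz fI))//.
  have := ler_wpM2r (mulr_ge0 r0 (sqr_ge0 (nm u))) (fb_epsM fb); lra.
have h3 : complex.Re z * nm (iota u) ^+ 2 <= nm z * nm (iota u) ^+ 2.
  by rewrite ler_wpM2r ?sqr_ge0// (le_trans (ler_norm _))// Re_nm.
have := ler_wpM2l (fb_om0 fb) h3; lra.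
Qed.

Definition shifted z u v : R[i] := inner (iota u) (iota v) + z * f u v.

Lemma sesq_shifted z : sesq (shifted z).
Proof.
have sf := fb_sesq fb.
split=> *; rewrite /shifted ?(linearD iota) ?(linearZ_LR iota) /= !innerE !(sesqE sf); ring.
Qed.

(** The solution is kept in [E], before the embedding, because its norm there is the energy that
    [res_energy] controls. *)
Definition res_lift z x : E :=
  xget 0 [set u | forall v, shifted z u v = inner x (iota v)].

Section Step.
Variable z : R[i].
Hypotheses (az : step_adm z) (z0 : z != 0).

Let cz : cone eps z. Proof. by case/andP: az. Qed.

Let Rez : 0 < complex.Re z.
Proof. exact: cone_Re_gt0 (fb_eps0 fb) (fb_eps1 fb) cz z0. Qed.

Lemma shifted_coercive u :
  complex.Re z * (d / 2) * nm u ^+ 2 <= complex.Re (shifted z u u).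
Proof.
rewrite /shifted cReD inner_nm /=; have := Re_zf u cz.
have := ler_wpM2r (sqr_ge0 (nm (iota u))) (step_om az).
have := sqr_ge0 (nm (iota u)); lra.
Qed.

Let zd0 : 0 < complex.Re z * (d / 2).
Proof. by rewrite mulr_gt0// divr_gt0// (fb_d0 fb). Qed.

Lemma liftP x v : shifted z (res_lift z x) v = inner x (iota v).
Proof.
rewrite /res_lift; case: xgetP => [u _ /(_ v)//|H].
have [|||u uP] := @lax_milgram R E (shifted z) (M * M + nm z * M) _
  (sesq_shifted z) _ zd0 shifted_coercive (fun v => inner x (iota v)) (nm x * M).
- move=> u w; rewrite /shifted (le_trans (nmD _ _))// nmM.
  rewrite [leRHS](_ : _ = M * nm u * (M * nm w) + nm z * (M * nm u * nm w)); last by ring.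
  rewrite lerD//; last by rewrite ler_wpM2l ?nm_ge0// (fb_bounded fb).
  by rewrite (le_trans (nm_inner_le _ _))// ler_pM ?nm_ge0// (fb_iota fb).
- by split=> *; rewrite ?(linearD iota) ?(linearZ_LR iota) /= !innerE.
- move=> u; rewrite (le_trans (nm_inner_le _ _))// -mulrA ler_wpM2l ?nm_ge0//.
  exact: (fb_iota fb).
by have := H u uP.
Qed.

Lemma lift_uniq x u : (forall v, shifted z u v = inner x (iota v)) -> u = res_lift z x.
Proof.
move=> h; apply: (coercive_inj (sesq_shifted z) zd0 shifted_coercive) => v.
by rewrite h liftP.
Qed.

Lemma lift_linear : linear (res_lift z).
Proof.
move=> a x y; apply/esym/lift_uniq => v.
by rewrite !(sesqE (sesq_shifted z)) !liftP !innerE.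
Qed.

End Step.

(* The resolvent [(1 + z A)^-1], with the junk value [x] off the admissible [z]. *)
Definition res_fun z x : X :=
  if step_adm z && (z != 0) then iota (res_lift z x) else x.

Lemma res_fun_linear z : linear (res_fun z).
Proof.
move=> a x y; rewrite /res_fun; case: ifPn => // /andP[az z0].
by rewrite lift_linear// linearP.
Qed.

HB.instance Definition _ z :=
  GRing.isLinear.Build R[i] X X *:%R (res_fun z) (res_fun_linear z).

Definition res z : {linear X -> X} := res_fun z.

Definition assoc : set (X * X) :=
  [set p | exists2 u, iota u = p.1 & forall v, f u v = inner p.2 (iota v)].

Lemma resE z x : step_adm z -> z != 0 -> res z x = iota (res_lift z x).
Proof. by move=> az z0; rewrite /res /= /res_fun az z0. Qed.

Lemma res0 x : res 0 x = x.
Proof. by rewrite /res /= /res_fun eqxx andbF. Qed.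

Lemma res_fix z x y : step_adm z -> assoc (x, y) -> res z (x + z *: y) = x.
Proof.
move=> az; have [->|z0] := eqVneq z 0; first by rewrite res0 scale0r addr0.
case=> u /= <- uy; rewrite resE//; congr (iota _); apply/esym/lift_uniq => // v.
by rewrite /shifted uy !innerE.
Qed.

Lemma res_shift z x v : step_adm z -> z != 0 ->
  z * f (res_lift z x) v = inner (x - res z x) (iota v).
Proof. by move=> az z0; rewrite resE// !innerE -(liftP az z0) /shifted addrAC subrr add0r. Qed.

Lemma res_ran z x : step_adm z -> z != 0 ->
  assoc (res z x, z^-1 *: (x - res z x)).
Proof.
move=> az z0; exists (res_lift z x) => /=; first by rewrite resE.
by move=> v; rewrite sesqZl ?sesq_inner; [rewrite -res_shift// mulKf|exact: sesq_inner].
Qed.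

Lemma assocD (x x' y y' : X) : assoc (x, y) -> assoc (x', y') ->
  assoc (x + x', y + y').
Proof.
move=> [u /= <- uP] [u' /= <- uP']; exists (u + u'); rewrite /= ?linearD//.
by move=> v; rewrite (sesqDl (fb_sesq fb)) uP uP' innerE.
Qed.

Lemma assocZ a (x y : X) : assoc (x, y) -> assoc (a *: x, a *: y).
Proof.
move=> [u /= <- uP]; exists (a *: u); rewrite /= ?linearZ//.
by move=> v; rewrite (sesqZl (fb_sesq fb)) uP innerE.
Qed.

(** Testing the equation with its solution gives (1 - s) |J x| <= |x| with s = om |z|, and (1 + 2
    s)(1 - s) >= 1 for 0 <= s <= 1/2. *)
Lemma res_bound z x : step_adm z -> nm (res z x) <= (1 + 2 * om * nm z) * nm x.
Proof.
move=> az; have o0 := fb_om0 fb; have n0 := nm_ge0 z.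
have [->|z0] := eqVneq z 0; first by rewrite res0 nm0 mulr0 addr0 mul1r.
have cz : cone eps z by case/andP: az.
have := Re_zf (res_lift z x) cz; rewrite res_shift// -resE// -/(rip _ _).
set y := res z x; rewrite ripDl ripNl -sqr_nm => h.
have h1 := rip_le x y; have h2 := step_om az.
have h3 : 0 <= complex.Re z * (d / 2) * nm (res_lift z x) ^+ 2.
  by rewrite !mulr_ge0 ?sqr_ge0 ?(cone_Re (fb_eps0 fb) cz) ?invr_ge0 ?(ltW (fb_d0 fb)) ?nm_ge0.
have [y0|y0] := eqVneq (nm y) 0.
  by rewrite y0 mulr_ge0 ?nm_ge0// addr_ge0// !mulr_ge0.
have yp : 0 < nm y by rewrite lt_def y0 nm_ge0.
have h4 : (1 - om * nm z) * nm y <= nm x.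
  by rewrite -(ler_pM2r yp); move: h; rewrite expr2; lra.
have o2 : 0 <= om * nm z by rewrite mulr_ge0.
have h5 : 0 <= 1 + 2 * om * nm z by rewrite addr_ge0// !mulr_ge0.
have := ler_wpM2l h5 h4; have := mulr_ge0 o2 (ltW yp).
have : 0 <= (om * nm z) * (1 / 2 - om * nm z) * nm y.
  by rewrite !mulr_ge0 ?nm_ge0// subr_ge0.
lra.
Qed.

(** The same test, with 2 Re (x - y|y) <= |x|^2 - |y|^2 for y = J x: the right-hand side telescopes
    along iterates of J. *)
Lemma res_energy z x : step_adm z -> z != 0 ->
  complex.Re z * d * nm (res_lift z x) ^+ 2
    <= nm x ^+ 2 - nm (res z x) ^+ 2 + 2 * om * nm z * nm (res z x) ^+ 2.
Proof.
move=> az z0; have cz : cone eps z by case/andP: az.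
have := Re_zf (res_lift z x) cz; rewrite res_shift// -resE// -/(rip _ _).
set y := res z x; rewrite ripDl ripNl -sqr_nm => h.
by have := sqr_ge0 (nm (x - y)); rewrite sqr_nmB; lra.
Qed.

Lemma res_contractive z x : 0 <= z -> step_adm z ->
  (forall u, 0 <= complex.Re (f u u)) -> nm (res z x) <= nm x.
Proof.
move=> zpos az acc; have [->|z0] := eqVneq z 0; first by rewrite res0.
have := acc (res_lift z x); have zE : (complex.Re z)%:C = z by rewrite RRe_real ?ger0_real.
have rz : 0 <= complex.Re z by rewrite -ler0c zE.
move=> /(mulr_ge0 rz); rewrite -cReCM zE res_shift// -resE// -/(rip _ _).
rewrite ripDl ripNl -sqr_nm => h.
rewrite -(@ler_pXn2r _ 2) ?nnegrE ?nm_ge0//.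
by have := sqr_ge0 (nm (x - res z x)); rewrite sqr_nmB; lra.
Qed.

Hypothesis iota_dense : forall x (e : R), 0 < e -> exists u, nm (x - iota u) <= e.

(* With [w = res_lift z (iota u) - u], testing the resolvent equation with [w]
   gives [|iota w|^2 + z f(w, w) = - z f(u, w)]. *)
Lemma res_iota_small u (e : R) : 0 < e ->
  exists2 t : R, 0 < t <= step_radius & nm (res t%:C (iota u) - iota u) <= e.
Proof.
move=> e0; have [c c0 hc] := sqr_small e0.
have sp := step_radius_gt0.
(* Young's inequality on M |u| |w| with weight [d] leaves |iota w|^2 <= t (M |u|)^2 / d; the added 1
   makes [B] positive. *)
pose B := (M * nm u) ^+ 2 / d + 1.
have B0 : 0 < B by rewrite ltr_wpDl// divr_ge0 ?sqr_ge0// (ltW (fb_d0 fb)).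
pose t := Num.min step_radius (c / B).
have t0 : 0 < t by rewrite lt_min sp divr_gt0.
have tr : t <= step_radius by rewrite ge_min lexx.
have tc : t * B <= c by rewrite -ler_pdivlMr// ge_min lexx orbT.
have az : step_adm t%:C.
  by rewrite /step_adm adm_pos ?(ltW t0) ?(ltW (fb_eps0 fb)).
have z0 : (t%:C : R[i]) != 0 by rewrite posC_neq0.
exists t; first by rewrite t0.
apply: hc; apply: le_trans tc; rewrite resE// -linearB.
set w := res_lift _ _ - u.
have key : shifted t%:C w w = - (t%:C * f u w).
  rewrite /w {1}(sesqDl (sesq_shifted _)) (sesqNl (sesq_shifted _)) liftP//.
  by rewrite {1}/shifted; ring.
have h1 : complex.Re (shifted t%:C w w) <= t * (M * nm u * nm w).
  rewrite key cReN cReCM -mulrN ler_wpM2l ?(ltW t0)// -cReN.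
  by rewrite (le_trans (ler_norm _))// (le_trans (Re_nm _))// nmN (fb_bounded fb).
have h2 : nm (iota w) ^+ 2 / 2 + t * (d / 2) * nm w ^+ 2 <= complex.Re (shifted t%:C w w).
  rewrite /shifted cReD inner_nm /= cReCM.
  have := ler_wpM2l (ltW t0) (fb_elliptic fb w).
  have := step_om az; rewrite nmC_ge0 ?(ltW t0)// => /(ler_wpM2r (sqr_ge0 (nm (iota w)))).
  have := mulr_ge0 (mulr_ge0 (ltW t0) (ltW (fb_d0 fb))) (sqr_ge0 (nm w)).
  lra.
have h3 : M * nm u * nm w <= (M * nm u) ^+ 2 / (2 * d) + d / 2 * nm w ^+ 2.
  have d0 := fb_d0 fb.
  have : 0 <= (M * nm u - d * nm w) ^+ 2 / (2 * d).
    by rewrite divr_ge0 ?sqr_ge0// mulr_ge0// ltW.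
  rewrite (_ : _ / _ = (M * nm u) ^+ 2 / (2 * d) - M * nm u * nm w + d / 2 * nm w ^+ 2).
    by lra.
  by field; rewrite gt_eqF.
have h4 := ler_wpM2l (ltW t0) h3.
have : (M * nm u) ^+ 2 / (2 * d) * 2 = B - 1.
  by rewrite /B; field; rewrite gt_eqF// (fb_d0 fb).
move=> h5; have := le_trans h2 h1; have : t * B = t * ((M * nm u) ^+ 2 / (2 * d) * 2) + t.
  by rewrite h5; ring.
by move=> ->; lra.
Qed.

Lemma assoc_dense x (e : R) : 0 < e ->
  exists2 p, assoc p & nm (x - p.1) <= e.
Proof.
move=> e0; have e2 : 0 < e / 2 by rewrite divr_gt0.
have [u hu] := iota_dense x e2.
have [t /andP[t0 tr] ht] := res_iota_small u e2.
have az : step_adm t%:C.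
  by rewrite /step_adm adm_pos ?(ltW t0) ?(ltW (fb_eps0 fb)).
have z0 : (t%:C : R[i]) != 0 by rewrite posC_neq0.
exists (res t%:C (iota u), t%:C^-1 *: (iota u - res t%:C (iota u))) => /=.
  exact: res_ran.
rewrite (le_trans (nm_tri (iota u) _ _))// [leRHS]splitr lerD//.
by rewrite nmBC.
Qed.

End FormResolvent.

(** * Adjoint resolvents and the smoothing estimate *)

Section Smoothing.
Variables (R : realType) (E X : hilbertType R) (iota : {linear E -> X}).
Variables (f : E -> E -> R[i]) (M d om eps : R).
Hypothesis fb : form_bounds iota f M d om eps.

Let fb' := form_bounds_adj fb.
Local Notation J := (res fb).
Local Notation J' := (res fb').

Lemma res_adj z x y : adm eps (step_radius om) z ->
  inner (J z x) y = inner x (J' (Num.conj z) y).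
Proof.
move=> az; have [->|z0] := eqVneq z 0; first by rewrite rmorph0 !res0.
have az' : adm eps (step_radius om) (Num.conj z) by rewrite admJ.
have z0' : Num.conj z != 0 by rewrite conjC_eq0.
rewrite !resE// -(liftP fb az z0) [LHS]innerC -(liftP fb' az' z0').
by rewrite /shifted /adj rmorphD rmorphM /= !conjCK -innerC.
Qed.

Lemma res_adj_iter z x y n : adm eps (step_radius om) z ->
  inner (iter n (J z) x) y = inner x (iter n (J' (Num.conj z)) y).
Proof.
by move=> az; elim: n x y => // n IH x y; rewrite iterSr IH res_adj// -iterS.
Qed.

(** Sums [res_energy] over the iterates. The form is a parameter because [smoothing] needs both [f]
    and its adjoint. *)
Lemma sum_energy (g : E -> E -> R[i]) (gb : form_bounds iota g M d om eps) z x n K :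
    adm eps (step_radius om) z -> z != 0 ->
    (forall k, (k <= n)%N -> nm (iter k (res gb z) x) <= K * nm x) ->
  complex.Re z * d * \sum_(k < n) nm (res_lift iota g z (iter k (res gb z) x)) ^+ 2
    <= (1 + 2 * om * (nm z *+ n) * K ^+ 2) * nm x ^+ 2.
Proof.
move=> az z0 hK.
have om0 : 0 <= 2 * om * nm z by rewrite !mulr_ge0 ?nm_ge0 ?(fb_om0 gb).
suff h m : (m <= n)%N ->
    complex.Re z * d * \sum_(k < m) nm (res_lift iota g z (iter k (res gb z) x)) ^+ 2
    <= nm x ^+ 2 - nm (iter m (res gb z) x) ^+ 2
       + 2 * om * (nm z *+ m) * (K ^+ 2 * nm x ^+ 2).
  by have := h n (leqnn _); have := sqr_ge0 (nm (iter n (res gb z) x)); lra.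
elim: m => [_|m IH hm]; first by rewrite big_ord0 mulr0n !mulr0 mul0r subrr addr0.
rewrite big_ord_recr /= mulrDr.
have := IH (ltnW hm); have := res_energy (gb) (iter m (res gb z) x) az z0.
have : nm (iter m.+1 (res gb z) x) ^+ 2 <= K ^+ 2 * nm x ^+ 2.
  by rewrite -exprMn ler_pXn2r ?nnegrE ?nm_ge0 ?hK// (le_trans _ (hK _ hm)) ?nm_ge0.
move=> /(ler_wpM2l om0) /=; rewrite mulrSr; lra.
Qed.

(* All the values [f (res_lift (J^k x)) (res_lift' (J'^l y))] with [k + l = n - 1] agree;
   averaging them bounds the generator applied to [J^n] by [C / n]. *)
Lemma smoothing z x n K : adm eps (step_radius om) z -> z != 0 ->
    (forall k, (k <= n)%N -> forall x, nm (iter k (J z) x) <= K * nm x) ->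
    (forall k, (k <= n)%N -> forall x, nm (iter k (J' (Num.conj z)) x) <= K * nm x) ->
  n%:R * nm (iter n (J z) x - iter n.+1 (J z) x)
    <= 2 * M / d * (1 + 2 * om * (nm z *+ n) * K ^+ 2) * nm x.
Proof.
move=> az z0 hK hK'.
have az' : adm eps (step_radius om) (Num.conj z) by rewrite admJ.
have z0' : Num.conj z != 0 by rewrite conjC_eq0.
pose p k := res_lift iota f z (iter k (J z) x).
pose q y l := res_lift iota (adj f) (Num.conj z) (iter l (J' (Num.conj z)) y).
set D := _ - _.
have fpq y k l : (k + l).+1 = n -> z * f (p k) (q y l) = inner D y.
  move=> kl; rewrite (res_shift fb)// -(resE fb')//.
  rewrite -[J' _ _]/(iter l.+1 (J' (Num.conj z)) y) -res_adj_iter// /D -kl.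
  congr (inner _ _).
  rewrite linearB -[J z _]/(iter k.+1 (J z) x); congr (_ - _).
    by rewrite -[LHS]/(iter l.+1 _ _) -iterD addSn addnC.
  by rewrite -[LHS]/(iter l.+1 _ (iter k.+1 _ _)) -iterD addSn addnS addnC.
set S := 1 + _.
have d0 := fb_d0 fb; have M0 := fb_M0 fb.
have cz : cone eps z by case/andP: az.
have nz := cone_nm (fb_eps0 fb) (fb_eps1 fb) cz.
have rz := cone_Re (fb_eps0 fb) cz.
have key y : n%:R * nm (inner D y) * d <= M * S * (nm x ^+ 2 + nm y ^+ 2).
  have hp := sum_energy (gb := fb) az z0 (fun k hk => hK k hk x).
  have hq := sum_energy (gb := fb') az' z0' (fun k hk => hK' k hk y).
  rewrite nmJ cReJ -/S in hq; rewrite -/S in hp.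
  have h : n%:R * nm (inner D y) <=
      nm z * M * (\sum_(k < n) nm (p k) ^+ 2 + \sum_(k < n) nm (q y k) ^+ 2) / 2.
    (* Reversing the second sum pairs [p k] with [q y (n - k - 1)], the indices that [fpq] links. *)
    rewrite [X in _ + X](reindex_inj rev_ord_inj) /= -big_split /=.
    have -> : n%:R * nm (inner D y) = \sum_(k < n) nm (inner D y).
      by rewrite sumr_const card_ord mulr_natl.
    rewrite mulr_sumr mulr_suml; apply: ler_sum => k _.
    rewrite -(@fpq y k (n - k.+1)%N); last by rewrite -addSn subnKC.
    rewrite nmM -!mulrA ler_wpM2l ?nm_ge0//.
    rewrite (le_trans (fb_bounded fb _ _))// -!mulrA ler_wpM2l//.
    by have := sqr_ge0 (nm (p k) - nm (q y (n - k.+1)%N)); lra.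
  have sp : 0 <= \sum_(k < n) nm (p k) ^+ 2 by apply: sumr_ge0 => k _; exact: sqr_ge0.
  have sq : 0 <= \sum_(k < n) nm (q y k) ^+ 2 by apply: sumr_ge0 => k _; exact: sqr_ge0.
  have h1 := ler_wpM2r (ltW d0) h; rewrite (le_trans h1)//.
  have h2 := ler_wpM2r (mulr_ge0 (mulr_ge0 M0 (ltW d0)) (addr_ge0 sp sq)) nz.
  have h3 := ler_wpM2l M0 (lerD hp hq).
  move: h2 h3; rewrite -/p -/(q y).
  move: (\sum_(_ < _) _) (\sum_(_ < _) _) => P Q; lra.
have [x0|x0] := eqVneq (nm x) 0.
  have -> : D = 0.
    rewrite /D (nm_eq0 x0); suff h k : iter k (J z) 0 = 0 by rewrite !h subrr.
    by elim: k => // k IH; rewrite iterS IH linear0.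
  by rewrite nm0 x0 !mulr0.
have xp : 0 < nm x by rewrite lt_def x0 nm_ge0.
have [D0|D0] := eqVneq (nm D) 0.
  (* With y = 0, [key] says that M S is not negative. *)
  have := key 0; rewrite (sesq0r (@sesq_inner R X)) !nm0 expr0n addr0 !mulr0 mul0r.
  rewrite pmulr_lge0 ?exprn_gt0// D0 mulr0 => MS.
  by rewrite mulr_ge0 ?nm_ge0// mulrAC mulr_ge0 ?invr_ge0 ?(ltW d0)// -mulrA mulr_ge0.
have Dp : 0 < nm D by rewrite lt_def D0 nm_ge0.
(* The dual vector is aligned with [D] and scaled to the norm of [x], which balances |x|^2 +
   |y|^2. *)
have := key ((nm x / nm D)%:C *: D).
rewrite (sesqZr (@sesq_inner R X)) inner_nm conjCr -rmorphM nmC_ge0; last first.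
  by rewrite !mulr_ge0 ?invr_ge0 ?sqr_ge0 ?nm_ge0.
rewrite nmZ nmC_ge0 ?divr_ge0 ?nm_ge0// mulfVK//.
rewrite (_ : nm x / nm D * nm D ^+ 2 = nm x * nm D); last by field.
move=> h; rewrite -(ler_pM2r d0) -(ler_pM2r xp).
rewrite [leRHS](_ : _ = M * S * (nm x ^+ 2 + nm x ^+ 2)); first by move: h; lra.
by field; rewrite gt_eqF.
Qed.

End Smoothing.

(* [J z] is the resolvent [(1 + z A)^-1] for all small [z] in the closed sector
   [|Im z| <= eps Re z]. *)
Record resolvents (R : realType) (X : hilbertType R) (A : set (X * X))
    (J : R[i] -> {linear X -> X}) (eps r c : R) : Prop := Resolvents {
  rs_eps0 : 0 < eps;
  rs_r0 : 0 < r;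
  rs_c0 : 0 <= c;
  rs_AD : forall x x' y y', A (x, y) -> A (x', y') -> A (x + x', y + y');
  rs_AZ : forall a x y, A (x, y) -> A (a *: x, a *: y);
  rs_J0 : forall x, J 0 x = x;
  rs_fix : forall z x y, adm eps r z -> A (x, y) -> J z (x + z *: y) = x;
  rs_ran : forall z x, adm eps r z -> z != 0 -> A (J z x, z^-1 *: (x - J z x));
  rs_bound : forall z x, adm eps r z -> nm (J z x) <= (1 + c * nm z) * nm x;
  rs_dense : forall x (e : R), 0 < e -> exists2 p, A p & nm (x - p.1) <= e }.

Section Resolvents.
Variables (R : realType) (X : hilbertType R) (A : set (X * X)).
Variables (J : R[i] -> {linear X -> X}) (eps r c : R).
Hypothesis rs : resolvents A J eps r c.
Local Notation admr := (adm eps r).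
Implicit Types (x y : X) (z w : R[i]) (e t : R).

Lemma AN x y : A (x, y) -> A (- x, - y).
Proof. by move=> /(rs_AZ rs (-1)); rewrite !scaleN1r. Qed.

Lemma AB x x' y y' : A (x, y) -> A (x', y') -> A (x - x', y - y').
Proof. by move=> h /AN; exact: (rs_AD rs h). Qed.

Lemma J_id z x y : admr z -> A (x, y) -> J z x = x - z *: J z y.
Proof.
by move=> az /(rs_fix rs az); rewrite linearD linearZ /= => h; rewrite -[in RHS]h addrK.
Qed.

Lemma A_J z x y : admr z -> A (x, y) -> A (J z x, J z y).
Proof.
move=> az Axy; have [->|z0] := eqVneq z 0; first by rewrite !(rs_J0 rs).
rewrite {1}(J_id az Axy).
have := AB Axy (rs_AZ rs z (rs_ran rs y az z0)).
by rewrite scalerA mulfV// scale1r opprB addrCA subrr addr0.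
Qed.

Lemma J_comm z w x : admr z -> admr w -> J z (J w x) = J w (J z x).
Proof.
move=> az aw; have [->|w0] := eqVneq w 0; first by rewrite !(rs_J0 rs).
have := rs_fix rs aw (A_J az (rs_ran rs x aw w0)).
by rewrite linearZ linearB /= scalerA mulfV// scale1r addrC subrK.
Qed.

(** Describes the graph by one bounded operator; limits in the graph and both generators are
    identified with A through it. *)
Lemma A_iff z x y : admr z -> z != 0 -> A (x, y) <-> J z (x + z *: y) = x.
Proof.
move=> az z0; split; first exact: (rs_fix rs).
move=> h; have := rs_ran rs (x + z *: y) az z0.
by rewrite h addrAC subrr add0r scalerA mulVf// scale1r.
Qed.

Lemma adm_r : admr r%:C.
Proof. by rewrite adm_pos ?(ltW (rs_eps0 rs)) ?(ltW (rs_r0 rs)). Qed.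

Lemma r_neq0 : (r%:C : R[i]) != 0.
Proof. exact/posC_neq0/(rs_r0 rs). Qed.

Definition Jb : R := 1 + c * r.

Lemma Jb_ge1 : 1 <= Jb.
Proof. by rewrite lerDl mulr_ge0 ?(rs_c0 rs)// ltW// (rs_r0 rs). Qed.

Lemma Jb_gt0 : 0 < Jb.
Proof. exact: lt_le_trans ltr01 Jb_ge1. Qed.

Lemma J_bound z x : admr z -> nm (J z x) <= Jb * nm x.
Proof.
move=> az; rewrite (le_trans (rs_bound rs _ az))// ler_wpM2r ?nm_ge0//.
by rewrite lerD2l ler_wpM2l ?(rs_c0 rs)//; case/andP: az.
Qed.

Lemma A_closed (u v : nat -> X) x y : (forall n, A (u n, v n)) ->
  tends u x -> tends v y -> A (x, y).
Proof.
move=> Auv ux vy; apply/(A_iff _ _ adm_r r_neq0).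
apply: (tends_uniq (u := u)) => //.
apply: (@tends_ext _ _ (fun n => J r%:C (u n + r%:C *: v n))).
  by exists 0%N => n _; apply: (rs_fix rs adm_r).
apply: (@tends_map _ _ _ (J r%:C) (fun n => u n + r%:C *: v n) _ Jb).
  by move=> a b; rewrite -linearB J_bound// adm_r.
by apply: tendsD => //; exact: tendsZ.
Qed.

Lemma J_lip z x y : admr z -> A (x, y) -> nm (J z x - x) <= nm z * (Jb * nm y).
Proof.
move=> az Axy; rewrite (J_id az Axy) addrAC subrr add0r nmN nmZ.
by rewrite ler_wpM2l ?nm_ge0// J_bound.
Qed.

Lemma J_to_id x e : 0 < e ->
  exists2 t, 0 < t <= r & forall z, admr z -> nm z <= t -> nm (J z x - x) <= e.
Proof.
move=> e0; have b0 := Jb_gt0.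
have k0 : 0 < 2 * (Jb + 1) by rewrite mulr_gt0// ltr_wpDl// ltW.
have [[x' y'] A' /= h] := rs_dense rs x (divr_gt0 e0 k0).
pose B := 2 * (Jb * nm y') + 1.
have B0 : 0 < B by rewrite ltr_wpDl// !mulr_ge0 ?nm_ge0// ltW.
exists (Num.min r (e / B)) => [|z az]; first by rewrite lt_min (rs_r0 rs) divr_gt0//= ge_min lexx.
rewrite le_min => /andP[_ zB].
have h1 := J_lip az A'; have h2 := J_bound (x - x') az.
have -> : J z x - x = J z (x - x') + (J z x' - x') - (x - x').
  by rewrite linearB /=; vec.
rewrite (le_trans (nmB _ _))//; have := nmD (J z (x - x')) (J z x' - x').
move: h zB; rewrite !ler_pdivlMr// /B => h zB.
by have := nm_ge0 z; lra.
Qed.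

(** J(t) with small t regularises [x] and its image together: D(A^2) is dense in D(A) for the graph
    norm, which later frees the Taylor estimates from A^2. *)
Lemma smooth_dense x y e : 0 < e -> A (x, y) -> exists x' y' y2,
  [/\ A (x', y'), A (y', y2), nm (x - x') <= e & nm (y - y') <= e].
Proof.
move=> e0 Axy; have [t1 /andP[t10 t1r] h1] := J_to_id x e0.
have [t2 /andP[t20 t2r] h2] := J_to_id y e0.
pose t := Num.min t1 t2; have t0 : 0 < t by rewrite lt_min t10.
have tr : t <= r by rewrite ge_min t1r.
have at_ : admr t%:C by rewrite adm_pos ?(ltW (rs_eps0 rs)) ?(ltW t0).
exists (J t%:C x), (J t%:C y), (t%:C^-1 *: (y - J t%:C y)); split.
- exact: A_J.
- by apply: (rs_ran rs) => //; exact: posC_neq0.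
- by rewrite nmBC h1// nmC_ge0 ?(ltW t0)// ge_min lexx.
- by rewrite nmBC h2// nmC_ge0 ?(ltW t0)// ge_min lexx orbT.
Qed.

Definition DA2 : set X := [set x | exists y y2, A (x, y) /\ A (y, y2)].

Lemma DA2_dense x e : 0 < e -> exists2 x', DA2 x' & nm (x - x') <= e.
Proof.
move=> e0; have e2 : 0 < e / 2 by rewrite divr_gt0.
have [[x1 y1] A1 /= h1] := rs_dense rs x e2.
have [x' [y' [y2 [A' A2 h2 _]]]] := smooth_dense e2 A1.
exists x'; first by exists y', y2.
by rewrite (le_trans (nm_tri x1 _ _))// [leRHS]splitr lerD.
Qed.

End Resolvents.

Lemma dense_eq (R : realType) (X : hilbertType R) (D : set X)
    (F G : {linear X -> X}) (K : R) :
    (forall x (e : R), 0 < e -> exists2 x', D x' & nm (x - x') <= e) ->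
    (forall x, nm (F x) <= K * nm x) -> (forall x, nm (G x) <= K * nm x) ->
    (forall x, D x -> F x = G x) ->
  forall x, F x = G x.
Proof.
move=> dD FK GK FG x; apply/eqP; rewrite -subr_eq0; apply/eqP; apply: nm_eq0.
apply/eqP; rewrite eq_le nm_ge0 andbT; apply/ler_addgt0Pr => e e0; rewrite add0r.
have K0 : 0 < 2 * (`|K| + 1) by rewrite mulr_gt0// ltr_wpDl.
have [x' Dx' h] := dD x _ (divr_gt0 e0 K0).
have -> : F x - G x = F (x - x') - G (x - x') by rewrite !linearB /= (FG _ Dx'); vec.
rewrite (le_trans (nmB _ _))//; have := FK (x - x'); have := GK (x - x').
move: h; rewrite ler_pdivlMr// => h.
by have := ler_wpM2r (nm_ge0 (x - x')) (ler_norm K); have := nm_ge0 (x - x'); lra.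
Qed.

(* Telescoping: [P^n - Q^n = \sum_i P^i Q^(n-1-i) (P - Q)]. *)
Lemma iter_dist (R : realType) (X : hilbertType R) (P Q : {linear X -> X}) (p : R) n x :
    1 <= p -> (forall x, nm (P x) <= p * nm x) -> (forall x, nm (Q x) <= p * nm x) ->
    (forall x, P (Q x) = Q (P x)) ->
  nm (iter n P x - iter n Q x) <= n%:R * p ^+ n * nm (P x - Q x).
Proof.
move=> p1 hP hQ PQ; have p0 : 0 <= p by exact: le_trans p1.
have iQ k y : nm (iter k Q y) <= p ^+ k * nm y.
  elim: k => [|k IH]; first by rewrite mul1r.
  by rewrite iterS (le_trans (hQ _))// exprS -mulrA ler_wpM2l.
have cQ k y : P (iter k Q y) = iter k Q (P y).
  by elim: k => // k IH; rewrite iterS PQ IH.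
elim: n => [|n IH]; first by rewrite subrr nm0 !mul0r.
have -> : iter n.+1 P x - iter n.+1 Q x
    = P (iter n P x - iter n Q x) + iter n Q (P x - Q x).
  rewrite !linearB /= cQ -[in X in _ = _ + (_ - X)]iterSr iterS; vec.
rewrite (le_trans (nmD _ _))// (le_trans (lerD (hP _) (iQ _ _)))//.
have d0 := nm_ge0 (P x - Q x).
have h1 := ler_wpM2l p0 IH.
have h2 : p ^+ n * nm (P x - Q x) <= p ^+ n.+1 * nm (P x - Q x).
  by rewrite ler_wpM2r// exprS ler_peMl// exprn_ge0.
rewrite (le_trans (lerD h1 h2))// le_eqVlt; apply/orP; left; apply/eqP.
by rewrite exprS -natr1; ring.
Qed.

(** * The analytic semigroup *)

Section Dyadic.
Variable R : realType.

Definition dy k : R := 2^-1 ^+ k.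

Lemma dy_gt0 k : 0 < dy k.
Proof. by rewrite exprn_gt0// invr_gt0. Qed.

Lemma dyE k : (2 ^ k)%:R * dy k = 1.
Proof. by rewrite natrX -exprMn mulfV// expr1n. Qed.

Lemma dyV k : dy k = (2 ^ k)%:R^-1.
Proof. by rewrite natrX /dy exprVn. Qed.

Lemma dyS k : dy k = 2 * dy k.+1.
Proof. by rewrite /dy exprS mulrA mulfV// mul1r. Qed.

Lemma dy_small (C e : R) : 0 < e -> exists k0, forall k, (k0 <= k)%N -> C * dy k <= e.
Proof.
move=> e0; have C0 : 0 < `|C| + 1 by rewrite ltr_wpDl.
have q : ((0 : R) <= 2^-1) && ((2^-1 : R) < 1) by apply/andP; split; lra.
have [k0 h] := exp_small q (divr_gt0 e0 C0); exists k0 => k /h.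
rewrite ler_pdivlMr// => h1; have := ler_wpM2r (ltW (dy_gt0 k)) (ler_norm C).
by have := dy_gt0 k; move: h1; rewrite -/(dy k); lra.
Qed.

End Dyadic.
Arguments dy {R} k.

Section ConeScale.
Variable R : realType.
Implicit Types (e t : R) (z w : R[i]).

Lemma nm_scale t z : 0 <= t -> nm (t%:C * z) = t * nm z.
Proof. by move=> t0; rewrite nmM nmC_ge0. Qed.

Lemma cone_scale e t z : 0 <= t -> cone e z -> cone e (t%:C * z).
Proof.
by move=> t0; rewrite /cone cReCM cImCM normrM (ger0_norm t0) mulrCA; exact: ler_wpM2l.
Qed.

Lemma coneD e z w : cone e z -> cone e w -> cone e (z + w).
Proof.
rewrite /cone cReD cImD mulrDr => a b.
by rewrite (le_trans (ler_normD _ _))// lerD.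
Qed.

Lemma cone_pos e t : 0 <= e -> 0 <= t -> cone e t%:C.
Proof. by move=> *; rewrite /cone /= normr0 mulr_ge0. Qed.

Lemma cone0 e : cone e (0 : R[i]).
Proof. by rewrite /cone /= normr0 mulr0. Qed.

End ConeScale.

Section Semigroup.
Variables (R : realType) (X : hilbertType R) (A : set (X * X)).
Variables (J : R[i] -> {linear X -> X}) (eps r c : R).
Hypothesis rs : resolvents A J eps r c.
Local Notation admr := (adm eps r).
Local Notation coner := (cone eps).
Local Notation Jbr := (Jb r c).
Implicit Types (x y : X) (z w : R[i]) (e t : R).

Let c0 : 0 <= c := rs_c0 rs.

Lemma J_iter_bound k z x : admr z ->
  nm (iter k (J z) x) <= expR (c * (k%:R * nm z)) * nm x.
Proof.
move=> az; rewrite mulrCA expRM_natl.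
elim: k => [|k IH]; first by rewrite expr0 mul1r.
rewrite iterS (le_trans (rs_bound rs _ az))// exprS -mulrA.
rewrite ler_pM ?addr_ge0 ?mulr_ge0 ?nm_ge0//.
exact: expR_ge1Dx.
Qed.

(** The one-step defect of the semigroup law: (1 + z A)(1 + w A) and 1 + (z + w) A differ by z w
    A^2. *)
Lemma J_add z w x y y2 : admr z -> admr w -> admr (z + w) -> A (x, y) -> A (y, y2) ->
  J (z + w) x - J z (J w x) = (z * w) *: J (z + w) (J z (J w y2)).
Proof.
move=> az aw azw Axy Ay; set u := x + (z + w) *: y.
have h1 : J (z + w) u = x := rs_fix rs azw Axy.
have h2 : J w (u + (z * w) *: y2) = x + z *: y.
  have -> : u + (z * w) *: y2 = (x + w *: y) + z *: (y + w *: y2).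
    by rewrite /u; vec.
  by rewrite linearD linearZ /= (rs_fix rs aw Axy) (rs_fix rs aw Ay).
have h3 : J z (J w u) + (z * w) *: J z (J w y2) = x.
  by rewrite -(rs_fix rs az Axy) -h2 !linearD !linearZ.
rewrite -[in LHS]h3 linearD linearZ /= (J_comm rs _ azw az) (J_comm rs _ azw aw) h1.
by rewrite h3 addrAC subrr add0r.
Qed.

Definition scl k z : R[i] := (dy k)%:C * z.

Lemma nm_scl k z : nm (scl k z) = dy k * nm z.
Proof. by rewrite nm_scale// ltW// dy_gt0. Qed.

Lemma scl_nm k z : (2 ^ k)%:R * nm (scl k z) = nm z.
Proof. by rewrite nm_scl mulrA dyE mul1r. Qed.

Lemma sclD k z w : scl k (z + w) = scl k z + scl k w.
Proof. exact: mulrDr. Qed.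

Lemma scl_cone k z : coner z -> coner (scl k z).
Proof. by apply: cone_scale; rewrite ltW// dy_gt0. Qed.

Lemma scl_adm (rho : R) : exists k0, forall k, (k0 <= k)%N ->
  forall z, coner z -> nm z <= rho -> admr (scl k z).
Proof.
have [k0 h] := dy_small rho (rs_r0 rs); exists k0 => k /h hk z cz zr.
rewrite /adm scl_cone//= nm_scl mulrC (le_trans _ hk)// ler_wpM2r//.
by rewrite ltW// dy_gt0.
Qed.

Definition Pk k z x := iter (2 ^ k) (J (scl k z)) x.

Lemma Pk_bound k z x : admr (scl k z) -> nm (Pk k z x) <= expR (c * nm z) * nm x.
Proof. by move=> a; rewrite (le_trans (J_iter_bound _ _ a))// scl_nm. Qed.

(** Each of the 2^k steps has a defect of order 4^-k by [J_add]; [iter_dist] adds them up to order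
    2^-k. *)
Lemma Pk_add k z w x y y2 : admr (scl k z) -> admr (scl k w) -> admr (scl k (z + w)) ->
    A (x, y) -> A (y, y2) ->
  nm (Pk k (z + w) x - Pk k z (Pk k w x))
    <= expR (2 * (c * (nm z + nm w))) * (nm z * nm w * Jbr ^+ 3 * nm y2) * dy k.
Proof.
set a := scl k z; set b := scl k w => az aw; rewrite sclD => azw Axy Ay.
pose Q : {linear X -> X} := J a \o J b.
have cab m v : J a (iter m (J b) v) = iter m (J b) (J a v).
  by elim: m => // m IHm; rewrite iterS (J_comm rs _ az aw) IHm.
have JJ n u : iter n (J a) (iter n (J b) u) = iter n Q u.
  by elim: n u => // n IH u; rewrite iterSr (iterSr n (J b)) cab IH iterSr.
rewrite /Pk JJ sclD.
have s0 : 0 <= c * (nm a + nm b) by rewrite mulr_ge0// addr_ge0 ?nm_ge0.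
(* A common bound for J(a + b) and J(a) J(b); its power 2^k is at most exp(2 c (|z| + |w|)). *)
pose p := (1 + c * (nm a + nm b)) ^+ 2.
have p1 : 1 <= p by rewrite exprn_ege1// lerDl.
have ha : 1 + c * nm a <= 1 + c * (nm a + nm b) by rewrite lerD2l ler_wpM2l// lerDl nm_ge0.
have hb : 1 + c * nm b <= 1 + c * (nm a + nm b) by rewrite lerD2l ler_wpM2l// lerDr nm_ge0.
have hab : 1 + c * nm (a + b) <= 1 + c * (nm a + nm b) by rewrite lerD2l ler_wpM2l// nmD.
have hP u : nm (J (a + b) u) <= p * nm u.
  rewrite (le_trans (rs_bound rs _ azw))// ler_wpM2r ?nm_ge0// (le_trans hab)//.
  by rewrite /p expr2 ler_peMl// ?lerDl// addr_ge0.
have hQ u : nm (Q u) <= p * nm u.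
  rewrite /Q /= (le_trans (rs_bound rs _ az))// /p expr2 -mulrA.
  rewrite ler_pM ?nm_ge0 ?addr_ge0 ?mulr_ge0 ?nm_ge0//.
  rewrite (le_trans (rs_bound rs _ aw))// ler_wpM2r ?nm_ge0//.
have PQ u : J (a + b) (Q u) = Q (J (a + b) u).
  by rewrite /Q /= (J_comm rs _ azw az) (J_comm rs _ azw aw).
rewrite (le_trans (iter_dist _ _ p1 hP hQ PQ))// (J_add az aw azw Axy Ay).
have pE : p ^+ (2 ^ k) <= expR (2 * (c * (nm z + nm w))).
  rewrite /p -exprM mulnC exprM.
  have -> : 2 * (c * (nm z + nm w)) = 2%:R * ((2 ^ k)%:R * (c * (nm a + nm b))).
    by rewrite [(2 ^ k)%:R * _]mulrCA (mulrDr (2 ^ k)%:R) !scl_nm.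
  rewrite expRM_natl ler_pXn2r ?nnegrE ?expR_ge0 ?exprn_ge0 ?addr_ge0//.
  by rewrite expRM_natl lerXn2r ?nnegrE ?expR_ge0 ?addr_ge0// expR_ge1Dx.
have hJ : nm (J (a + b) (J a (J b y2))) <= Jbr ^+ 3 * nm y2.
  have jb := ltW (Jb_gt0 rs).
  rewrite (le_trans (J_bound rs _ azw))// exprS -mulrA ler_wpM2l//.
  rewrite (le_trans (J_bound rs _ az))// exprS -mulrA ler_wpM2l//.
  by rewrite (le_trans (J_bound rs _ aw))// expr1.
rewrite nmZ nmM; have nz : nm a = dy k * nm z := nm_scl k z.
have nw : nm b = dy k * nm w := nm_scl k w.
have -> : expR (2 * (c * (nm z + nm w))) * (nm z * nm w * Jbr ^+ 3 * nm y2) * dy k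
   = (2 ^ k)%:R * expR (2 * (c * (nm z + nm w))) * ((nm a * nm b) * (Jbr ^+ 3 * nm y2)).
  rewrite nz nw; transitivity (expR (2 * (c * (nm z + nm w))) *
    (nm z * nm w * Jbr ^+ 3 * nm y2) * dy k * ((2 ^ k)%:R * dy k)); last by ring.
  by rewrite dyE mulr1.
apply: ler_pM.
- by rewrite mulr_ge0 ?ler0n// exprn_ge0// exprn_ge0 ?addr_ge0.
- by rewrite !mulr_ge0 ?nm_ge0.
- by rewrite ler_wpM2l ?ler0n.
- by rewrite ler_wpM2l// mulr_ge0 ?nm_ge0.
Qed.

End Semigroup.

Section SemigroupLimit.
Variables (R : realType) (X : hilbertType R) (A : set (X * X)).
Variables (J : R[i] -> {linear X -> X}) (eps r c : R).
Hypothesis rs : resolvents A J eps r c.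
Local Notation admr := (adm eps r).
Local Notation coner := (cone eps).
Local Notation Jbr := (Jb r c).
Local Notation PkJ := (Pk J).
Implicit Types (x y : X) (z w : R[i]) (e t : R).

Let c0 : 0 <= c := rs_c0 rs.

(** Level k + 1 at z is the square of level k at z/2, so [Pk_add] with both arguments z/2 bounds the
    increments in k geometrically. *)
Lemma Pk_double k z x : PkJ k.+1 z x = PkJ k ((2^-1)%:C * z) (PkJ k ((2^-1)%:C * z) x).
Proof.
rewrite /Pk -iterD addnn -mul2n -expnS; congr (iter _ (J _) _).
by rewrite /scl mulrA -rmorphM /= /dy exprSr.
Qed.

Lemma Pk_cvg_smooth z x : coner z -> DA2 A x -> exists l, tends (fun k => PkJ k z x) l.
Proof.
move=> cz [y [y2 [Axy Ay]]]; have [k0 hk] := scl_adm rs (nm z).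
have half0 : 0 <= 2^-1 :> R by rewrite invr_ge0.
set w := (2^-1)%:C * z.
have cw : coner w by apply: cone_scale.
have nw : nm w <= nm z by rewrite nm_scale// ler_piMl ?nm_ge0//; lra.
have ww : z = w + w.
  rewrite /w -mulrDl -rmorphD /= (_ : 2^-1 + 2^-1 = 1) ?mul1r//; lra.
have q : ((0 : R) <= 2^-1) && ((2^-1 : R) < 1) by apply/andP; split; lra.
have step k : (k0 <= k)%N -> nm (PkJ k.+1 z x - PkJ k z x)
    <= expR (2 * (c * (nm w + nm w))) * (nm w * nm w * Jbr ^+ 3 * nm y2) * 2^-1 ^+ k.
  move=> kk0; rewrite Pk_double -/w nmBC {1}ww.
  by apply: (Pk_add rs _ _ _ Axy Ay); rewrite -?ww; apply: hk.
by have [l ul _] := geom_tends q step; exists l.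
Qed.

Lemma Pk_cvg z x : coner z -> exists l, tends (fun k => PkJ k z x) l.
Proof.
move=> cz; have [k0 hk] := scl_adm rs (nm z).
apply: (@strong_limit R X
  (fun k => (iter (2 ^ k) (J (scl k z)) : {linear X -> X})) (DA2 A)
  (expR (c * nm z)) k0).
- by move=> k kk0 u; apply: (Pk_bound rs); exact: hk.
- by move=> u e e0; exact: (DA2_dense rs).
- by move=> u; exact: Pk_cvg_smooth.
Qed.

(** The identity off the cone makes this linear for every z, as a family indexed by all complex
    numbers requires. *)
Definition Sfun z x : X :=
  if coner z then xget 0 [set l | tends (fun k => PkJ k z x) l] else x.

Lemma SfunP z x : coner z -> tends (fun k => PkJ k z x) (Sfun z x).
Proof.
move=> cz; rewrite /Sfun cz; case: xgetP => [l _ //|H].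
by have [l ul] := Pk_cvg x cz; have := H l ul.
Qed.

Lemma Sfun_linear z : linear (Sfun z).
Proof.
have [cz|ncz] := boolP (coner z); last by move=> a x y; rewrite /Sfun (negbTE ncz).
move=> a x y; apply: (tends_uniq (SfunP _ cz)).
apply: (@tends_ext _ _ (fun k => a *: PkJ k z x + PkJ k z y)).
  by exists 0%N => k _; rewrite /Pk linearP.
by apply: tendsD; [apply: tendsZ|]; exact: SfunP.
Qed.

HB.instance Definition _ z :=
  GRing.isLinear.Build R[i] X X *:%R (Sfun z) (Sfun_linear z).

Definition semig z : {linear X -> X} := Sfun z.

Lemma SP z x : coner z -> tends (fun k => PkJ k z x) (semig z x).
Proof. exact: SfunP. Qed.

Lemma S_bound z x : coner z -> nm (semig z x) <= expR (c * nm z) * nm x.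
Proof.
move=> cz; rewrite -[semig z x]subr0; apply: tends_le (SP x cz) _.
have [k0 hk] := scl_adm rs (nm z); exists k0 => k kk0.
by rewrite subr0; apply: (Pk_bound rs); exact: hk.
Qed.

Lemma S0 x : semig 0 x = x.
Proof.
apply: (tends_uniq (SP x (cone0 eps))); apply: tends_ext (tends_cst x).
exists 0%N => k _; rewrite /Pk /scl mulr0.
by elim: (2 ^ k)%N => // n IH; rewrite iterS -IH (rs_J0 rs).
Qed.

Lemma S_J z w x : coner z -> admr w -> semig z (J w x) = J w (semig z x).
Proof.
move=> cz aw; apply: (tends_uniq (SP _ cz)).
have : tends (fun k => J w (PkJ k z x)) (J w (semig z x)).
  apply: (@tends_map _ _ _ (J w) (fun k => PkJ k z x) _ Jbr) (SP x cz).
  by move=> a b; rewrite -linearB (J_bound rs).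
apply: tends_ext; have [k0 hk] := scl_adm rs (nm z); exists k0 => k kk0.
rewrite /Pk; elim: (2 ^ k)%N => // n IH; rewrite !iterS -IH.
by rewrite (J_comm rs _ aw (hk _ kk0 _ cz (lexx _))).
Qed.

Lemma A_S z x y : coner z -> A (x, y) -> A (semig z x, semig z y).
Proof.
move=> cz Axy; apply/(A_iff rs _ _ (adm_r rs) (r_neq0 rs)).
rewrite -linearZ -linearD -S_J ?(adm_r rs)//.
by rewrite (rs_fix rs (adm_r rs) Axy).
Qed.

Lemma SD z w x : coner z -> coner w -> semig (z + w) x = semig z (semig w x).
Proof.
move=> cz cw; have czw := coneD cz cw.
pose K := expR (c * (nm z + nm w)).
have Kz : expR (c * nm z) * expR (c * nm w) = K by rewrite -expRD -mulrDr.
apply: (@dense_eq R X (DA2 A) (semig (z + w)) (semig z \o semig w) K).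
- by move=> u e e0; exact: (DA2_dense rs).
- move=> u; rewrite (le_trans (S_bound _ czw))// ler_wpM2r ?nm_ge0//.
  by rewrite ler_expR ler_wpM2l// nmD.
- move=> u; rewrite /= (le_trans (S_bound _ cz))// -Kz -mulrA ler_wpM2l ?expR_ge0//.
  exact: S_bound.
move=> u [y [y2 [Auy Ay]]]; have [k0 hk] := scl_adm rs (nm z + nm w).
have nz : nm z <= nm z + nm w by rewrite lerDl nm_ge0.
have nw : nm w <= nm z + nm w by rewrite lerDr nm_ge0.
have nzw : nm (z + w) <= nm z + nm w by exact: nmD.
apply: (tends_uniq (SP u czw)).
have h : tends (fun k => PkJ k z (PkJ k w u)) (semig z (semig w u)).
  apply: (@tends_lip _ _ _ (fun k => PkJ k z) (fun k => PkJ k w u) (semig w u) _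
    (expR (c * nm z))); [|exact: SP|exact: SP].
  exists k0 => k kk0 a b.
  by rewrite /Pk -linearB (Pk_bound rs)//; exact: hk.
apply: tends_small h _ => e e0.
have [k1 h1] := dy_small (expR (2 * (c * (nm z + nm w)))
  * (nm z * nm w * Jbr ^+ 3 * nm y2)) e0.
exists (maxn k0 k1) => k; rewrite geq_max => /andP[a b].
rewrite (le_trans _ (h1 _ b))//.
by apply: (Pk_add rs _ _ _ Auy Ay); apply: hk.
Qed.

Lemma part_bound k z n x : admr (scl k z) -> (n <= 2 ^ k)%N ->
  nm (iter n (J (scl k z)) x) <= expR (c * nm z) * nm x.
Proof.
move=> a hn; rewrite (le_trans (J_iter_bound rs _ _ a))// ler_wpM2r ?nm_ge0//.
by rewrite ler_expR ler_wpM2l// -[leRHS](scl_nm k) ler_wpM2r ?nm_ge0// ler_nat.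
Qed.

Lemma part_lip k z n x y : admr (scl k z) -> (n <= 2 ^ k)%N -> A (x, y) ->
  nm (iter n (J (scl k z)) x - x) <= nm z * (expR (c * nm z) * (Jbr * nm y)).
Proof.
move=> a hn Axy; set B := expR _ * _.
have B0 : 0 <= B by rewrite !mulr_ge0 ?expR_ge0 ?nm_ge0 ?(ltW (Jb_gt0 rs)).
suff h : nm (iter n (J (scl k z)) x - x) <= n%:R * (nm (scl k z) * B).
  rewrite (le_trans h)// mulrA ler_wpM2r// -[leRHS](scl_nm k) ler_wpM2r ?nm_ge0//.
  by rewrite ler_nat.
elim: n hn => [_|n IH hn]; first by rewrite subrr nm0 mul0r.
rewrite iterSr (le_trans (nm_tri (iter n (J (scl k z)) x) _ _))//.
rewrite -linearB -natr1 mulrDl mul1r addrC lerD ?IH ?(ltnW hn)//.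
rewrite (le_trans (part_bound _ a (ltnW hn)))// mulrCA ler_wpM2l ?expR_ge0//.
exact: (J_lip rs).
Qed.

Lemma S_lip z x y : coner z -> A (x, y) ->
  nm (semig z x - x) <= nm z * (expR (c * nm z) * (Jbr * nm y)).
Proof.
move=> cz Axy; apply: tends_le (SP x cz) _.
have [k0 hk] := scl_adm rs (nm z); exists k0 => k kk0.
by apply: part_lip => //; exact: hk.
Qed.

(** Proved on the approximants: after n steps of size s the reference is x - n s y, and step n + 1
    adds the error s (J^(n+1) y - y), small by [part_lip]. *)
Lemma S_taylor z x y y2 : coner z -> A (x, y) -> A (y, y2) ->
  nm (semig z x - x + z *: y) <= nm z ^+ 2 * (expR (c * nm z) * (Jbr * nm y2)).
Proof.
move=> cz Axy Ay; set B := expR _ * _.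
have B0 : 0 <= B by rewrite !mulr_ge0 ?expR_ge0 ?nm_ge0 ?(ltW (Jb_gt0 rs)).
have [k0 hk] := scl_adm rs (nm z).
suff h k : (k0 <= k)%N -> nm (PkJ k z x - (x - z *: y)) <= nm z ^+ 2 * B.
  have -> : semig z x - x + z *: y = semig z x - (x - z *: y) by vec.
  by apply: tends_le (SP x cz) _; exists k0.
move=> kk0; have a : admr (scl k z) by exact: hk.
set s := scl k z in a *.
have P n : (n <= 2 ^ k)%N ->
    nm (iter n (J s) x - (x - (n%:R * s) *: y)) <= n%:R * (nm s * (nm z * B)).
  elim: n => [_|n IH hn].
    by rewrite /= !mul0r scale0r subr0 subrr nm0.
  have -> : iter n.+1 (J s) x - (x - (n.+1%:R * s) *: y)
      = (iter n (J s) x - (x - (n%:R * s) *: y)) - s *: (iter n.+1 (J s) y - y).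
    rewrite iterSr (J_id rs a Axy) linearB linearZ /= -iterSr -natr1; vec.
  rewrite (le_trans (nmB _ _))// -natr1 mulrDl mul1r lerD ?IH ?(ltnW hn)//.
  by rewrite nmZ ler_wpM2l ?nm_ge0//; exact: part_lip.
have := P _ (leqnn _).
have -> : (2 ^ k)%:R * s = z.
  by rewrite /s /scl mulrA -(rmorph_nat (real_complex R)) -rmorphM /= dyE mul1r.
by rewrite mulrA scl_nm mulrA -expr2.
Qed.

Lemma S_contractive t x : 0 <= t ->
    (forall u x, 0 <= u <= r -> nm (J u%:C x) <= nm x) ->
  nm (semig t%:C x) <= nm x.
Proof.
move=> t0 h; have ct : coner t%:C by rewrite cone_pos// ltW// (rs_eps0 rs).
rewrite -[semig _ x]subr0; apply: tends_le (SP x ct) _.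
have [k0 hk] := scl_adm rs (nm (t%:C : R[i])); exists k0 => k kk0.
rewrite subr0 /Pk; elim: (2 ^ k)%N => // n IH; rewrite iterS.
rewrite /scl -rmorphM /= in IH *; rewrite (le_trans (h _ _ _))//.
have dt : 0 <= dy k * t by rewrite mulr_ge0// ltW// dy_gt0.
have := hk _ kk0 _ ct (lexx _); rewrite dt /= => /andP[_].
by rewrite /scl -rmorphM nmC_ge0.
Qed.

Hypothesis smooth : forall z, coner z -> z != 0 -> exists C : R, forall n,
  admr ((n%:R^-1)%:C * z) -> forall x,
  n%:R * nm (iter n (J ((n%:R^-1)%:C * z)) x - iter n.+1 (J ((n%:R^-1)%:C * z)) x)
    <= C * nm x.

(** [B k] is A J^(2^k + 1) at step z / 2^k. The hypothesis [smooth] bounds it uniformly in k, it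
    converges on D(A^2), and closedness of the graph identifies the limit with A S(z). *)
Lemma S_smooth z : coner z -> z != 0 ->
  exists C : R, exists2 G : {linear X -> X},
    0 <= C & forall x, A (semig z x, G x) /\ nm (G x) <= C * nm x.
Proof.
move=> cz z0; have [C hC] := smooth cz z0.
have nz := nm_gt0 z0; have [k0 hk] := scl_adm rs (nm z).
pose B k : {linear X -> X} :=
  (scl k z)^-1 \*: (iter (2 ^ k) (J (scl k z)) \- iter (2 ^ k).+1 (J (scl k z))).
have s0 k : scl k z != 0 by rewrite mulf_neq0// posC_neq0// dy_gt0.
have BK k : (k0 <= k)%N -> forall x, nm (B k x) <= `|C| / nm z * nm x.
  move=> kk0 x; have a : admr (scl k z) by exact: hk.
  have := hC (2 ^ k)%N; rewrite -dyV -/(scl k z) => /(_ a x) h.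
  have d0 := dy_gt0 R k; rewrite nmZ nmV nm_scl invfM mulrC dyV invrK.
  rewrite [leRHS]mulrAC [leLHS]mulrA ler_pM2r ?invr_gt0// mulrC (le_trans h)//.
  by rewrite ler_wpM2r ?nm_ge0// ler_norm.
have Bc x y k : (k0 <= k)%N -> A (x, y) -> B k x = J (scl k z) (PkJ k z y).
  move=> kk0 Axy; have a : admr (scl k z) by exact: hk.
  transitivity ((scl k z)^-1 *: (iter (2 ^ k) (J (scl k z)) x
      - iter (2 ^ k) (J (scl k z)) (J (scl k z) x))); first by rewrite -iterSr.
  rewrite -linearB (J_id rs a Axy) opprB addrCA subrr addr0 linearZ /=.
  by rewrite scalerA mulVf// scale1r -iterSr.
have Jk x : tends (fun k => J (scl k z) x) x.
  move=> e e0; have [t /andP[t0 tr] ht] := J_to_id rs x e0.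
  have [k1 h1] := dy_small (nm z) t0; exists (maxn k0 k1) => k.
  rewrite geq_max => /andP[ka kb]; apply: ht; first exact: hk.
  by rewrite nm_scl mulrC h1.
have JPk x : tends (fun k => J (scl k z) (PkJ k z x)) (semig z x).
  apply: (@tends_lip _ _ _ (fun k => J (scl k z)) _ (semig z x) _ Jbr) => //.
    by exists k0 => k kk0 a b; rewrite -linearB (J_bound rs)//; exact: hk.
  exact: SP.
have cB x : exists l, tends (fun k => B k x) l.
  apply: (@strong_limit R X B (DA2 A) (`|C| / nm z) k0) => //.
    by move=> u e e0; exact: (DA2_dense rs).
  move=> u [y [y2 [Auy _]]]; exists (semig z y); apply: tends_ext (JPk y).
  by exists k0 => k kk0; rewrite (Bc u y).
have /choice[G GP] := cB.
have Glin : linear G.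
  move=> a x y; apply: (tends_uniq (GP _)).
  apply: (@tends_ext _ _ (fun k => a *: B k x + B k y)).
    by exists 0%N => k _; rewrite linearP.
  by apply: tendsD => //; exact: tendsZ.
pose Gl := GRing.isLinear.Build R[i] X X *:%R G Glin.
pose GL : {linear X -> X} := HB.pack G Gl.
exists (`|C| / nm z), GL; first by rewrite divr_ge0// nm_ge0.
move=> x; split; last first.
  rewrite -[GL x]subr0; apply: tends_le (GP x) _; exists k0 => k kk0.
  by rewrite subr0 BK.
(* Indices start at [k0] because [A_closed] wants every term in the graph, hence every step
   admissible. *)
apply: (@A_closed _ _ _ _ _ _ _ rs
  (fun k => J (scl (k0 + k) z) (PkJ (k0 + k) z x)) (fun k => B (k0 + k)%N x)).
- move=> k; have a : admr (scl (k0 + k) z) by apply: hk => //; exact: leq_addr.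
  exact: (rs_ran rs (PkJ (k0 + k) z x) a (s0 _)).
- by apply: (@tends_comp _ _ (fun k => J (scl k z) (PkJ k z x)) _ (addn k0)) => // n;
    exact: leq_addl.
- by apply: (@tends_comp _ _ (fun k => B k x) _ (addn k0)) => // n; exact: leq_addl.
Qed.

End SemigroupLimit.

Section SemigroupMain.
Variables (R : realType) (X : hilbertType R) (A : set (X * X)).
Variables (J : R[i] -> {linear X -> X}) (eps r c : R).
Hypothesis rs : resolvents A J eps r c.
Local Notation admr := (adm eps r).
Local Notation coner := (cone eps).
Local Notation Jbr := (Jb r c).
Local Notation ST := (semig rs).
Implicit Types (x y : X) (z w : R[i]) (e t : R).

Let c0 : 0 <= c := rs_c0 rs.
Let e0 : 0 < eps := rs_eps0 rs.

Lemma opp_opE p : opp_op A p = A (p.1, - p.2).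
Proof. by []. Qed.

Lemma S_bound_le z (rho : R) x : coner z -> nm z <= rho ->
  nm (ST z x) <= expR (c * rho) * nm x.
Proof.
move=> cz zr; rewrite (le_trans (S_bound rs _ cz))// ler_wpM2r ?nm_ge0//.
by rewrite ler_expR ler_wpM2l.
Qed.

Lemma S_lip_le z (rho : R) x y : coner z -> nm z <= rho -> A (x, y) ->
  nm (ST z x - x) <= nm z * (expR (c * rho) * (Jbr * nm y)).
Proof.
move=> cz zr Axy; rewrite (le_trans (S_lip rs cz Axy))// ler_wpM2l ?nm_ge0//.
by rewrite ler_wpM2r ?mulr_ge0 ?nm_ge0 ?(ltW (Jb_gt0 rs))// ler_expR ler_wpM2l.
Qed.

Lemma S_taylor_le z (rho : R) x y y2 : coner z -> nm z <= rho ->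
    A (x, y) -> A (y, y2) ->
  nm (ST z x - x + z *: y) <= nm z ^+ 2 * (expR (c * rho) * (Jbr * nm y2)).
Proof.
move=> cz zr Axy Ay; rewrite (le_trans (S_taylor rs cz Axy Ay))//.
rewrite ler_wpM2l ?sqr_ge0//.
by rewrite ler_wpM2r ?mulr_ge0 ?nm_ge0 ?(ltW (Jb_gt0 rs))// ler_expR ler_wpM2l.
Qed.

Lemma S_to_id x e : 0 < e ->
  exists2 d, 0 < d & forall z, coner z -> nm z < d -> nm (ST z x - x) <= e.
Proof.
move=> epos; pose K := expR (c * 1); have K0 : 0 < K by exact: expR_gt0.
have k0 : 0 < 2 * (K + 1) by rewrite mulr_gt0// ltr_wpDl// ltW.
have [[x' y'] A' /= h] := rs_dense rs x (divr_gt0 epos k0).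
pose B := 2 * (K * (Jbr * nm y')) + 1.
have B0 : 0 < B.
  by rewrite ltr_wpDl// !mulr_ge0 ?nm_ge0 ?(ltW K0) ?(ltW (Jb_gt0 rs)).
exists (Num.min 1 (e / B)) => [|z cz]; first by rewrite lt_min ltr01 divr_gt0.
rewrite lt_min => /andP[/ltW z1 zB].
have h1 := S_lip_le cz z1 A'; have h2 := S_bound_le (x - x') cz z1.
have -> : ST z x - x = ST z (x - x') + (ST z x' - x') - (x - x').
  by rewrite linearB /=; vec.
rewrite (le_trans (nmB _ _))//; have := nmD (ST z (x - x')) (ST z x' - x').
move: h zB; rewrite ler_pdivlMr// ltr_pdivlMr// /B -/K in h1 h2 *.
by have := nm_ge0 z; lra.
Qed.

(** [x] is replaced by x' in D(A^2), close in the graph norm: [S_taylor_le] handles x', and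
    [S_lip_le] bounds the quotient at x - x' by a multiple of |y - y'|. *)
Lemma S_generator x y e : A (x, y) -> 0 < e ->
  exists2 d, 0 < d & forall t, 0 < t < d ->
    nm (t^-1%:C *: (ST t%:C x - x) - - y) <= e.
Proof.
move=> Axy epos; pose K := expR (c * 1) * Jbr.
have K0 : 0 < K by rewrite mulr_gt0 ?expR_gt0// (Jb_gt0 rs).
have k0 : 0 < 2 * (K + 1) by rewrite mulr_gt0// ltr_wpDl// ltW.
have [x' [y' [y2 [A' A2 _ hy]]]] := smooth_dense rs (divr_gt0 epos k0) Axy.
pose B := 2 * (K * nm y2) + 1.
have B0 : 0 < B.
  by rewrite ltr_wpDl// !mulr_ge0 ?nm_ge0 ?expR_ge0 ?(ltW (Jb_gt0 rs)).
exists (Num.min 1 (e / B)) => [|t]; first by rewrite lt_min ltr01 divr_gt0.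
rewrite lt_min => /and3P[t0 /ltW t1 tB].
have ct : coner t%:C by rewrite cone_pos// ltW.
have nt : nm (t%:C : R[i]) = t by rewrite nmC_ge0// ltW.
have tV : t^-1 * t = 1 by rewrite mulVf// gt_eqF.
have ti : 0 <= t^-1 by rewrite invr_ge0 ltW.
have h1 := @S_lip_le t%:C 1 _ _ ct; rewrite nt in h1.
have {}h1 := h1 _ _ t1 (AB rs Axy A').
have h2 := @S_taylor_le t%:C 1 _ _ _ ct; rewrite nt in h2.
have {}h2 := h2 _ _ _ t1 A' A2.
have -> : t^-1%:C *: (ST t%:C x - x) - - y
   = t^-1%:C *: (ST t%:C (x - x') - (x - x'))
     + t^-1%:C *: (ST t%:C x' - x' + t%:C *: y') + (y - y').
  rewrite [t^-1%:C *: (_ + t%:C *: _)]scalerDr scalerA -rmorphM /= tV scale1r.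
  rewrite (linearB (ST t%:C)) /=; vec.
rewrite (le_trans (nmD _ _))//.
have := nmD (t^-1%:C *: (ST t%:C (x - x') - (x - x')))
            (t^-1%:C *: (ST t%:C x' - x' + t%:C *: y')).
rewrite !nmZ (nmC_ge0 ti).
have {}h1 : t^-1 * nm (ST t%:C (x - x') - (x - x')) <= K * nm (y - y').
  by rewrite ler_pdivrMl// /K -mulrA.
have {}h2 : t^-1 * nm (ST t%:C x' - x' + t%:C *: y') <= t * (K * nm y2).
  by rewrite ler_pdivrMl// [leRHS]mulrA -[t * t]expr2 /K -[_ * Jbr * _]mulrA.
move: hy tB; rewrite ler_pdivlMr// ltr_pdivlMr// /B => hy tB.
by clearbody K; lra.
Qed.

(** J(r) maps into D(A), where the derivative is known; it commutes with S, so uniqueness of limits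
    gives J(r) y = - A J(r) x. *)
Lemma J_limit_A (y : X) (g : R -> X) x :
    (forall t, 0 < t -> g t = t^-1%:C *: (ST t%:C x - x)) ->
    g t @[t --> 0^'+] --> y -> A (x, - y).
Proof.
move=> gE gy; apply/(A_iff rs _ _ (adm_r rs) (r_neq0 rs)).
set Jr := J r%:C; have r0 := r_neq0 rs.
suff h : Jr y = - (r%:C^-1 *: (x - Jr x)).
  rewrite linearD linearZ linearN /= -/Jr h opprK scalerA mulfV// scale1r.
  by rewrite addrC subrK.
have h1 : (fun t => Jr (g t)) t @[t --> 0^'+] --> Jr y.
  apply/cvg_right0 => e epos; have J0 := Jb_gt0 rs.
  have /cvg_right0/(_ (e / Jbr)) := gy.
  case=> [|d d0 hd]; first by rewrite divr_gt0.
  exists d => // t /hd; rewrite ler_pdivlMr// mulrC => h; apply: le_trans h.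
  by rewrite -linearB (J_bound rs)// (adm_r rs).
have h2 : (fun t => Jr (g t)) t @[t --> 0^'+] --> - (r%:C^-1 *: (x - Jr x)).
  apply/cvg_right0 => e epos.
  have [d d0 hd] := S_generator (rs_ran rs x (adm_r rs) r0) epos.
  exists d => // t td; have := hd t td; case/andP: td => t0 _.
  have -> : Jr (g t) = t^-1%:C *: (ST t%:C (Jr x) - Jr x); last by [].
  rewrite (gE t t0) [in RHS](S_J rs) ?(adm_r rs)// ?cone_pos// ?ltW//.
  by rewrite linearZ linearB.
exact: (@cvg_unique _ (@norm_hausdorff _ X) _ _ _ _ h1 h2).
Qed.

Lemma semigroup_generatorE (T : R -> {linear X -> X}) :
    (forall t x, 0 <= t -> T t x = ST t%:C x) -> semigroup_generator T = opp_op A.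
Proof.
move=> TS; apply/seteqP; split=> -[x y] /=.
  move=> h; apply: (@J_limit_A y (fun t => t^-1%:C *: (T t x - x)) x) => // t t0.
  by rewrite TS// ltW.
rewrite opp_opE /= => Axy; apply/cvg_right0 => e epos.
have [d d0 hd] := S_generator Axy epos; exists d => // t td.
by have := hd t td; rewrite opprK TS//; case/andP: td => /ltW.
Qed.

Hypothesis smooth : forall z, coner z -> z != 0 -> exists C : R, forall n,
  admr ((n%:R^-1)%:C * z) -> forall x,
  n%:R * nm (iter n (J ((n%:R^-1)%:C * z)) x - iter n.+1 (J ((n%:R^-1)%:C * z)) x)
    <= C * nm x.

(* The increment [h] need not lie in the cone; with [s ~ |h|] real, both
   [h + s] and [z / 2 - s] do, and
   [S(z + h) - S(z) = S(z/2 - s) (S(h + s) - S(s)) S(z/2)]. *)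
Lemma S_derivable z : `|complex.Im z| < eps * complex.Re z -> op_derivable_at ST z.
Proof.
move=> zint; have cz : coner z by exact: ltW.
have Rz : 0 < complex.Re z by rewrite -(pmulr_rgt0 _ e0) (le_lt_trans _ zint).
have q0 : 0 <= 4^-1 :> R by rewrite invr_ge0.
(* Quarters make S(z/2) = S(z/4)^2 map into D(A^2) with A^2 S(z/2) = G^2 bounded; the other half of
   z is left to absorb the shift by [s]. *)
pose z4 := (4^-1)%:C * z; pose z2 := (2^-1)%:C * z.
have c4 : coner z4 by exact: cone_scale.
have c2 : coner z2 by apply: cone_scale => //; rewrite invr_ge0.
have z40 : z4 != 0.
  rewrite mulf_neq0 ?posC_neq0 ?invr_gt0//; apply: contraTneq Rz => ->.
  by rewrite ltxx.
have z44 : z4 + z4 = z2 by rewrite /z4 /z2 -mulrDl -rmorphD /=; congr (_%:C * _); lra.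
have z22 : z2 + z2 = z.
  rewrite /z2 -mulrDl -rmorphD /= (_ : 2^-1 + 2^-1 = 1 :> R) ?mul1r//; lra.
have [C [G C0 GP]] := S_smooth rs smooth c4 z40.
have AG x : A (ST z4 x, G x) := (GP x).1.
have GC x : nm (G x) <= C * nm x := (GP x).2.
pose x2 x := ST z2 x; pose y' x := ST z4 (G x); pose y2 x := G (G x).
have A1 x : A (x2 x, y' x) by rewrite /x2 -z44 (SD rs)//; exact: (A_S rs).
have A2 x : A (y' x, y2 x) := AG (G x).
have y2C x : nm (y2 x) <= C ^+ 2 * nm x.
  by rewrite (le_trans (GC _))// expr2 -mulrA ler_wpM2l.
pose D : {linear X -> X} := (-1) \*: (ST z2 \o ST z4 \o G).
have DE x : D x = - ST z2 (y' x) by rewrite /D /= scaleN1r.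
exists D.
  apply: (@bounded_opP _ _ _ _ (expR (c * nm z2) * (expR (c * nm z4) * C))) => x.
  rewrite DE nmN (le_trans (S_bound rs _ c2))// -!mulrA ler_wpM2l ?expR_ge0//.
  by rewrite (le_trans (S_bound rs _ c4))// ler_wpM2l ?expR_ge0.
move=> e epos.
(* With s = K |h| one has eps (s - |h|) = |h|, which puts h + s in the cone for every direction of
   h. *)
pose K := 1 + eps^-1; have K1 : 1 <= K by rewrite lerDl invr_ge0 ltW.
have K0 : 0 < K by exact: lt_le_trans K1.
pose rho := nm z + 1 + K.
pose E := expR (c * rho); have E0 : 0 < E by exact: expR_gt0.
pose Q := E * (3 * (1 + K) ^+ 2 * (E * (Jbr * C ^+ 2))).
have J0 := Jb_gt0 rs.
have Q0 : 0 <= Q.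
  exact: mulr_ge0 (ltW E0) (mulr_ge0 (mulr_ge0 (ler0n R 3) (sqr_ge0 _))
    (mulr_ge0 (ltW E0) (mulr_ge0 (ltW J0) (sqr_ge0 _)))).
have Q1 : 0 < Q + 1 by rewrite ltr_wpDl.
(* For |h| < gap, z/2 - K |h| is still in the cone. *)
pose gap := (eps * complex.Re z - `|complex.Im z|) / (2 * eps * K).
have gap0 : 0 < gap by rewrite divr_gt0 ?subr_gt0// !mulr_gt0.
pose d := Num.min 1 (Num.min gap (e / (Q + 1))).
have d0 : 0 < d by rewrite !lt_min ltr01 gap0 divr_gt0.
apply/(@nbhs_nm _ R[i]^o); exists d => // h; rewrite /= nmBC subr0.
rewrite !lt_min => /and3P[/ltW h1 hgap hQ] h0 x.
rewrite !nmE -rmorphM lecR.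
set eta := nm h in h1 hgap hQ.
have eta0 : 0 < eta by apply: nm_gt0.
pose s := K * eta; have s0 : 0 < s by rewrite mulr_gt0.
have sK : s <= K by rewrite /s ler_piMr// ltW.
have cs : coner s%:C by apply: cone_pos; exact: ltW.
have ns : nm (s%:C : R[i]) = s by rewrite nmC_ge0// ltW.
have nhs : nm (h + s%:C) <= (1 + K) * eta.
  by rewrite (le_trans (nmD _ _))// ns mulrDl mul1r.
have chs : coner (h + s%:C).
  rewrite /cone cImD cReD /= addr0 (le_trans (Im_nm _))// -/eta.
  have := Re_nm h; rewrite -/eta ler_norml => /andP[a _].
  have -> : eta = eps * (- eta + s).
    by rewrite /s /K; field; rewrite gt_eqF.
  by rewrite ler_wpM2l ?(ltW e0)// lerD2r.
have cz2s : coner (z2 - s%:C).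
  rewrite /cone cImD cReD cImN cReN /= subr0 /z2 cImCM cReCM.
  rewrite normrM (ger0_norm (_ : 0 <= 2^-1)) ?invr_ge0//.
  have : eta * (2 * eps * K) < eps * complex.Re z - `|complex.Im z|.
    by rewrite -ltr_pdivlMr// !mulr_gt0.
  by rewrite /s; lra.
have nz2s : nm (z2 - s%:C) <= rho.
  rewrite (le_trans (nmB _ _))// ns /z2 nm_scale ?invr_ge0//.
  by have := nm_ge0 z; rewrite /rho; lra.
have nhs_rho : nm (h + s%:C) <= rho.
  rewrite (le_trans (nmD _ _))// ns -/eta /rho.
  by have := nm_ge0 z; lra.
have ns_rho : nm (s%:C : R[i]) <= rho.
  by rewrite ns /rho; have := nm_ge0 z; lra.
have e1 : ST (z + h) x = ST (z2 - s%:C) (ST (h + s%:C) (x2 x)).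
  rewrite /x2 -!(SD rs)//; last by exact: coneD.
  by congr (ST _ _); rewrite -{1}z22; ring.
have e2 : ST z x = ST (z2 - s%:C) (ST s%:C (x2 x)).
  rewrite /x2 -!(SD rs)//; last by exact: coneD.
  by congr (ST _ _); rewrite -{1}z22; ring.
have e3 : D x = - ST (z2 - s%:C) (ST s%:C (y' x)).
  by rewrite DE -(SD rs)// subrK.
pose w := ST (h + s%:C) (x2 x) - ST s%:C (x2 x) + h *: ST s%:C (y' x).
have -> : h^-1 *: (ST (z + h) x - ST z x) - D x = h^-1 *: ST (z2 - s%:C) w.
  rewrite e1 e2 e3 opprK /w (linearD (ST _)) (linearB (ST _)) (linearZ_LR (ST _)).
  by rewrite [in RHS]scalerDr scalerA mulVf// scale1r.
have b1 := S_taylor_le chs nhs_rho (A1 x) (A2 x).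
have b2 := S_taylor_le cs ns_rho (A1 x) (A2 x).
have b3 := S_lip_le cs ns_rho (A2 x).
rewrite -/E in b1 b2 b3.
pose B := E * (Jbr * (C ^+ 2 * nm x)).
have B0 : 0 <= B.
  exact: mulr_ge0 (ltW E0) (mulr_ge0 (ltW J0) (mulr_ge0 (sqr_ge0 _) (nm_ge0 _))).
have y2B : E * (Jbr * nm (y2 x)) <= B.
  by rewrite ler_wpM2l ?(ltW E0)// ler_wpM2l ?(ltW J0).
have wE : w = (ST (h + s%:C) (x2 x) - x2 x + (h + s%:C) *: y' x)
   - (ST s%:C (x2 x) - x2 x + s%:C *: y' x) + h *: (ST s%:C (y' x) - y' x).
  by rewrite /w; vec.
have nw : nm w <= eta ^+ 2 * (3 * (1 + K) ^+ 2 * B).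
  rewrite wE (le_trans (nmD _ _))// nmZ -/eta.
  have := nmB (ST (h + s%:C) (x2 x) - x2 x + (h + s%:C) *: y' x)
              (ST s%:C (x2 x) - x2 x + s%:C *: y' x).
  have K10 : 0 <= (1 + K) * eta := mulr_ge0 (addr_ge0 ler01 (ltW K0)) (ltW eta0).
  have f1 : nm (h + s%:C) ^+ 2 <= (1 + K) ^+ 2 * eta ^+ 2.
    by rewrite -exprMn lerXn2r// nnegrE// nm_ge0.
  have f2 : s ^+ 2 <= (1 + K) ^+ 2 * eta ^+ 2.
    rewrite -exprMn lerXn2r// ?nnegrE ?(ltW s0)//.
    by rewrite /s ler_wpM2r ?(ltW eta0)// lerDr.
  have f3 : eta * s <= (1 + K) ^+ 2 * eta ^+ 2.
    rewrite /s mulrCA -expr2 ler_wpM2r ?sqr_ge0//.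
    by have := K0; nra.
  have g1 := le_trans b1 (ler_pM (sqr_ge0 _)
    (mulr_ge0 (ltW E0) (mulr_ge0 (ltW J0) (nm_ge0 _))) f1 y2B).
  rewrite ns in b2 b3.
  have g2 := le_trans b2 (ler_pM (sqr_ge0 _)
    (mulr_ge0 (ltW E0) (mulr_ge0 (ltW J0) (nm_ge0 _))) f2 y2B).
  have g3 := le_trans b3 (ler_wpM2l (ltW s0) y2B).
  have {}g3 := le_trans (ler_wpM2l (ltW eta0) g3) (_ : _ <= (1 + K) ^+ 2 * eta ^+ 2 * B).
  have {}g3 := g3 ltac:(by rewrite mulrA ler_wpM2r).
  lra.
rewrite nmZ nmV -/eta ler_pdivrMl//.
rewrite (le_trans (S_bound_le _ cz2s nz2s))// -/E.
rewrite (le_trans (ler_wpM2l (ltW E0) nw))//.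
have -> : E * (eta ^+ 2 * (3 * (1 + K) ^+ 2 * B)) = eta * (eta * Q * nm x).
  by rewrite /B /Q; ring.
rewrite ler_wpM2l ?(ltW eta0)// ler_wpM2r ?nm_ge0//.
move: hQ; rewrite ltr_pdivlMr// mulrDr mulr1 => hQ.
by clearbody Q; lra.
Qed.

(** With th = atan eps, sin (th - u) > 0 reads sin u < eps cos u for |u| < th; it is used at phi and
    - phi. *)
Lemma sector_cone z : sector (atan eps) z -> `|complex.Im z| < eps * complex.Re z.
Proof.
move=> [s [phi [s0 phit ->]]]; rewrite cImCM cReCM /= normrM (gtr0_norm s0) mulrCA.
rewrite ltr_pM2l//.
have [/andP[t1 t2] tE] := atan_def eps.
set th := atan eps in phit t1 t2 tE.
have th0 : 0 < th by rewrite (le_lt_trans _ phit).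
have pi0 := pi_gt0 R.
have cth : 0 < cos th by rewrite cos_gt0_pihalf// t1 t2.
have sth : sin th = eps * cos th by rewrite -tE /tan mulfVK// gt_eqF.
have key u : `|u| < th -> sin u < eps * cos u.
  rewrite ltr_norml => /andP[u1 u2].
  have : 0 < sin (th - u) by rewrite sin_gt0_pi//; lra.
  by rewrite sinB sth; nra.
rewrite ltr_norml; apply/andP; split; last exact: key.
by rewrite ltrNl -sinN -(cosN phi) key// normrN.
Qed.

Theorem semigroup_main : exists T : R -> {linear X -> X},
  [/\ analytic_semigroup T, semigroup_generator T = opp_op A
    & (forall u x, 0 <= u <= r -> nm (J u%:C x) <= nm x) -> contractive T].
Proof.
exists (fun t => ST t%:C); have cp t : 0 <= t -> coner t%:C by move=> ?; rewrite cone_pos// ltW.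
split.
- split.
    split.
    + move=> t t0; apply: (@bounded_opP _ _ _ _ (expR (c * nm (t%:C : R[i])))) => x.
      exact: (S_bound rs _ (cp _ t0)).
    + by move=> x; exact: (S0 rs).
    + by move=> u t x u0 t0; rewrite rmorphD; apply: (SD rs); exact: cp.
    + move=> x; apply/cvg_right0 => e epos; have [d d0 hd] := S_to_id x epos.
      exists d => // t /andP[t0 td]; apply: hd; first exact/cp/ltW.
      by rewrite nmC_ge0// ltW.
  have [/andP[t1 t2] tE] := atan_def eps.
  have th0 : 0 < atan eps.
    rewrite ltNge; apply/negP => th.
    have ct : 0 < cos (atan eps) by rewrite cos_gt0_pihalf// t1 t2.
    have : 0 <= sin (- atan eps).
      by rewrite sin_ge0_pi//; have := pi_gt0 R; lra.
    rewrite sinN oppr_ge0 => st; move: e0; rewrite -tE /tan.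
    by rewrite pmulr_lgt0 ?invr_gt0// ltNge st.
  exists (atan eps), ST; split.
  + by rewrite th0 ltW.
  + by [].
  + move=> z sz; split; last exact/S_derivable/sector_cone.
    apply: (@bounded_opP _ _ _ _ (expR (c * nm z))) => x.
    by apply: (S_bound rs); exact/ltW/sector_cone.
  + by move=> z w x sz sw; apply: (SD rs); exact/ltW/sector_cone.
  + move=> th' x /andP[th'0 th'1]; apply/cvg_nm => e epos.
    have [d d0 hd] := S_to_id x epos.
    apply/(@nbhs_nm _ R[i]^o); exists d => // z; rewrite nmBC subr0 => zd sz.
    apply: hd => //; apply/ltW/sector_cone.
    by case: sz => s [phi [s0 hphi ->]]; exists s, phi; split=> //; exact: lt_trans th'1.
- by apply: semigroup_generatorE.
- move=> h t x t0; rewrite !nmE lecR; exact: (S_contractive rs).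
Qed.

End SemigroupMain.

(** * Discrete Fourier transform and the parabola condition *)

Section DFT.
Variables (R : realType) (E : hilbertType R).

(** X^n - 1 splits over the algebraically closed field R[i] with distinct roots, and n distinct n-th
    roots of unity include a primitive one. *)
Lemma prim_root_exists n : (0 < n)%N -> exists z : R[i], n.-primitive_root z.
Proof.
pose p : {poly R[i]} := 'X^n - 1; have [s Dp] := closed_field_poly_normal p.
move=> n0; rewrite (monicP _) ?monicXnsubC// scale1r in Dp.
have sn1 : all n.-unity_root s by apply/allP => z; rewrite -root_prod_XsubC -Dp.
have sz : (n < (size s).+1)%N by rewrite -(size_prod_XsubC s id) -Dp size_XnsubC.
have [|z] := hasP (cyclic.has_prim_root n0 sn1 _ sz); last by exists z.
by rewrite -separable.separable_prod_XsubC -Dp cyclotomic.separable_Xn_sub_1// pnatr_eq0 -lt0n.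
Qed.

Variables (N : nat) (zt : R[i]).
Hypotheses (N0 : (0 < N)%N) (pz : N.-primitive_root zt).

Lemma prim_norm k : Num.conj (zt ^+ k) = (zt ^+ k)^-1.
Proof.
have z1 : `|zt| = 1.
  have : `|zt| ^+ N = 1 by rewrite -normrX (prim_expr_order pz) normr1.
  by move/eqP; rewrite pexpr_eq1 ?normr_ge0// => /eqP.
rewrite invC_norm normrX z1 !expr1n invr1 mul1r//.
Qed.

Lemma prim_normV k : Num.conj ((zt ^+ k)^-1) = zt ^+ k.
Proof. by rewrite -prim_norm conjCK. Qed.

Lemma zt_neq0 : zt != 0.
Proof.
apply: contraTneq isT => z0; have := prim_expr_order pz.
by rewrite z0 expr0n gtn_eqF// => /eqP; rewrite eq_sym oner_eq0.
Qed.

Lemma root_sum (k l : 'I_N) :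
  \sum_(m < N) (zt ^+ (m * l) / zt ^+ (m * k)) = (k == l)%:R * N%:R.
Proof.
have z0 j : zt ^+ j != 0 by rewrite expf_neq0// zt_neq0.
pose x := zt ^+ l / zt ^+ k.
have -> : \sum_(m < N) (zt ^+ (m * l) / zt ^+ (m * k)) = \sum_(m < N) x ^+ m.
  by apply: eq_bigr => m _; rewrite /x expr_div_n -!exprM !(mulnC m).
have [kl|kl] := eqVneq k l.
  rewrite /x kl mulfV// mul1r;
  by under eq_bigr do rewrite expr1n; rewrite sumr_const card_ord.
rewrite mul0r; apply/eqP; have := subrX1 x N.
have -> : x ^+ N = 1.
  by rewrite /x expr_div_n -!exprM !(mulnC _ N) !exprM (prim_expr_order pz) !expr1n divr1.
rewrite subrr => /esym/eqP; rewrite mulf_eq0 subr_eq0 => /orP[|//] /eqP x1.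
case/negP: kl; have : zt ^+ l = zt ^+ k by rewrite -[LHS](divfK (z0 k)) -/x x1 mul1r.
by move=> /eqP; rewrite (eq_prim_root_expr pz) !modn_small// eq_sym.
Qed.

Definition dft (W : nat -> E) (m : nat) : E :=
  \sum_(k < N) (zt ^+ (m * k))^-1 *: W k.

(** Only orthogonality of characters enters, so the form may be non-symmetric: this is applied to
    [f] on a sequence and its shift as well as to inner products. *)
Lemma parseval (phi : E -> E -> R[i]) (V W : nat -> E) : sesq phi ->
  \sum_(m < N) phi (dft V m) (dft W m) = N%:R * \sum_(k < N) phi (V k) (W k).
Proof.
move=> sphi; rewrite /dft.
under eq_bigr => m _.
  rewrite (sesq_suml sphi); under eq_bigr => k _.
    rewrite (sesq_sumr sphi); under eq_bigr => l _ do
      rewrite (sesqZl sphi) (sesqZr sphi) prim_normV mulrA [_^-1 * _]mulrC.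
    over.
  over.
rewrite exchange_big mulr_sumr; apply: eq_bigr => k _.
rewrite exchange_big /= (bigD1 k)//= -mulr_suml root_sum eqxx mul1r.
rewrite big1 ?addr0// => l lk.
by rewrite -mulr_suml root_sum eq_sym (negbTE lk) !mul0r.
Qed.

Lemma dft_shift (W : nat -> E) m : W N = W 0%N ->
  dft (fun k => W k.+1) m = zt ^+ m *: dft W m.
Proof.
move=> WN; rewrite /dft scaler_sumr.
have z0 j : zt ^+ j != 0 by rewrite expf_neq0// zt_neq0.
have e (k : nat) : (zt ^+ (m * k))^-1 *: W k.+1
    = zt ^+ m *: ((zt ^+ (m * k.+1))^-1 *: W k.+1).
  by rewrite scalerA mulnS exprD invfM mulrA mulfV// mul1r.
under eq_bigr => k _ do rewrite e.
pose G k := zt ^+ m *: ((zt ^+ (m * k))^-1 *: W k).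
have : \sum_(k < N.+1) G k = \sum_(k < N.+1) G k by [].
rewrite {1}big_ord_recl big_ord_recr /= [LHS]addrC.
have -> : G N = G 0%N.
  rewrite /G WN muln0 expr0 mulnC exprM (prim_expr_order pz) expr1n //.
by move/addIr.
Qed.

Lemma dftB (V W : nat -> E) m : dft (fun k => V k - W k) m = dft V m - dft W m.
Proof.
by rewrite /dft -sumrB; apply: eq_bigr => k _; rewrite scalerBr.
Qed.

End DFT.

Section CyclicForm.
Variables (R : realType) (E X : hilbertType R) (iota : {linear E -> X}).
Variables (f : E -> E -> R[i]) (mb : R).
Hypotheses (sf : sesq f) (mb0 : 0 <= mb).
Hypothesis parab : forall u, `|complex.Im (f u u)| <= mb * nm (iota u) * nm u.

Let sesq_iota : sesq (fun u v => inner (iota u) (iota v)).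
Proof. by split=> *; rewrite ?(linearD iota) ?(linearZ_LR iota) /= !innerE. Qed.

(* On the Fourier side the left-hand side is a sum of
   [Im (zt^m) Im f(W_m, W_m)], and [|Im zt^m| <= |zt^m - 1|] is the symbol of
   the difference operator. *)
Lemma cyclic_form_le N (W : nat -> E) (tau : R) : (0 < N)%N -> W N = W 0%N -> 0 < tau ->
  \sum_(k < N) complex.Re (f (W k.+1) (W k) - f (W k) (W k.+1))
  <= mb * (\sum_(k < N) nm (iota (W k.+1 - W k)) ^+ 2 / tau
           + tau * \sum_(k < N) nm (W k) ^+ 2).
Proof.
move=> N0 WN tau0; have [zt pz] := prim_root_exists R N0.
have NR : 0 < N%:R :> R by rewrite ltr0n.
pose W' k := W k.+1; pose h m := dft N zt W m.
have sh m : dft N zt W' m = zt ^+ m *: h m by exact: dft_shift.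
have ReN m : complex.Re (N%:R * m : R[i]) = N%:R * complex.Re m.
  by rewrite -(rmorph_nat (real_complex R)) cReCM.
have Re_sum (F : nat -> R[i]) : complex.Re (\sum_(k < N) F k) = \sum_(k < N) complex.Re (F k).
  by rewrite (big_morph (@complex.Re R) (@cReD R) (erefl : complex.Re (0 : R[i]) = 0)).
rewrite -(ler_pM2l NR).
have -> : N%:R * \sum_(k < N) complex.Re (f (W k.+1) (W k) - f (W k) (W k.+1))
  = \sum_(m < N) - (2 * (complex.Im (zt ^+ m) * complex.Im (f (h m) (h m)))).
  rewrite -(Re_sum (fun k => f (W k.+1) (W k) - f (W k) (W k.+1))) -ReN sumrB mulrBr.
  rewrite -(parseval N0 pz W' W sf) -(parseval N0 pz W W' sf) -sumrB.
  rewrite (Re_sum (fun m => f (dft N zt W' m) (dft N zt W m) - f (dft N zt W m) (dft N zt W' m))).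
  apply: eq_bigr => m _; rewrite sh (sesqZl sf) (sesqZr sf) cReD cReN !cReM cReJ cImJ /h.
  ring.
have e1 : N%:R * \sum_(k < N) nm (iota (W k.+1 - W k)) ^+ 2
   = \sum_(m < N) nm (zt ^+ m - 1) ^+ 2 * nm (iota (h m)) ^+ 2.
  have := parseval N0 pz (fun k => W' k - W k) (fun k => W' k - W k) sesq_iota.
  move/(congr1 (@complex.Re R)).
  rewrite ReN (Re_sum (fun m => inner (iota (dft N zt (fun k => W' k - W k) m))
    (iota (dft N zt (fun k => W' k - W k) m)))).
  rewrite (Re_sum (fun k => inner (iota (W' k - W k)) (iota (W' k - W k)))).
  under [X in _ = _ * X -> _]eq_bigr do rewrite inner_nm.
  move=> /= <-; apply: eq_bigr => m _.
  by rewrite inner_nm dftB sh -/(h m) -[X in _ - X]scale1r -scalerBl linearZ nmZ exprMn.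
have e2 : N%:R * \sum_(k < N) nm (W k) ^+ 2 = \sum_(m < N) nm (h m) ^+ 2.
  have := parseval N0 pz W W (@sesq_inner R E).
  move/(congr1 (@complex.Re R)).
  rewrite ReN (Re_sum (fun m => inner (dft N zt W m) (dft N zt W m))).
  rewrite (Re_sum (fun k => inner (W k) (W k))).
  under [X in _ = _ * X -> _]eq_bigr do rewrite inner_nm.
  by move=> /= <-; apply: eq_bigr => m _; rewrite inner_nm.
have -> : N%:R * (mb * (\sum_(k < N) nm (iota (W k.+1 - W k)) ^+ 2 / tau
     + tau * \sum_(k < N) nm (W k) ^+ 2)) =
   \sum_(m < N) (mb * (nm (zt ^+ m - 1) ^+ 2 * nm (iota (h m)) ^+ 2 / tau + tau * nm (h m) ^+ 2)).
  rewrite -mulr_sumr big_split /= -!mulr_suml -mulr_sumr -e1 -e2; ring.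
apply: ler_sum => m _; set s := zt ^+ m; set v := h m.
have Ims : `|complex.Im s| <= nm (s - 1).
  by have := Im_nm (s - 1); rewrite cImD cImN /= oppr0 addr0.
have h1 : - (complex.Im s * complex.Im (f v v)) <= nm (s - 1) * (mb * nm (iota v) * nm v).
  by rewrite (le_trans (ler_norm _))// normrN normrM ler_pM// parab.
have h2 : 2 * (nm (s - 1) * nm (iota v) * nm v)
     <= nm (s - 1) ^+ 2 * nm (iota v) ^+ 2 / tau + tau * nm v ^+ 2.
  have : 0 <= (nm (s - 1) * nm (iota v) - tau * nm v) ^+ 2 / tau.
    by rewrite divr_ge0 ?sqr_ge0// ltW.
  rewrite (_ : _ / _ = nm (s - 1) ^+ 2 * nm (iota v) ^+ 2 / tau
     - 2 * (nm (s - 1) * nm (iota v) * nm v) + tau * nm v ^+ 2); first by lra.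
  by field; rewrite gt_eqF.
by have := ler_wpM2l mb0 h2; lra.
Qed.

End CyclicForm.

(** * The discrete energy estimate *)

Section Scheme.
Variables (R : realType) (E X : hilbertType R) (iota : {linear E -> X}).

(* Crank-Nicolson scheme of step [h] for [w' = u], [u' = - A w] started at
   [w = 0]; then [u] approximates [cos(t sqrt A) u0]. *)
Record scheme (f : E -> E -> R[i]) (h : R) (u : nat -> X) (w : nat -> E) : Prop :=
  Scheme {
  sc_h0 : 0 < h;
  sc_w0 : w 0%N = 0;
  sc_pos : forall k, iota (w k.+1) - iota (w k) = (h / 2)%:C *: (u k.+1 + u k);
  sc_vel : forall k v,
    (h / 2)%:C * f (w k.+1 + w k) v = - inner (u k.+1 - u k) (iota v) }.

(* The left-hand side does not depend on [m], for a fixed value of [n]. *)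
Lemma scheme_duality f h (u us : nat -> X) (w ws : nat -> E) m n : sesq f ->
  scheme f h u w -> scheme (adj f) h us ws ->
  inner (u m) (us (m + n)%N) + f (w m) (ws (m + n)%N) = inner (u 0%N) (us n).
Proof.
move=> sf su sus; elim: m => [|m <-].
  by rewrite (sc_w0 su) (sesq0l sf) addr0.
rewrite addSn; set k := (m + n)%N.
have h0 : ((h / 2)%:C : R[i]) != 0.
  by apply: posC_neq0; rewrite divr_gt0// (sc_h0 su).
(* Each velocity equation is tested with the position increment of the other scheme; in the sum of
   the two, the mixed terms cancel. *)
have e1 := sc_vel su m (ws k.+1 - ws k).
have e2 := congr1 Num.conj (sc_vel sus k (w m.+1 - w m)).
rewrite (linearB iota) /= (sc_pos sus) !innerE conjCr in e1.
rewrite rmorphM /= /adj conjCK conjCr rmorphN /= -innerC in e2.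
rewrite (linearB iota) /= (sc_pos su) !innerE in e2.
rewrite !(sesqE sf) in e1 e2.
have : (h / 2)%:C * (2 * (f (w m.+1) (ws k.+1) - f (w m) (ws k)))
     = (h / 2)%:C * (2 * (inner (u m) (us k) - inner (u m.+1) (us k.+1))).
  apply/eqP; rewrite -subr_eq0; apply/eqP.
  by have /eqP := congr2 +%R e1 e2; rewrite -subr_eq0 => /eqP e; rewrite -[RHS]e; ring.
move/(mulfI h0)/(mulfI (_ : 2 != 0)); rewrite pnatr_eq0 => /(_ isT) /eqP.
rewrite -subr_eq0 => /eqP e; apply/eqP; rewrite -subr_eq0; apply/eqP.
by rewrite -[RHS]e; ring.
Qed.

(** Tests the velocity equation with w_(k+1) - w_k; [sc_pos] turns the inner product into
    |u_(k+1)|^2 - |u_k|^2. *)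
Lemma scheme_energy f h (u : nat -> X) (w : nat -> E) k : sesq f -> scheme f h u w ->
  (nm (u k.+1) ^+ 2 + complex.Re (f (w k.+1) (w k.+1)))
   - (nm (u k) ^+ 2 + complex.Re (f (w k) (w k)))
  = complex.Re (f (w k.+1) (w k) - f (w k) (w k.+1)).
Proof.
move=> sf su; have h0 : ((h / 2)%:C : R[i]) != 0.
  by apply: posC_neq0; rewrite divr_gt0// (sc_h0 su).
have := sc_vel su k (w k.+1 - w k).
rewrite (linearB iota) /= (sc_pos su) (sesqZr (@sesq_inner R X)) conjCr -mulrN.
move/(mulfI h0)/(congr1 (@complex.Re R)).
rewrite !(sesqE sf) !innerE !inner_nm !(cReD, cReN) /=.
have := ripC (u k) (u k.+1); rewrite /rip => -> /=; lra.
Qed.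

End Scheme.

Section Weights.
Variable R : realType.
Implicit Types (a : nat -> R) (N : nat).

Lemma sum_sum N a :
  \sum_(k < N) \sum_(i < k.+1) a i = \sum_(i < N) (N - i)%:R * a i.
Proof.
elim: N => [|N IH]; first by rewrite !big_ord0.
rewrite big_ord_recr /= IH !big_ord_recr /= subSnn mul1r addrA; congr (_ + _).
rewrite -big_split /=; apply: eq_bigr => i _.
by rewrite subSn ?(ltnW (ltn_ord i))// -natr1 mulrDl mul1r.
Qed.

Lemma sqr_sum_le N a : (\sum_(i < N) a i) ^+ 2 <= N%:R * \sum_(i < N) a i ^+ 2.
Proof.
elim: N => [|N IH]; first by rewrite !big_ord0 expr0n mulr0.
rewrite !big_ord_recr /= -natr1; set s := \sum_(i < N) a i.
set q := \sum_(i < N) a i ^+ 2; rewrite -/s -/q in IH.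
suff : 2 * (s * a N) <= q + N%:R * a N ^+ 2 by have := sqr_ge0 (a N); lra.
have : 0 <= \sum_(i < N) (a i - a N) ^+ 2 by apply: sumr_ge0 => i _; exact: sqr_ge0.
under eq_bigr => i _ do rewrite sqrrB.
rewrite big_split /= sumrB sumr_const card_ord sumrMnl -mulr_suml -/s -/q.
by rewrite -[X in _ + X]mulr_natl; lra.
Qed.

(** Summation by parts. Consecutive weights (N - k)(N - k - 1) differ by twice a linear weight, so
    energy increments become a linearly weighted time average of the energy. *)
Lemma abel N (E : nat -> R) :
  \sum_(k < N) (N - k)%:R * (N - k.+1)%:R * (E k.+1 - E k)
  = 2 * \sum_(k < N) (N - k)%:R * E k - N%:R * (N%:R + 1) * E 0%N.
Proof.
suff h n : (n <= N)%N -> \sum_(k < n) (N - k)%:R * (N - k.+1)%:R * (E k.+1 - E k)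
  = 2 * \sum_(k < n) (N - k)%:R * E k - N%:R * (N%:R + 1) * E 0%N
    + (N - n)%:R * ((N - n)%:R + 1) * E n.
  by rewrite h// subnn !mul0r addr0.
elim: n => [_|n IH nN]; first by rewrite !big_ord0 subn0; ring.
rewrite !big_ord_recr /= IH ?(ltnW nN)//.
have -> : (N - n)%:R = (N - n.+1)%:R + 1 :> R by rewrite natr1 subnSK.
ring.
Qed.

End Weights.

Section QuadraticEstimate.
Variables (R : realType) (E X : hilbertType R) (iota : {linear E -> X}).
Variables (f : E -> E -> R[i]) (M d om eps mb : R).
Hypotheses (fb : form_bounds iota f M d om eps) (mb0 : 0 <= mb).
Hypothesis parab : forall u, `|complex.Im (f u u)| <= mb * nm (iota u) * nm u.
Variables (h : R) (u : nat -> X) (w : nat -> E).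
Hypothesis sc : scheme iota f h u w.

Let h0 : 0 < h := sc_h0 sc.
Let d0 : 0 < d := fb_d0 fb.
Let sf : sesq f := fb_sesq fb.

Lemma pos_le k : nm (iota (w k)) <= h * (\sum_(i < k.+1) nm (u i)).
Proof.
(* The trapezoidal rule counts the last value by half; this sharper form is the one that passes the
   induction. *)
suff : nm (iota (w k)) <= h * (\sum_(i < k) nm (u i)) + h / 2 * nm (u k).
  move=> a; rewrite big_ord_recr /= mulrDr (le_trans a)// lerD2l ler_wpM2r ?nm_ge0//.
  by have := h0; lra.
elim: k => [|k IH].
  by rewrite (sc_w0 sc) linear0 nm0 big_ord0 mulr0 add0r mulr_ge0 ?nm_ge0// divr_ge0// ltW.
rewrite (le_trans (nm_le_dist _ (iota (w k))))// (sc_pos sc) nmZ nmC_ge0 ?divr_ge0 ?(ltW h0)//.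
rewrite big_ord_recr /=; have := ler_wpM2l (divr_ge0 (ltW h0) (ler0n R 2)) (nmD (u k.+1) (u k)).
lra.
Qed.

Variable N : nat.
Hypothesis N0 : (0 < N)%N.

Let F := \sum_(k < N) (N - k)%:R * (nm (u k) ^+ 2 + d * nm (w k) ^+ 2).

Let Fa : \sum_(k < N) (N - k)%:R * nm (u k) ^+ 2 <= F.
Proof.
apply: ler_sum => k _; rewrite ler_wpM2l ?ler0n// lerDl.
by rewrite mulr_ge0 ?sqr_ge0// ltW.
Qed.

Let Fb : d * \sum_(k < N) (N - k)%:R * nm (w k) ^+ 2 <= F.
Proof.
rewrite mulr_sumr; apply: ler_sum => k _; rewrite mulrCA ler_wpM2l ?ler0n// lerDr.
by rewrite sqr_ge0.
Qed.

Let sum_pos : \sum_(k < N) nm (iota (w k)) ^+ 2 <= h ^+ 2 * N%:R * F.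
Proof.
apply: le_trans (ler_wpM2l (mulr_ge0 (sqr_ge0 h) (ler0n R N)) Fa).
rewrite -(sum_sum N (fun k => nm (u k) ^+ 2)) mulr_sumr.
apply: ler_sum => k _.
have := pos_le k => hp.
have : nm (iota (w k)) ^+ 2 <= (h * \sum_(i < k.+1) nm (u i)) ^+ 2.
  by rewrite lerXn2r// ?nnegrE ?nm_ge0// (le_trans _ hp)// nm_ge0.
move/le_trans; apply; rewrite exprMn -[leRHS]mulrA ler_wpM2l ?sqr_ge0//.
rewrite (le_trans (sqr_sum_le _ (fun i => nm (u i))))// ler_wpM2r//.
  by apply: sumr_ge0 => i _; exact: sqr_ge0.
by rewrite ler_nat.
Qed.

Let W k : E := (N - k)%:R *: w k.

Let natC k : (k%:R : R[i]) = (k%:R : R)%:C.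
Proof. by rewrite rmorph_nat. Qed.

Let sum_W : d * \sum_(k < N) nm (W k) ^+ 2 <= N%:R * F.
Proof.
rewrite (le_trans _ (ler_wpM2l _ Fb)) ?ler0n// mulrCA ler_wpM2l ?(ltW d0)// mulr_sumr.
apply: ler_sum => k _; rewrite /W natC nmZ nmC_ge0 ?ler0n// exprMn [leRHS]mulrA.
rewrite ler_wpM2r ?sqr_ge0// expr2 ler_wpM2r ?ler0n// ler_nat leq_subr//.
Qed.

Let sum_dW : \sum_(k < N) nm (iota (W k.+1 - W k)) ^+ 2 <= 4 * h ^+ 2 * N%:R * F.
Proof.
have q k : nm (iota (W k.+1 - W k)) ^+ 2 <=
   h ^+ 2 * ((N - k.+1)%:R ^+ 2 * nm (u k.+1) ^+ 2) + h ^+ 2 * ((N - k)%:R ^+ 2 * nm (u k) ^+ 2)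
   + 2 * nm (iota (w k)) ^+ 2.
  have [kN|kN] := leqP N k.
    have -> : W k.+1 - W k = 0.
      have e1 : (N - k)%N = 0%N by apply/eqP; rewrite subn_eq0.
      have e2 : (N - k.+1)%N = 0%N by apply/eqP; rewrite subn_eq0 leqW.
      by rewrite /W e1 e2 !scale0r subr0.
    rewrite linear0 nm0 expr0n /=.
    by do ?[exact: sqr_ge0|exact: ler0n|apply: addr_ge0|apply: mulr_ge0].
  (* Discrete product rule: a weighted increment of [w], expressed by [u], minus [w] itself, which
     [sum_pos] controls. *)
  have -> : iota (W k.+1 - W k) = ((N - k.+1)%:R * (h / 2))%:C *: (u k.+1 + u k) - iota (w k).
    rewrite rmorphM -scalerA -(sc_pos sc) /W -(subnSK kN) -natr1 natC.
    by rewrite linearB !linearZ /=; vec.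
  set c := (N - k.+1)%:R; set c' := (N - k)%:R.
  have cc : 0 <= c <= c' by rewrite ler0n ler_nat leq_sub.
  rewrite (le_trans (sqr_nmB_le _ _))// lerD2r nmZ nmC_ge0; last first.
    by rewrite mulr_ge0 ?ler0n ?divr_ge0 ?(ltW h0).
  have uu : nm (u k.+1 + u k) ^+ 2 <= 2 * nm (u k.+1) ^+ 2 + 2 * nm (u k) ^+ 2.
    by have := sqr_nmB_le (u k.+1) (- u k); rewrite opprK nmN.
  have c2 : c ^+ 2 <= c' ^+ 2 by case/andP: cc => a b; rewrite lerXn2r// ?nnegrE// (le_trans a).
  have hc : 0 <= h ^+ 2 * c ^+ 2 / 2 by rewrite divr_ge0// mulr_ge0 ?sqr_ge0.
  have := ler_wpM2l hc uu.
  have := ler_wpM2r (mulr_ge0 (sqr_ge0 h) (sqr_ge0 (nm (u k)))) c2.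
  by rewrite !exprMn; lra.
apply: le_trans (ler_sum _ (fun (k : 'I_N) _ => q k)) _.
rewrite 2!big_split /= -!mulr_sumr.
have a1 : \sum_(k < N) (N - k)%:R ^+ 2 * nm (u k) ^+ 2 <= N%:R * F.
  rewrite (le_trans _ (ler_wpM2l _ Fa)) ?ler0n// mulr_sumr; apply: ler_sum => k _.
  by rewrite [leRHS]mulrA ler_wpM2r ?sqr_ge0// expr2 ler_wpM2r ?ler0n// ler_nat leq_subr.
have a2 : \sum_(k < N) (N - k.+1)%:R ^+ 2 * nm (u k.+1) ^+ 2 <= N%:R * F.
  apply: le_trans a1; pose G k := (N - k)%:R ^+ 2 * nm (u k) ^+ 2.
  have : \sum_(k < N.+1) G k = \sum_(k < N.+1) G k by [].
  rewrite {1}big_ord_recl big_ord_recr /= /G subnn expr0n mul0r addr0 => <-.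
  by rewrite lerDr mulr_ge0 ?sqr_ge0.
have h2 := sqr_ge0 h.
have := ler_wpM2l h2 a1; have := ler_wpM2l h2 a2; have := sum_pos.
lra.
Qed.

(* Weighting the energy increments by [(N - k) (N - k - 1)] turns their sum into
   the left-hand side of [cyclic_form_le] for the sequence [W k = (N - k) w_k],
   which vanishes at both ends. *)
Lemma quadratic_estimate :
    2 * om * (h * N%:R) ^+ 2 + mb * (h * N%:R) * (4 + d^-1) <= 1 ->
  \sum_(k < N) (N - k)%:R * (nm (u k) ^+ 2 + d * nm (w k) ^+ 2)
    <= 2 * N%:R ^+ 2 * nm (u 0%N) ^+ 2.
Proof.
move=> small; rewrite -/F.
pose En k := nm (u k) ^+ 2 + complex.Re (f (w k) (w k)).
have WN : W N = W 0%N by rewrite /W subnn scale0r (sc_w0 sc) scaler0.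
have := cyclic_form_le sf mb0 parab N0 WN h0.
have -> : \sum_(k < N) complex.Re (f (W k.+1) (W k) - f (W k) (W k.+1))
   = \sum_(k < N) (N - k)%:R * (N - k.+1)%:R * (En k.+1 - En k).
  apply: eq_bigr => k _; rewrite (scheme_energy k sf sc) /W !natC !(sesqE sf) !conjCr.
  by rewrite !(cReD, cReN, cReCM); ring.
rewrite abel => cyc.
have E0 : En 0%N = nm (u 0%N) ^+ 2.
  by rewrite /En (sc_w0 sc) (sesq0l sf) /= addr0.
have F0 : 0 <= F.
  apply: sumr_ge0 => k _; rewrite mulr_ge0 ?ler0n ?addr_ge0 ?sqr_ge0//.
  by rewrite mulr_ge0 ?sqr_ge0// ltW.
have lowE : F - om * (h ^+ 2 * N%:R ^+ 2 * F) <= \sum_(k < N) (N - k)%:R * En k.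
  have : om * (N%:R * \sum_(k < N) nm (iota (w k)) ^+ 2) <= om * (h ^+ 2 * N%:R ^+ 2 * F).
    rewrite ler_wpM2l ?(fb_om0 fb)//; have := ler_wpM2l (ler0n R N) sum_pos; lra.
  rewrite -lerN2 => /(lerD (lexx F))/le_trans; apply.
  rewrite lerBlDr mulrA mulr_sumr -big_split /=; apply: ler_sum => k _.
  have c0 : 0 <= (N - k)%:R :> R by rewrite ler0n.
  have cN : (N - k)%:R <= N%:R :> R by rewrite ler_nat leq_subr.
  have := ler_wpM2l c0 (fb_elliptic fb (w k)).
  have := ler_wpM2r (mulr_ge0 (fb_om0 fb) (sqr_ge0 (nm (iota (w k))))) cN.
  by rewrite /En; lra.
have NR : 1 <= N%:R :> R by rewrite ler1n.
have cyc2 : mb * (\sum_(k < N) nm (iota (W k.+1 - W k)) ^+ 2 / h + h * \sum_(k < N) nm (W k) ^+ 2)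
    <= mb * (h * N%:R) * (4 + d^-1) * F.
  rewrite -!mulrA ler_wpM2l// -mulr_suml.
  have b1 : (\sum_(k < N) nm (iota (W k.+1 - W k)) ^+ 2) / h <= 4 * h * N%:R * F.
    rewrite ler_pdivrMr// (le_trans sum_dW)// le_eqVlt; apply/orP; left; apply/eqP; ring.
  have b2 : h * (\sum_(k < N) nm (W k) ^+ 2) <= h * (N%:R * F / d).
    by rewrite ler_wpM2l ?(ltW h0)// ler_pdivlMr// mulrC sum_W.
  lra.
(* The left-hand side contains 2 F; [small] says that the ellipticity shift and the cyclic term
   consume at most one F. *)
have := ler_wpM2r F0 small; rewrite E0 in cyc.
have := sqr_ge0 (nm (u 0%N)) => u00.
have := ler_wpM2r u00 (_ : N%:R * (N%:R + 1) <= 2 * N%:R ^+ 2 :> R).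
move=> /(_ ltac:(by nra)); lra.
Qed.

End QuadraticEstimate.

Lemma nm_sum (R : realType) (X : hilbertType R) n (F : nat -> X) :
  nm (\sum_(i < n) F i) <= \sum_(i < n) nm (F i).
Proof.
elim: n => [|n IH]; first by rewrite !big_ord0 nm0.
by rewrite !big_ord_recr /= (le_trans (nmD _ _))// lerD2r.
Qed.

(** * Chebyshev polynomials of an operator *)

Section Chebyshev.
Variables (R : realType) (X : hilbertType R).
Implicit Types (p q : {linear X -> X}) (x y : X).

(* [cheb p n] and [chebU p n] are the Chebyshev polynomials [T_n(p)] and
   [U_n(p)] of the operator [p]. *)
Definition cheb_pair p n (s : X * X) : X * X :=
  iter n (fun s => (s.2, 2 *: p s.2 - s.1)) s.

(* Locked: unification would otherwise unfold [cheb p n.+2 x] to a difference. *)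
Fact cheb_key : unit. Proof. exact: tt. Qed.

Definition cheb p n x : X := locked_with cheb_key (cheb_pair p n (x, p x)).1.

Definition chebU p n x : X := locked_with cheb_key (cheb_pair p n (x, 2 *: p x)).1.

Lemma cheb0 p x : cheb p 0 x = x. Proof. by rewrite /cheb unlock. Qed.
Lemma cheb1 p x : cheb p 1 x = p x. Proof. by rewrite /cheb unlock. Qed.
Lemma chebSS p n x : cheb p n.+2 x = 2 *: p (cheb p n.+1 x) - cheb p n x.
Proof. by rewrite /cheb !unlock. Qed.
Lemma chebU0 p x : chebU p 0 x = x. Proof. by rewrite /chebU unlock. Qed.
Lemma chebU1 p x : chebU p 1 x = 2 *: p x. Proof. by rewrite /chebU unlock. Qed.
Lemma chebUSS p n x : chebU p n.+2 x = 2 *: p (chebU p n.+1 x) - chebU p n x.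
Proof. by rewrite /chebU !unlock. Qed.

Lemma nat_ind2 (P : nat -> Prop) :
  P 0%N -> P 1%N -> (forall n, P n -> P n.+1 -> P n.+2) -> forall n, P n.
Proof.
move=> P0 P1 PS n; suff: P n /\ P n.+1 by case.
by elim: n => [|n [a b]]; split=> //; exact: PS.
Qed.

Lemma cheb_linear p n : linear (cheb p n).
Proof.
move=> a x y; elim/nat_ind2: n => [|| n IH1 IH2]; rewrite ?cheb0 ?cheb1 ?linearP//.
rewrite !chebSS IH1 IH2 linearP /=; vec.
Qed.

HB.instance Definition _ p n :=
  GRing.isLinear.Build R[i] X X *:%R (cheb p n) (cheb_linear p n).

Lemma chebB p n x y : cheb p n (x - y) = cheb p n x - cheb p n y.
Proof. exact: linearB. Qed.
Lemma chebZ p n a x : cheb p n (a *: x) = a *: cheb p n x.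
Proof. exact: linearZ_LR. Qed.

Lemma chebU_linear p n : linear (chebU p n).
Proof.
move=> a x y; elim/nat_ind2: n => [|| n IH1 IH2]; rewrite ?chebU0//.
  by rewrite !chebU1 linearP /=; vec.
rewrite !chebUSS IH1 IH2 linearP /=; vec.
Qed.

HB.instance Definition _ p n :=
  GRing.isLinear.Build R[i] X X *:%R (chebU p n) (chebU_linear p n).

Lemma cheb_comm p q n x : (forall x, q (p x) = p (q x)) -> q (cheb p n x) = cheb p n (q x).
Proof.
move=> h; elim/nat_ind2: n => [|| n IH1 IH2]; rewrite ?cheb0 ?cheb1//.
by rewrite !chebSS (linearB q) (linearZ_LR q) h IH1 IH2.
Qed.

Lemma cheb_commC p m n x : cheb p m (cheb p n x) = cheb p n (cheb p m x).
Proof. by apply: cheb_comm => y; rewrite (cheb_comm (q := p)). Qed.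

(** The addition formula T_(a+b) + T_(a-b) = 2 T_a T_b, indexed by b = m and a - b = k to avoid
    truncated subtraction. *)
Lemma cheb_mul p k m x :
  cheb p (k + m.*2) x + cheb p k x = 2 *: cheb p (k + m) (cheb p m x).
Proof.
have pc j y : p (cheb p j y) = cheb p j (p y) by exact: cheb_comm.
elim/nat_ind2: m k => [k|k|m IH1 IH2 k].
- by rewrite addn0 cheb0 -mulr2n -scaler_nat.
- by rewrite addn2 addn1 chebSS cheb1 subrK pc.
have h1 := IH2 k.+1; have h2 := IH1 k.+2.
rewrite !doubleS !addnS in h1 *; rewrite !addSn in h1 h2.
rewrite (chebSS p m) chebB chebZ -pc.
have -> : 2 *: (2 *: p (cheb p (k + m).+2 (cheb p m.+1 x)) - cheb p (k + m).+2 (cheb p m x))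
  = 2 *: p (2 *: cheb p (k + m).+2 (cheb p m.+1 x)) - 2 *: cheb p (k + m).+2 (cheb p m x).
  by rewrite (linearZ_LR p) scalerBr.
rewrite -h1 -h2 (linearD p) [cheb p (k + m.*2).+4 x]chebSS [cheb p k.+2 x]chebSS; vec.
Qed.

(** T_(2n) = T_n o T_2 turns 2n steps of length h/2 into n steps of one operator, comparable with
    the step of length h. *)
Lemma cheb_double p n x : cheb p n.*2 x = cheb (cheb p 2) n x.
Proof.
elim/nat_ind2: n => [|| n IH1 IH2]; rewrite ?cheb0 ?cheb1//.
have := cheb_mul p n.*2 2 x.
rewrite (_ : n.*2 + 2.*2 = n.+2.*2)%N; last by rewrite -doubleD addn2.
rewrite (_ : n.*2 + 2 = n.+1.*2)%N; last by rewrite addn2.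
by rewrite [cheb _ n.+2 x]chebSS -IH1 -IH2 cheb_commC => <-; rewrite addrK.
Qed.

(** Exhibits U_n as a sum of polynomials T_k; bounds on the T_k thus give linear growth of U_n. *)
Lemma chebU_cheb p n x : chebU p n.+2 x = chebU p n x + 2 *: cheb p n.+2 x.
Proof.
elim/nat_ind2: n => [|| n IH1 IH2].
- by rewrite chebUSS chebSS cheb0 cheb1 chebU0 chebU1 (linearZ_LR p); vec.
- rewrite chebUSS [chebU p 2 x]chebUSS !chebSS cheb0 cheb1 chebU0 chebU1.
  by rewrite !(linearB p) !(linearZ_LR p); vec.
rewrite chebUSS IH2 {1}IH1 [chebU p n.+2 x]chebUSS [cheb p n.+4 x]chebSS.
by rewrite !(linearD p) !(linearZ_LR p); vec.
Qed.

Lemma chebU_bound p n K x : 0 <= K ->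
  (forall k, (k <= n)%N -> nm (cheb p k x) <= K * nm x) ->
  nm (chebU p n x) <= 2 * n.+1%:R * K * nm x.
Proof.
move=> K0; have KX : 0 <= K * nm x by rewrite mulr_ge0 ?nm_ge0.
elim/nat_ind2: n => [h|h|n IH1 _ h].
- by have := h 0%N (leqnn _); rewrite cheb0 chebU0; lra.
- have := h 1%N (leqnn _); rewrite cheb1 chebU1 nmZ.
  by rewrite nm_nat; lra.
rewrite chebU_cheb (le_trans (nmD _ _))// nmZ nm_nat.
have := h _ (leqnn n.+2); have := IH1 (fun k hk => h k (leqW (leqW hk))).
by rewrite -[n.+3%:R]natr1 -[n.+2%:R]natr1; lra.
Qed.

(** The polynomials U_n are the fundamental solution of the Chebyshev recurrence, so a solution with
    sources [r] is a discrete convolution with them. *)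
Lemma duhamel p (e r : nat -> X) : e 0%N = 0 -> e 1%N = r 0%N ->
    (forall n, e n.+2 = 2 *: p (e n.+1) - e n + r n.+1) ->
  forall n, e n = \sum_(i < n) chebU p (n - i.+1) (r i).
Proof.
move=> e0 e1 eS; elim/nat_ind2 => [|| n IH1 IH2].
- by rewrite big_ord0.
- by rewrite big_ord1 subnn chebU0.
rewrite eS IH1 IH2 !big_ord_recr /= !subnn subSnn.
have -> : \sum_(i < n) chebU p (n.+2 - i.+1) (r i)
   = 2 *: p (\sum_(i < n) chebU p (n.+1 - i.+1) (r i))
     - \sum_(i < n) chebU p (n - i.+1) (r i).
  rewrite (linear_sum p) scaler_sumr -sumrB; apply: eq_bigr => i _.
  by rewrite (subSn (leqW (ltn_ord i))) (subSn (ltn_ord i)) chebUSS.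
by rewrite (linearD p) !chebU0 chebU1; vec.
Qed.

(** One factor n counts the sources, the other is the growth of U_n. *)
Lemma duhamel_bound p (e r : nat -> X) n (K rho : R) : 0 <= K ->
    e 0%N = 0 -> e 1%N = r 0%N ->
    (forall n, e n.+2 = 2 *: p (e n.+1) - e n + r n.+1) ->
    (forall k, (k <= n)%N -> forall x, nm (cheb p k x) <= K * nm x) ->
    (forall k, (k < n)%N -> nm (r k) <= rho) ->
  nm (e n) <= 2 * n%:R ^+ 2 * K * rho.
Proof.
move=> K0 e0 e1 eS hK hr; rewrite (duhamel e0 e1 eS).
apply: le_trans (nm_sum n (fun i => chebU p (n - i.+1) (r i))) _.
have -> : 2 * n%:R ^+ 2 * K * rho = \sum_(i < n) 2 * n%:R * K * rho.
  by rewrite sumr_const card_ord -mulr_natr; ring.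
apply: ler_sum => i _.
have ni : ((n - i.+1).+1 <= n)%N by rewrite subnSK// leq_subr.
have := @chebU_bound p (n - i.+1) K (r i) K0 (fun k hk => hK k (leq_trans hk (ltnW ni)) _).
move/le_trans; apply; have rr := hr _ (ltn_ord i).
rewrite ler_pM ?nm_ge0//; first by rewrite !mulr_ge0.
by rewrite ler_wpM2r// ler_wpM2l// ler_nat.
Qed.

Definition cheb_bounded p n (K : R) :=
  forall k, (k <= n)%N -> forall x, nm (cheb p k x) <= K * nm x.

Lemma cheb_dist p q n K x : 1 <= K -> (forall x, p (q x) = q (p x)) ->
  cheb_bounded p n K -> cheb_bounded q n K ->
  nm (cheb p n x - cheb q n x) <= 4 * n%:R ^+ 2 * K ^+ 2 * nm (p x - q x).
Proof.
move=> K1 pq hp hq; have K0 : 0 <= K by exact: le_trans K1.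
pose e k := cheb p k x - cheb q k x.
(* The first source has weight 1 because T_1(p) = p lacks the factor 2 of the recurrence. *)
pose r k := (if k is 0 then 1 else 2 : R[i]) *: cheb q k (p x - q x).
have qc j y : q (cheb q j y) = cheb q j (q y) by exact: cheb_comm.
have pc j y : p (cheb q j y) = cheb q j (p y) by exact: cheb_comm.
have := @duhamel_bound p e r n K (2 * K * nm (p x - q x)) K0.
have -> : 2 * n%:R ^+ 2 * K * (2 * K * nm (p x - q x))
  = 4 * n%:R ^+ 2 * K ^+ 2 * nm (p x - q x) by ring.
apply => //.
- by rewrite /e !cheb0 subrr.
- by rewrite /e /r !cheb1 cheb0 scale1r.
- move=> k; rewrite /e /r !chebSS !(linearB p) /= chebB -pc -qc; vec.
move=> k kn; rewrite /r nmZ -mulrA.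
have kx := hq k (ltnW kn) (p x - q x).
case: k kn kx => [|k] kn kx; rewrite ?nm1 ?nm_nat.
  by rewrite mul1r (le_trans kx)// ler_peMl ?mulr_ge0 ?nm_ge0// ler1n.
by rewrite ler_wpM2l.
Qed.

Lemma cheb_id n x : cheb (idfun : {linear X -> X}) n x = x.
Proof.
elim/nat_ind2: n => [|| n IH1 IH2]; rewrite ?cheb0 ?cheb1//.
by rewrite chebSS IH1 IH2 /=; vec.
Qed.

Lemma cheb_sub1 p n K x : 1 <= K -> cheb_bounded p n K ->
  nm (cheb p n x - x) <= 4 * n%:R ^+ 2 * K ^+ 2 * nm (p x - x).
Proof.
move=> K1 hp; have := @cheb_dist p (idfun : {linear X -> X}) n K x K1 (fun _ => erefl) hp.
rewrite cheb_id; apply => k _ y; rewrite cheb_id ler_peMl ?nm_ge0//.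
Qed.

(** Two polynomials U instead of a Duhamel sum: the bound on successive differences is linear in n,
    as Lipschitz continuity in time requires. *)
Lemma cheb_succ p n x :
  cheb p n.+2 x - cheb p n.+1 x = chebU p n.+1 (p x - x) + chebU p n (p x - x).
Proof.
elim/nat_ind2: n => [|| n IH1 IH2].
- by rewrite chebSS chebU1 chebU0 !cheb1 cheb0 (linearB p); vec.
- rewrite chebUSS !chebSS !chebU1 chebU0 !cheb1 cheb0.
  rewrite !(linearB p) !(linearZ_LR p) !(linearB p); vec.
rewrite (chebUSS p n.+1) [X in _ = _ + X]chebUSS.
have -> : 2 *: p (chebU p n.+2 (p x - x)) - chebU p n.+1 (p x - x)
   + (2 *: p (chebU p n.+1 (p x - x)) - chebU p n (p x - x))
   = 2 *: p (chebU p n.+2 (p x - x) + chebU p n.+1 (p x - x))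
     - (chebU p n.+1 (p x - x) + chebU p n (p x - x)).
  by rewrite (linearD p); vec.
by rewrite -IH1 -IH2 (linearB p) [X in _ - X = _]chebSS [cheb p n.+4 x]chebSS; vec.
Qed.

Lemma cheb_succ_bound p n K x : 1 <= K -> cheb_bounded p n K ->
  nm (cheb p n.+1 x - cheb p n x) <= 4 * n.+1%:R * K * nm (p x - x).
Proof.
move=> K1; have K0 : 0 <= K by exact: le_trans K1.
have KX : 0 <= K * nm (p x - x) by rewrite mulr_ge0 ?nm_ge0.
case: n => [|n] hp.
  by rewrite cheb1 cheb0; have := nm_ge0 (p x - x); nra.
rewrite cheb_succ (le_trans (nmD _ _))//.
have := @chebU_bound p n.+1 K (p x - x) K0 (fun k hk => hp k hk _).
have := @chebU_bound p n K (p x - x) K0 (fun k hk => hp k (leqW hk) _).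
by rewrite -[n.+2%:R]natr1; lra.
Qed.

(** k^2 has second difference 2, so x - k^2 g y solves the Chebyshev recurrence up to the defects
    [s0] and [s1]. *)
Lemma cheb_taylor p n K (g s0 s1 : R) x y : 0 <= K -> 0 <= g -> cheb_bounded p n K ->
    nm (p x - x + g%:C *: y) <= s0 -> nm (p y - y) <= s1 ->
  nm (cheb p n x - x + (n%:R ^+ 2 * g)%:C *: y)
    <= 2 * n%:R ^+ 2 * K * (2 * s0 + 2 * g * n%:R ^+ 2 * s1).
Proof.
move=> K0 g0 hp h0 h1.
pose e k := cheb p k x - x + (k%:R ^+ 2 * g)%:C *: y.
pose r k := (if k is 0 then 1 else 2 : R[i]) *: (p x - x + g%:C *: y)
   + (2 * g * k%:R ^+ 2)%:C *: (y - p y).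
have := @duhamel_bound p e r n K (2 * s0 + 2 * g * n%:R ^+ 2 * s1) K0; apply => //.
- by rewrite /e cheb0 subrr expr0n mul0r scale0r addr0.
- by rewrite /e /r cheb1 expr1n mul1r expr0n mulr0 scale0r addr0 scale1r.
- move=> k; rewrite /e /r chebSS -!natr1.
  rewrite !(linearB p, linearD p) !(linearZ_LR p).
  rewrite !(rmorphM, rmorphXn, rmorphD, rmorph1, rmorph_nat) /=; vec.
move=> k kn; rewrite /r (le_trans (nmD _ _))//.
have s00 : 0 <= s0 by exact: le_trans (nm_ge0 _) h0.
have s10 : 0 <= s1 by exact: le_trans (nm_ge0 _) h1.
apply: lerD.
  rewrite nmZ; case: (k) => [|m]; rewrite ?nm1 ?nm_nat; last by rewrite ler_wpM2l.
  by rewrite mul1r (le_trans h0)//; lra.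
have kk : k%:R ^+ 2 <= n%:R ^+ 2 :> R by rewrite lerXn2r ?nnegrE ?ler0n// ler_nat ltnW.
rewrite nmZ nmC_ge0; last by rewrite mulr_ge0 ?sqr_ge0// mulr_ge0.
rewrite nmBC ler_pM ?nm_ge0//; first by rewrite mulr_ge0 ?sqr_ge0// mulr_ge0.
by rewrite ler_wpM2l// mulr_ge0.
Qed.

End Chebyshev.

(** * The cosine function *)

Section Cosl.
Variables (R : realType) (X : hilbertType R) (J : R[i] -> {linear X -> X}).

(* The Crank-Nicolson step [(1 - h^2 A / 4) / (1 + h^2 A / 4)]: its [n]-th
   Chebyshev polynomial approximates [cos(n h sqrt A)]. *)
Definition cosl (h : R) : {linear X -> X} :=
  (2 : R[i]) \*: J (h ^+ 2 / 4)%:C \- idfun.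

Arguments cosl : simpl never.

Lemma coslE h x : cosl h x = 2 *: J (h ^+ 2 / 4)%:C x - x.
Proof. by []. Qed.

End Cosl.

(** * Stability of the Crank-Nicolson scheme on a short interval *)

Section CosStability.
Variables (R : realType) (E X : hilbertType R) (iota : {linear E -> X}).
Variables (M d om eps mb : R).

Section OneForm.
Variable f : E -> E -> R[i].
Hypothesis fb : form_bounds iota f M d om eps.
Local Notation J := (res fb).

Variable h : R.
Hypotheses (h0 : 0 < h) (ah : adm eps (step_radius om) (h ^+ 2 / 4)%:C).
Let z : R[i] := (h ^+ 2 / 4)%:C.

Let z0 : z != 0.
Proof. by apply: posC_neq0; rewrite divr_gt0// exprn_gt0. Qed.

(** Eliminating the velocity from the implicit step leaves q + (h^2/4) A q = w + (h/2) u for the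
    midpoint q of the two positions. *)
Definition cn_step (s : X * E) : X * E :=
  let w := 2 *: res_lift iota f z (iota s.2 + (h / 2)%:C *: s.1) - s.2 in
  ((2 / h)%:C *: (iota w - iota s.2) - s.1, w).

Definition cn x k : X * E := iter k cn_step (x, 0).

Lemma cn_scheme x : scheme iota f h (fun k => (cn x k).1) (fun k => (cn x k).2).
Proof.
have hC : (h / 2)%:C * (2 / h)%:C = 1 :> R[i].
  by rewrite -rmorphM /= (_ : h / 2 * (2 / h) = 1)//; field; rewrite gt_eqF.
split=> // k; rewrite /cn iterS; case: (iter k cn_step (x, 0)) => u w /=.
  by rewrite subrK scalerA hC scale1r.
move=> v; rewrite subrK; set y := iota w + _; set q := res_lift _ _ _ _.
have := liftP fb ah z0 y v; rewrite /shifted -/q => qP.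
have -> : (2 / h)%:C *: (iota (2 *: q - w) - iota w) - u - u
   = (2 / h)%:C *: (2 *: (iota q - y)).
  rewrite (linearB iota) (linearZ_LR iota) /y; apply: inner_ext => t; rewrite !innerE.
  transitivity ((2 / h)%:C * (2 * inner (iota q) (t) - inner (iota w) t - inner (iota w) t)
    - 2 * ((h / 2)%:C * (2 / h)%:C) * inner u t); last by ring.
  by rewrite hC; ring.
clearbody q y; have fq : f q v = (4 / h ^+ 2)%:C * inner (y - iota q) (iota v).
  have zz : (4 / h ^+ 2)%:C * z = 1.
    by rewrite /z -rmorphM /= (_ : _ * _ = 1)//; field; rewrite gt_eqF.
  by rewrite !innerE -qP addrAC subrr add0r mulrA zz mul1r.
rewrite (sesqZl (fb_sesq fb)) fq !innerE.
have hz : (h / 2)%:C * (4 / h ^+ 2)%:C = (2 / h)%:C :> R[i].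
  by rewrite -rmorphM /=; congr (_%:C); field; rewrite gt_eqF.
by rewrite -hz; ring.
Qed.

(** On (u, iota w) a step is a 2 x 2 matrix of commuting operators with both diagonal entries c = 2
    J - 1 and determinant c^2 - 4 J (J - 1) = 1; Cayley-Hamilton is then the Chebyshev
    recurrence. *)
Lemma cn_cheb x k : (cn x k).1 = cheb (cosl J h) k x.
Proof.
have hC : h%:C * (4 / h)%:C = 4 :> R[i].
  by rewrite -rmorphM /= (_ : h * (4 / h) = 4) ?rmorph_nat//; field; rewrite gt_eqF.
have hC2 : (2 / h)%:C * 2 = (4 / h)%:C :> R[i].
  by rewrite -(rmorph_nat (real_complex R) 2) -rmorphM /=; congr (_%:C); field; rewrite gt_eqF.
have hC3 : (2 / h)%:C * h%:C = 2 :> R[i].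
  by rewrite -rmorphM /= (_ : 2 / h * h = 2) ?rmorph_nat//; field; rewrite gt_eqF.
have hC4 : 2 * (h / 2)%:C = h%:C :> R[i].
  by rewrite -(rmorph_nat (real_complex R) 2) -rmorphM /=; congr (_%:C); field.
pose u j := (cn x j).1; pose v j := iota (cn x j).2.
have vS j : v j.+1 = cosl J h (v j) + h%:C *: J z (u j).
  rewrite coslE -/z /v /u /cn iterS; set s := iter j cn_step _; rewrite /= -/s.
  rewrite (linearB iota) (linearZ_LR iota) -(resE fb)//.
  by rewrite (linearD (J z)) (linearZ_LR (J z)) -hC4; vec.
have uS j : u j.+1 = cosl J h (u j) + (4 / h)%:C *: (J z (v j) - v j).
  have -> : u j.+1 = (2 / h)%:C *: (v j.+1 - v j) - u j by [].
  rewrite vS !coslE -/z -hC2; apply: inner_ext => t; rewrite !innerE.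
  transitivity ((2 / h)%:C * (2 * inner (J z (v j)) t - inner (v j) t - inner (v j) t)
     + ((2 / h)%:C * h%:C) * inner (J z (u j)) t - inner (u j) t); first by ring.
  by rewrite hC3; ring.
rewrite -/(u k); elim/nat_ind2: k => [|| k IH1 IH2].
- by rewrite cheb0.
- have v0 : v 0%N = 0 by rewrite /v /cn /= linear0.
  by rewrite cheb1 uS v0 linear0 subrr scaler0 addr0.
rewrite chebSS -IH1 -IH2 uS vS (uS k) !coslE -/z.
rewrite !(linearD (J z), linearN (J z), linearZ_LR (J z)).
apply: inner_ext => t; rewrite !innerE.
move: (inner (J z (J z (v k))) t) (inner (J z (v k)) t) (inner (v k) t)
  (inner (J z (J z (u k))) t) (inner (J z (u k)) t) (inner (u k) t) => a1 a2 a3 b1 b2 b3.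
apply/eqP; rewrite -subr_eq0; apply/eqP.
transitivity ((h%:C * (4 / h)%:C - 4) * (b1 - b2)); last by rewrite hC subrr mul0r.
ring.
Qed.

End OneForm.

Variable f : E -> E -> R[i].
Hypotheses (fb : form_bounds iota f M d om eps) (mb0 : 0 <= mb).
Hypothesis parab : forall u, `|complex.Im (f u u)| <= mb * nm (iota u) * nm u.

Let d0 : 0 < d := fb_d0 fb.

Lemma sum_window (A : nat -> R) n P N : (forall k, 0 <= A k) -> (n + P <= N)%N ->
  \sum_(m < P) A (n + m)%N <= \sum_(k < N) A k.
Proof.
move=> A0 /subnKC <-; rewrite -addnA big_split_ord /= big_split_ord /=.
rewrite addrCA lerDl addr_ge0//; apply: sumr_ge0 => k _; exact: A0.
Qed.

(** The quadratic estimate at horizon 4P: for k < 2P the weight 4P - k is at least 2P and can be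
    divided out. *)
Lemma scheme_sum (g : E -> E -> R[i]) (gb : form_bounds iota g M d om eps)
    (gp : forall u, `|complex.Im (g u u)| <= mb * nm (iota u) * nm u)
    h (u : nat -> X) (w : nat -> E) P :
    scheme iota g h u w -> (0 < P)%N ->
    2 * om * (h * (4 * P)%:R) ^+ 2 + mb * (h * (4 * P)%:R) * (4 + d^-1) <= 1 ->
  \sum_(k < 2 * P) (nm (u k) ^+ 2 + d * nm (w k) ^+ 2) <= 16 * P%:R * nm (u 0%N) ^+ 2.
Proof.
move=> sc P0 small; have N0 : (0 < 4 * P)%N by rewrite muln_gt0.
have P0' : 0 < P%:R :> R by rewrite ltr0n.
have := quadratic_estimate gb mb0 gp sc N0 small.
have e : (4 * P = 2 * P + 2 * P)%N by rewrite -mulnDl.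
rewrite [in X in X <= _ -> _]e big_split_ord /= => h1.
have pos k : 0 <= nm (u k) ^+ 2 + d * nm (w k) ^+ 2.
  by rewrite addr_ge0 ?sqr_ge0// mulr_ge0 ?sqr_ge0// ltW.
have h2 : \sum_(k < 2 * P) (2 * P)%:R * (nm (u k) ^+ 2 + d * nm (w k) ^+ 2)
   <= 2 * (4 * P)%:R ^+ 2 * nm (u 0%N) ^+ 2.
  apply: le_trans h1; rewrite -[leLHS]addr0; apply: lerD.
    apply: ler_sum => k _; rewrite ler_wpM2r// ler_nat -addnBA ?leq_addr//.
    exact: ltnW.
  by apply: sumr_ge0 => k _; rewrite mulr_ge0.
move: h2; rewrite -mulr_sumr !natrM => h2.
rewrite -(ler_pM2l (_ : 0 < 2 * P%:R)) ?mulr_gt0//.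
by rewrite (le_trans h2)// le_eqVlt; apply/orP; left; apply/eqP; ring.
Qed.

(* [scheme_duality] is averaged over [m < P], and [quadratic_estimate] controls
   the time averages of the energies of both schemes. *)
Lemma cos_stability : exists T h1 : R, [/\ 0 < T, 0 < h1 &
  forall h n, 0 < h <= h1 -> n%:R * h <= T ->
  forall x, nm (cheb (cosl (res fb) h) n x) <= 16 * (1 + M / d) * nm x].
Proof.
have om0 := fb_om0 fb; have M0 := fb_M0 fb.
(* The time T = 1/D satisfies the smallness condition of [quadratic_estimate]; the added 1 gives T
   <= 1, hence T^2 <= T. *)
pose D := 2 * om + mb * (4 + d^-1) + 1.
have D0 : 1 <= D.
  by rewrite lerDr addr_ge0 ?mulr_ge0 ?addr_ge0 ?invr_ge0 ?(ltW d0).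
have D0' : 0 < D by exact: lt_le_trans D0.
pose T := D^-1; have T0 : 0 < T by rewrite invr_gt0.
have T1 : T <= 1 by rewrite invf_le1.
have TD : T * D = 1 by rewrite mulVf// gt_eqF.
have sp := step_radius_gt0 fb.
pose h1 := Num.min (T / 4) (Num.min 1 (step_radius om)).
exists (T / 8), h1; split; [by rewrite divr_gt0| |].
  by rewrite !lt_min divr_gt0 ?ltr01 ?sp.
move=> h n /andP[h0]; rewrite !le_min => /and3P[hT h_1 hr] nh x.
have ah : adm eps (step_radius om) (h ^+ 2 / 4)%:C.
  rewrite adm_pos ?(ltW (fb_eps0 fb)) ?divr_ge0 ?sqr_ge0//.
  by rewrite (le_trans _ hr)//; nra.
(* P, the integer part of q, keeps 4 P h <= T, while n h <= T/8 forces n <= P, so the window n, ...,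
   n + P - 1 stays below 2P. *)
pose q := T / (4 * h); have qT : q * (4 * h) = T.
  by rewrite mulfVK// gt_eqF// mulr_gt0.
have q1 : 1 <= q by rewrite ler_pdivlMr ?mulr_gt0//; move: hT; rewrite ler_pdivlMr//; lra.
clearbody q T; pose P := Num.truncn q.
have /truncn_itv/andP[P1 P2] : 0 <= q by exact: le_trans q1.
rewrite -/P -?natr1 in P1 P2; clearbody P.
have P0 : (0 < P)%N by rewrite -(ltr0n R); lra.
have P0' : 1 <= P%:R :> R by rewrite ler1n.
have P4 : h * (4 * P)%:R <= T.
  by rewrite natrM -qT; have := ler_wpM2r (ltW h0) P1; lra.
have nP : (n <= P)%N.
  rewrite -(ler_nat R); have : n%:R <= q / 2.
    rewrite -(ler_pM2r h0); move: nh; rewrite -qT; lra.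
  lra.
have P4' : 0 <= h * (4 * P)%:R by rewrite mulr_ge0// ltW.
have small : 2 * om * (h * (4 * P)%:R) ^+ 2 + mb * (h * (4 * P)%:R) * (4 + d^-1) <= 1.
  move: (h * (4 * P)%:R) P4 P4' => t tT t0.
  have t1 : t <= 1 by exact: le_trans tT T1.
  have a1 : om * t ^+ 2 <= om * T by rewrite ler_wpM2l//; nra.
  have a2 : mb * (4 + d^-1) * t <= mb * (4 + d^-1) * T.
    by rewrite ler_wpM2l// mulr_ge0// addr_ge0// invr_ge0 ltW.
  by move: TD; rewrite /D; lra.
have fb' := form_bounds_adj fb.
have parab' u : `|complex.Im (adj f u u)| <= mb * nm (iota u) * nm u.
  by rewrite /adj cImJ normrN.
have sc := cn_scheme fb h0 ah x.
have key y : nm (inner y (cheb (cosl (res fb) h) n x)) <= 8 * (1 + M / d) * (nm x ^+ 2 + nm y ^+ 2).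
  have scs := cn_scheme fb' h0 ah y.
  have sx := scheme_sum fb parab sc P0 small.
  have sy := scheme_sum fb' parab' scs P0 small.
  move: sc scs sx sy; rewrite -(cn_cheb fb h0 ah).
  set u := fun k => (cn f h x k).1; set w := fun k => (cn f h x k).2.
  set us := fun k => (cn (adj f) h y k).1; set ws := fun k => (cn (adj f) h y k).2.
  move=> sc scs sx sy; rewrite -/(u n).
  (* Duality is used with the adjoint scheme first, so that its invariant is (y|T_n x). *)
  have scA : scheme iota (adj (adj f)) h u w by rewrite adjK.
  have dual m := scheme_duality m n (fb_sesq fb') scs scA.
  pose A k := nm (u k) ^+ 2 + d * nm (w k) ^+ 2.
  pose As k := nm (us k) ^+ 2 + d * nm (ws k) ^+ 2.
  have A0 k : 0 <= A k by rewrite addr_ge0 ?sqr_ge0// mulr_ge0 ?sqr_ge0// ltW.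
  have As0 k : 0 <= As k by rewrite addr_ge0 ?sqr_ge0// mulr_ge0 ?sqr_ge0// ltW.
  have Md : 0 <= M / d by rewrite divr_ge0// ltW.
  have h2 : P%:R * nm (inner y (u n)) <= (1 + M / d) / 2 *
     (\sum_(m < P) As m + \sum_(m < P) A (n + m)%N).
    have -> : P%:R * nm (inner y (u n)) = \sum_(m < P) nm (inner y (u n)).
      by rewrite sumr_const card_ord mulr_natl.
    rewrite -big_split mulr_sumr /=; apply: ler_sum => m _.
    have := dual m; rewrite -/(us 0%N) addnC => <-; rewrite (le_trans (nmD _ _))//.
    have i1 := nm_inner_le (us m) (u (n + m)%N).
    have i2 := fb_bounded fb' (ws m) (w (n + m)%N).
    have i3 := sqr_ge0 (nm (us m) - nm (u (n + m)%N)).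
    have i4 := mulr_ge0 M0 (sqr_ge0 (nm (ws m) - nm (w (n + m)%N))).
    have i5 := mulr_ge0 Md (addr_ge0 (sqr_ge0 (nm (us m))) (sqr_ge0 (nm (u (n + m)%N)))).
    have i6 := mulr_ge0 (ltW d0) (addr_ge0 (sqr_ge0 (nm (ws m))) (sqr_ge0 (nm (w (n + m)%N)))).
    have -> : (1 + M / d) / 2 * (As m + A (n + m)%N) =
       (As m + A (n + m)%N) / 2 + M / d * (nm (us m) ^+ 2 + nm (u (n + m)%N) ^+ 2) / 2
       + M * (nm (ws m) ^+ 2 + nm (w (n + m)%N) ^+ 2) / 2.
      by rewrite /A /As; field; rewrite gt_eqF.
    by rewrite /A /As; move: i1 i2 i3 i4 i5 i6; lra.
  have h3 : \sum_(m < P) As m <= \sum_(k < 2 * P) As k.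
    by apply: (@sum_window As 0) => //; rewrite add0n leq_pmull.
  have h4 : \sum_(m < P) A (n + m)%N <= \sum_(k < 2 * P) A k.
    by apply: sum_window => //; rewrite mul2n -addnn leq_add2r.
  have B0 : 0 <= (1 + M / d) / 2 by rewrite divr_ge0// addr_ge0.
  have sx' : \sum_(k < 2 * P) A k <= 16 * P%:R * nm x ^+ 2 := sx.
  have sy' : \sum_(k < 2 * P) As k <= 16 * P%:R * nm y ^+ 2 := sy.
  have h5 := ler_wpM2l B0 (lerD (le_trans h3 sy') (le_trans h4 sx')).
  have := le_trans h2 h5.
  have -> : (1 + M / d) / 2 * (16 * P%:R * nm y ^+ 2 + 16 * P%:R * nm x ^+ 2)
    = P%:R * (8 * (1 + M / d) * (nm x ^+ 2 + nm y ^+ 2)) by field; rewrite gt_eqF.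
  by rewrite ler_pM2l//; exact: lt_le_trans P0'.
move: key; set v := cheb _ _ _ => key.
have B0 : 0 <= 16 * (1 + M / d) by rewrite mulr_ge0// addr_ge0// divr_ge0// ltW.
have [v0|v0] := eqVneq (nm v) 0; first by rewrite v0 mulr_ge0 ?nm_ge0.
have [x0|x0] := eqVneq (nm x) 0.
  by case/negP: v0; rewrite /v (nm_eq0 x0) linear0 nm0.
have vp : 0 < nm v by rewrite lt_def v0 nm_ge0.
have xp : 0 < nm x by rewrite lt_def x0 nm_ge0.
(* As in [smoothing], the dual vector is aligned with [v] and given the norm of [x]. *)
have := key ((nm x / nm v)%:C *: v).
rewrite (sesqZl (@sesq_inner R X)) inner_nm -rmorphM nmC_ge0; last first.
  by rewrite mulr_ge0 ?sqr_ge0// divr_ge0 ?nm_ge0.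
rewrite nmZ nmC_ge0 ?divr_ge0 ?nm_ge0// mulfVK//.
rewrite (_ : nm x / nm v * nm v ^+ 2 = nm v * nm x); last by field.
by move=> hk; rewrite -(ler_pM2r xp); move: hk; lra.
Qed.

End CosStability.

(** * Convergence of the Chebyshev approximants, functional equation and generator *)

Section Cosine.
Variables (R : realType) (X : hilbertType R) (A : set (X * X)).
Variables (J : R[i] -> {linear X -> X}) (eps r c : R).
Hypothesis rs : resolvents A J eps r c.
Local Notation admr := (adm eps r).
Local Notation Jbr := (Jb r c).
Implicit Types (x y : X) (h t s e : R).

Let Jb0 : 0 <= Jbr := ltW (Jb_gt0 rs).

Lemma cosl_comm h h' x : admr (h ^+ 2 / 4)%:C -> admr (h' ^+ 2 / 4)%:C ->
  cosl J h (cosl J h' x) = cosl J h' (cosl J h x).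
Proof.
move=> a a'; rewrite !coslE !(linearB (J _)) !(linearZ_LR (J _)) (J_comm rs _ a a').
vec.
Qed.

Let half_sqr h : (h ^+ 2 / 2)%:C = 2 * (h ^+ 2 / 4)%:C :> R[i].
Proof.
by rewrite -(rmorph_nat (real_complex R) 2) -rmorphM /=; congr (_%:C); field.
Qed.

Lemma cosl_sub1 h x y : admr (h ^+ 2 / 4)%:C -> A (x, y) ->
  nm (cosl J h x - x) <= h ^+ 2 / 2 * (Jbr * nm y).
Proof.
move=> a Axy; rewrite coslE (J_id rs a Axy).
have -> : 2 *: (x - (h ^+ 2 / 4)%:C *: J (h ^+ 2 / 4)%:C y) - x - x
   = - ((h ^+ 2 / 2)%:C *: J (h ^+ 2 / 4)%:C y).
  by rewrite half_sqr; vec.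
rewrite nmN nmZ nmC_ge0 ?divr_ge0 ?sqr_ge0// ler_wpM2l ?divr_ge0 ?sqr_ge0//.
exact: (J_bound rs).
Qed.

Lemma cosl_taylor h x y y2 : admr (h ^+ 2 / 4)%:C -> A (x, y) -> A (y, y2) ->
  nm (cosl J h x - x + (h ^+ 2 / 2)%:C *: y) <= h ^+ 4 / 8 * (Jbr * nm y2).
Proof.
move=> a Axy Ay; rewrite coslE (J_id rs a Axy).
have -> : 2 *: (x - (h ^+ 2 / 4)%:C *: J (h ^+ 2 / 4)%:C y) - x - x + (h ^+ 2 / 2)%:C *: y
   = - ((h ^+ 2 / 2)%:C *: (J (h ^+ 2 / 4)%:C y - y)).
  by rewrite half_sqr; vec.
rewrite nmN nmZ nmC_ge0 ?divr_ge0 ?sqr_ge0//.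
have := J_lip rs a Ay; rewrite nmC_ge0 ?divr_ge0 ?sqr_ge0// => hl.
have := ler_wpM2l (divr_ge0 (sqr_ge0 h) (ler0n R 2)) hl.
by move/le_trans; apply; rewrite le_eqVlt; apply/orP; left; apply/eqP; field.
Qed.

Definition stable (T h1 K : R) := forall h n, 0 < h <= h1 -> n%:R * h <= T ->
  forall x, nm (cheb (cosl J h) n x) <= K * nm x.

(* [cos (a + b) = 2 cos a cos b - cos (a - b)]. *)
Lemma stable_extend T : 0 < T ->
  (exists h1 K : R, 0 < h1 /\ stable T h1 K) ->
  (exists h1 K : R, 0 < h1 /\ stable (3 / 2 * T) h1 K).
Proof.
move=> T0 [h1 [K [h10 st]]].
(* With h <= T/2 and n h <= 3T/2, rounding up still gives h (n + 1) / 2 <= T. *)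
exists (Num.min h1 (T / 2)), (2 * `|K| * `|K| + `|K| + 1).
split; first by rewrite lt_min h10 divr_gt0.
move=> h n /andP[h0]; rewrite le_min => /andP[hh1 hT] nh x.
have st' m : m%:R * h <= T -> forall x, nm (cheb (cosl J h) m x) <= `|K| * nm x.
  move=> mh y; rewrite (le_trans (st h m _ mh y)) ?h0//.
  by rewrite ler_wpM2r ?nm_ge0 ?ler_norm.
have KK := normr_ge0 K; have x0 := nm_ge0 x.
pose m := n./2; have nE : n = (odd n + m.*2)%N by rewrite odd_double_half.
have mh : m%:R * h <= T.
  have : m.*2%:R <= n%:R :> R by rewrite ler_nat [leqRHS]nE leq_addl.
  by rewrite -mul2n natrM => /(ler_wpM2r (ltW h0)); lra.
have omh : (odd n + m)%:R * h <= T.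
  have : (odd n + m)%:R * 2 <= n%:R + 1 :> R.
    by rewrite -natrM natr1 ler_nat [in leqRHS]nE muln2 doubleD -addSn leq_add2r; case: (odd n).
  by move/(ler_wpM2r (ltW h0)); lra.
have oh : (odd n)%:R * h <= T.
  by apply: le_trans omh; rewrite ler_wpM2r ?(ltW h0)// ler_nat leq_addr.
have -> : cheb (cosl J h) n x =
   2 *: cheb (cosl J h) (odd n + m) (cheb (cosl J h) m x) - cheb (cosl J h) (odd n) x.
  by rewrite -cheb_mul -nE addrK.
rewrite (le_trans (nmB _ _))// nmZ nm_nat.
have := st' _ oh x; have := st' _ omh (cheb (cosl J h) m x).
have := ler_wpM2l KK (st' _ mh x); lra.
Qed.

Hypothesis stab : exists T h1 K : R, [/\ 0 < T, 0 < h1 & stable T h1 K].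

Lemma stable_all T : exists h1 K : R, 0 < h1 /\ stable T h1 K.
Proof.
have [T0 [h1 [K [T00 h10 st]]]] := stab.
(* Each extension multiplies the time by 3/2, hence adds at least T0/2; linear growth is enough for
   the Archimedean argument. *)
have key j : exists h1 K : R, 0 < h1 /\ stable (T0 * (1 + j%:R / 2)) h1 K.
  elim: j => [|j IH]; first by exists h1, K; split=> //; rewrite mul0r addr0 mulr1.
  have j0 : 0 <= j%:R :> R by rewrite ler0n.
  have Tj : 0 < T0 * (1 + j%:R / 2) by rewrite mulr_gt0//; lra.
  have [h2 [K2 [h20 st2]]] := stable_extend Tj IH.
  exists h2, K2; split=> // h n hh nh; apply: st2 => //; apply: le_trans nh _.
  by rewrite -natr1; have := mulr_ge0 (ltW T00) j0; lra.
pose j := Num.bound `|2 * T / T0|.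
have [h2 [K2 [h20 st2]]] := key j.
exists h2, K2; split=> // h n hh nh; apply: st2 => //; apply: le_trans nh _.
have : 2 * T / T0 < j%:R by exact: le_lt_trans (ler_norm _) (archi_boundP (normr_ge0 _)).
by rewrite ltr_pdivrMr//; lra.
Qed.

Definition good (T K : R) k := [/\ dy k <= 1 :> R, admr (dy k ^+ 2 / 4)%:C &
  forall n, n%:R * dy k <= T -> cheb_bounded (cosl J (dy k)) n K].

Lemma goodP T : exists2 K : R, 1 <= K &
  exists k0, forall k, (k0 <= k)%N -> good T K k.
Proof.
have [h1 [K [h10 st]]] := stable_all T.
exists (`|K| + 1); first by rewrite lerDr.
have m0 : 0 < Num.min h1 (Num.min 1 r) by rewrite !lt_min h10 ltr01 (rs_r0 rs).
have [k0 hk] := dy_small 1 m0; exists k0 => k /hk.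
rewrite mul1r !le_min => /and3P[a b d].
have dk := dy_gt0 R k; split=> //.
  rewrite adm_pos ?(ltW (rs_eps0 rs)) ?divr_ge0 ?sqr_ge0//.
  by rewrite (le_trans _ d)//; nra.
move=> n nT m mn x; rewrite (le_trans (st (dy k) m _ _ x)) ?dk//.
  by rewrite (le_trans _ nT)// ler_wpM2r ?(ltW dk)// ler_nat.
by rewrite ler_wpM2r ?nm_ge0// (le_trans (ler_norm K))// lerDl.
Qed.

Section Good.
Variables (T K : R).
Hypotheses (T0 : 0 <= T) (K1 : 1 <= K).

Let K0 : 0 <= K. Proof. exact: le_trans K1. Qed.

(** One step of length h and two of length h/2 agree with x - (h^2/2) A x up to O(h^4); the factor
    n^2 of [cheb_dist] leaves O(h^2) when n h <= T. *)
Lemma refine k n x y y2 : good T K k -> good T K k.+1 -> n%:R * dy k <= T ->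
    A (x, y) -> A (y, y2) ->
  nm (cheb (cosl J (dy k.+1)) n.*2 x - cheb (cosl J (dy k)) n x)
    <= 12 * K ^+ 3 * T ^+ 2 * (Jbr * nm y2) * dy k ^+ 2.
Proof.
move=> [d1 a b] [d1' a' b'] nT Axy Ay.
set h := dy k in d1 a b nT *; set h' := dy k.+1 in d1' a' b' *.
have hh : h = 2 * h' by exact: dyS.
have h0 : 0 < h by exact: dy_gt0.
have h'0 : 0 < h' by exact: dy_gt0.
pose p := cosl J h; pose q : {linear X -> X} := cheb (cosl J h') 2.
have B0 : 0 <= Jbr * nm y2 by rewrite mulr_ge0 ?nm_ge0.
have [->|n0] := eqVneq n 0%N.
  by rewrite !cheb0 subrr nm0 !mulr_ge0 ?sqr_ge0 ?exprn_ge0 ?nm_ge0.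
have pq u : p (q u) = q (p u).
  by apply: cheb_comm => v; exact: cosl_comm.
have bq : cheb_bounded q n K.
  move=> j jn u; rewrite /q -cheb_double; apply: (b' n.*2) => //.
    by rewrite -muln2 natrM -mulrA -hh.
  by rewrite leq_double.
rewrite cheb_double -/q nmBC.
rewrite (le_trans (cheb_dist x K1 pq (b n nT) bq))//.
have dpq : nm (p x - q x) <= 3 * K * h ^+ 4 * (Jbr * nm y2).
  have e1 : nm (p x - x + (h ^+ 2 / 2)%:C *: y) <= h ^+ 4 / 8 * (Jbr * nm y2).
    exact: cosl_taylor.
  have e2 : nm (q x - x + (h ^+ 2 / 2)%:C *: y) <= 2 * K * h ^+ 4 * (Jbr * nm y2).
    have b2 : cheb_bounded (cosl J h') 2 K.
      move=> j j2; apply: (b' n.*2); first by rewrite -muln2 natrM -mulrA -hh.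
      by rewrite (leq_trans j2)// -[2%N]/(1.*2) leq_double lt0n.
    have := cheb_taylor K0 (divr_ge0 (sqr_ge0 h') (ler0n R 2)) b2
      (cosl_taylor a' Axy Ay) (cosl_sub1 a' Ay).
    rewrite (_ : 2%:R ^+ 2 * (h' ^+ 2 / 2) = h ^+ 2 / 2); last by rewrite hh; field.
    move/le_trans; apply; rewrite hh.
    by have := mulr_ge0 K0 (mulr_ge0 (exprn_ge0 4 (ltW h'0)) B0); lra.
  have -> : p x - q x = (p x - x + (h ^+ 2 / 2)%:C *: y) - (q x - x + (h ^+ 2 / 2)%:C *: y).
    by vec.
  rewrite (le_trans (nmB _ _))//.
  have h4 := mulr_ge0 (exprn_ge0 4 (ltW h0)) B0.
  have : h ^+ 4 * (Jbr * nm y2) <= K * (h ^+ 4 * (Jbr * nm y2)) by rewrite ler_peMl.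
  lra.
have nT2 : n%:R ^+ 2 * h ^+ 2 <= T ^+ 2.
  by rewrite -exprMn lerXn2r// nnegrE// mulr_ge0// ltW.
have k3 : 0 <= 4 * n%:R ^+ 2 * K ^+ 2 by rewrite !mulr_ge0 ?sqr_ge0 ?exprn_ge0.
rewrite (le_trans (ler_wpM2l k3 dpq))//.
have : 0 <= 12 * K ^+ 3 * (Jbr * nm y2) * h ^+ 2.
  exact: mulr_ge0 (mulr_ge0 (mulr_ge0 (ler0n R 12) (exprn_ge0 3 K0)) B0) (sqr_ge0 h).
by move/ler_wpM2l => /(_ _ _ nT2); lra.
Qed.

Lemma cheb_index k m n x y : good T K k -> m%:R * dy k <= T -> n%:R * dy k <= T ->
    A (x, y) ->
  nm (cheb (cosl J (dy k)) m x - cheb (cosl J (dy k)) n x)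
    <= `|m%:R * dy k - n%:R * dy k| * (2 * K * T * (Jbr * nm y)).
Proof.
move=> [d1 a b] mT nT Axy; have h0 := dy_gt0 R k.
set h := dy k in d1 a b mT nT h0 *.
have B0 : 0 <= Jbr * nm y by rewrite mulr_ge0 ?nm_ge0.
wlog mn : m n mT nT / (m <= n)%N.
  move=> H; have [mn|/ltnW nm'] := leqP m n; first exact: H.
  by rewrite nmBC distrC; exact: H.
have -> : `|m%:R * h - n%:R * h| = (n - m)%:R * h.
  rewrite -mulrBl normrM (gtr0_norm h0) distrC -natrB//; congr (_ * _).
  by rewrite ger0_norm ?ler0n.
rewrite nmBC; have := subnKC mn; move: (n - m)%N => j nE; rewrite -nE in nT *.
elim: j {n mn nE} nT => [|j IH] nT; first by rewrite addn0 subrr nm0 !mul0r.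
have jT : (m + j)%:R * h <= T.
  by apply: le_trans nT; rewrite ler_wpM2r ?(ltW h0)// ler_nat addnS.
rewrite (le_trans (nm_tri (cheb (cosl J h) (m + j) x) _ _))//.
rewrite -[j.+1%:R]natr1 mulrDl mul1r [(_ + h) * _]mulrDl addrC lerD ?IH//.
rewrite addnS in nT *; rewrite (le_trans (cheb_succ_bound x K1 (b _ jT)))//.
have k0 : 0 <= 4 * (m + j).+1%:R * K by rewrite !mulr_ge0.
rewrite (le_trans (ler_wpM2l k0 (cosl_sub1 a Axy)))//.
have := ler_wpM2r (mulr_ge0 (mulr_ge0 K0 (ltW h0)) B0) nT; lra.
Qed.

End Good.

(** The number of full steps of length 2^-k in |t|; the modulus makes the limit an even function of
    t. *)
Definition idx k t : nat := Num.truncn (`|t| * (2 ^ k)%:R).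

Lemma idx_le k t : (idx k t)%:R * dy k <= `|t|.
Proof.
have /truncn_itv/andP[h _] : 0 <= `|t| * (2 ^ k)%:R by rewrite mulr_ge0.
by have := ler_wpM2r (ltW (dy_gt0 R k)) h; rewrite -mulrA dyE mulr1.
Qed.

Lemma idx_gt k t : `|t| - dy k < (idx k t)%:R * dy k.
Proof.
have /truncn_itv/andP[_ h] : 0 <= `|t| * (2 ^ k)%:R by rewrite mulr_ge0.
move: h; rewrite -(ltr_pM2r (dy_gt0 R k)) -mulrA dyE mulr1 -natr1 mulrDl mul1r.
by rewrite -/(idx k t) ltrBlDr.
Qed.

Definition Ck k t x : X := cheb (cosl J (dy k)) (idx k t) x.

Lemma Ck_bound T K k t x : good T K k -> `|t| <= T -> nm (Ck k t x) <= K * nm x.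
Proof.
by move=> [_ _ b] tT; apply: b (leqnn _) _; exact: le_trans (idx_le k t) tT.
Qed.

Lemma Ck_cvg_smooth t x : DA2 A x -> exists l, tends (fun k => Ck k t x) l.
Proof.
move=> [y [y2 [Axy Ay]]]; have [K K1 [k0 hk]] := goodP `|t|.
have t0 := normr_ge0 t.
pose L := 2 * K * `|t| * (Jbr * nm y).
pose L' := 12 * K ^+ 3 * `|t| ^+ 2 * (Jbr * nm y2).
have L0 : 0 <= L by rewrite !mulr_ge0 ?nm_ge0//; lra.
have L'0 : 0 <= L' by rewrite !mulr_ge0 ?nm_ge0 ?exprn_ge0//; lra.
have q : ((0 : R) <= 2^-1) && ((2^-1 : R) < 1) by apply/andP; split; lra.
have step k : (k0 <= k)%N -> nm (Ck k.+1 t x - Ck k t x) <= (L + L') * 2^-1 ^+ k.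
  move=> kk; have g := hk _ kk; have g' := hk _ (leqW kk).
  have d0 := dy_gt0 R k; have d0' := dy_gt0 R k.+1.
  have dd : dy k = 2 * dy k.+1 :> R := dyS R k.
  have i1 := idx_le k t; have i2 := idx_gt k t.
  have i3 := idx_le k.+1 t; have i4 := idx_gt k.+1 t.
  have i5 : (idx k t).*2%:R * dy k.+1 = (idx k t)%:R * dy k :> R.
    by rewrite dd -muln2 natrM; ring.
  (* Passing from [idx k.+1 t] to twice [idx k t] costs an index shift, paid by [L]; halving the
     step at equal time costs [L']. *)
  rewrite (le_trans (nm_tri (cheb (cosl J (dy k.+1)) (idx k t).*2 x) _ _))//.
  rewrite mulrDl lerD//.
    rewrite (le_trans (cheb_index K1 g' _ _ Axy)) ?i5// mulrC ler_wpM2l//.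
    by rewrite -/(dy k) ler_norml; lra.
  rewrite (le_trans (refine t0 K1 g g' i1 Axy Ay))// ler_wpM2l//.
  by rewrite -/(dy k) expr2 ler_piMr ?(ltW d0)//; case: g.
by have [l ul _] := geom_tends q step; exists l.
Qed.

Lemma Ck_cvg t x : exists l, tends (fun k => Ck k t x) l.
Proof.
have [K K1 [k0 hk]] := goodP `|t|.
apply: (@strong_limit R X (fun k => (cheb (cosl J (dy k)) (idx k t) : {linear X -> X}))
  (DA2 A) K k0).
- by move=> k kk u; apply: Ck_bound (hk _ kk) _.
- by move=> u e e0; exact: (DA2_dense rs).
- by move=> u; exact: Ck_cvg_smooth.
Qed.

Definition Cfun t x : X := xget 0 [set l | tends (fun k => Ck k t x) l].

Lemma CfunP t x : tends (fun k => Ck k t x) (Cfun t x).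
Proof.
rewrite /Cfun; case: xgetP => [l _ //|H].
by have [l ul] := Ck_cvg t x; have := H l ul.
Qed.

Lemma Cfun_linear t : linear (Cfun t).
Proof.
move=> a x y; apply: (tends_uniq (CfunP _ _)).
apply: (@tends_ext _ _ (fun k => a *: Ck k t x + Ck k t y)).
  by exists 0%N => k _; rewrite /Ck (cheb_linear _ _ a).
by apply: tendsD; [apply: tendsZ|]; exact: CfunP.
Qed.

HB.instance Definition _ t :=
  GRing.isLinear.Build R[i] X X *:%R (Cfun t) (Cfun_linear t).

Definition C t : {linear X -> X} := Cfun t.

Lemma CP t x : tends (fun k => Ck k t x) (C t x).
Proof. exact: CfunP. Qed.

Lemma C_norm t x : C `|t| x = C t x.
Proof.
apply: (tends_uniq (CP _ _)); apply: tends_ext (CP t x).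
by exists 0%N => k _; rewrite /Ck /idx normr_id.
Qed.

Lemma C_bound T : exists2 K : R, 1 <= K & forall t x, `|t| <= T -> nm (C t x) <= K * nm x.
Proof.
have [K K1 [k0 hk]] := goodP T; exists K => // t x tT.
rewrite -[C t x]subr0; apply: tends_le (CP t x) _; exists k0 => k kk.
by rewrite subr0; exact: Ck_bound (hk _ kk) tT.
Qed.

Lemma C0 x : C 0 x = x.
Proof.
apply: (tends_uniq (CP _ _)); apply: tends_ext (tends_cst x).
exists 0%N => k _; rewrite /Ck /idx normr0 mul0r.
by rewrite (_ : Num.truncn 0 = 0%N) ?cheb0//; apply: truncn_def; rewrite lexx ltr01.
Qed.

Lemma C_J t w x : admr w -> C t (J w x) = J w (C t x).
Proof.
move=> aw; apply: (tends_uniq (CP _ _)).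
have : tends (fun k => J w (Ck k t x)) (J w (C t x)).
  apply: (@tends_map _ _ _ (J w) (fun k => Ck k t x) _ Jbr) (CP t x).
  by move=> a b; rewrite -linearB (J_bound rs).
apply: tends_ext; have [K K1 [k0 hk]] := goodP `|t|; exists k0 => k /hk[_ a _].
rewrite /Ck; apply: cheb_comm => u.
by rewrite !coslE (linearB (J w)) (linearZ_LR (J w)) (J_comm rs _ aw a).
Qed.

(** Integer parts are not additive; any index sequence within O(2^-k) of |t| gives the same limit,
    which allows sums and differences of indices. *)
Lemma C_index T t x y (a : nat -> nat) m :
    (exists k0, forall k, (k0 <= k)%N ->
      (a k)%:R * dy k <= T /\ `|(a k)%:R * dy k - `|t| | <= m * dy k) ->
    `|t| <= T -> A (x, y) ->
  tends (fun k => cheb (cosl J (dy k)) (a k) x) (C t x).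
Proof.
move=> [k1 h1] tT Axy; have T0 : 0 <= T by exact: le_trans (normr_ge0 t) tT.
have [K K1 [k0 hk]] := goodP T.
pose L := 2 * K * T * (Jbr * nm y).
have L0 : 0 <= L by rewrite !mulr_ge0 ?nm_ge0//; lra.
apply: tends_small (CP t x) _ => e e0.
have [k2 h2] := dy_small ((m + 1) * L) e0.
exists (maxn k0 (maxn k1 k2)) => k; rewrite !geq_max => /and3P[ka kb kc].
have [aT am] := h1 _ kb; have d0 := dy_gt0 R k.
have iT := le_trans (idx_le k t) tT.
rewrite (le_trans (cheb_index K1 (hk _ ka) aT iT Axy))//.
rewrite (le_trans _ (h2 _ kc))// [leRHS]mulrAC ler_wpM2r// mulrDl mul1r.
rewrite (le_trans (ler_distD `|t| _ _))// lerD//.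
have := idx_le k t; have := idx_gt k t.
by rewrite ler_norml; lra.
Qed.

(** With truncated subtraction (n - m) + (m - n) is |n - m|, so no order between the indices is
    needed. *)
Lemma cheb_mul_dist p m n x :
  cheb p (n + m) x + cheb p ((n - m) + (m - n)) x = 2 *: cheb p n (cheb p m x).
Proof.
wlog mn : m n / (m <= n)%N.
  move=> H; have [mn|/ltnW mn] := leqP m n; first exact: H.
  by rewrite addnC [((n - m) + _)%N]addnC H// cheb_commC.
have -> : ((n - m) + (m - n) = n - m)%N by move: mn; rewrite -subn_eq0 => /eqP ->; rewrite addn0.
have := cheb_mul p (n - m) m x; rewrite subnK// => <-.
by rewrite -addnn addnA subnK.
Qed.

Lemma C_mul_pos t s x :
  C (`|t| + `|s|) x + C (`|t| - `|s|) x = 2 *: C t (C s x).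
Proof.
pose T := `|t| + `|s|.
have t0 := normr_ge0 t; have s0 := normr_ge0 s.
have [K K1 bK] := C_bound T.
have tT : `|t| <= T by rewrite lerDl.
have sT : `|s| <= T by rewrite lerDr.
have nT : `| `|t| + `|s| | <= T by rewrite ger0_norm ?addr_ge0.
have nT' : `| `|t| - `|s| | <= T by rewrite ler_norml /T; lra.
pose F : {linear X -> X} := C (`|t| + `|s|) \+ C (`|t| - `|s|).
pose G : {linear X -> X} := (2 : R[i]) \*: (C t \o C s).
apply: (@dense_eq R X (DA2 A) F G (2 * K * K)).
- by move=> u e e0; exact: (DA2_dense rs).
- move=> u; rewrite /F /= (le_trans (nmD _ _))//.
  have := bK _ u nT; have := bK _ u nT'.
  have : K * nm u <= K * (K * nm u) by rewrite ler_peMl// mulr_ge0 ?nm_ge0//; lra.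
  lra.
- move=> u; rewrite /G /= nmZ nm_nat.
  have K0 : 0 <= K by lra.
  by have := bK _ (C s u) tT; have := ler_wpM2l K0 (bK _ u sT); lra.
move=> u [y [_ [Auy _]]]; rewrite /F /G /=.
have e1 : tends (fun k => cheb (cosl J (dy k)) (idx k t + idx k s) u) (C (`|t| + `|s|) u).
  apply: (@C_index T _ u y _ 2) nT Auy; exists 0%N => k _.
  have := idx_le k t; have := idx_gt k t; have := idx_le k s; have := idx_gt k s.
  rewrite natrD mulrDl (ger0_norm (_ : 0 <= `|t| + `|s|)) ?addr_ge0// => *.
  split; first by rewrite /T lerD.
  by rewrite ler_norml; lra.
have e2 : tends (fun k => cheb (cosl J (dy k))
    ((idx k t - idx k s) + (idx k s - idx k t)) u) (C (`|t| - `|s|) u).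
  apply: (@C_index T _ u y _ 2) nT' Auy; exists 0%N => k _.
  have d0 := dy_gt0 R k.
  have := idx_le k t; have := idx_gt k t; have := idx_le k s; have := idx_gt k s.
  have it : 0 <= (idx k t)%:R * dy k :> R by rewrite mulr_ge0// ltW.
  have is_ : 0 <= (idx k s)%:R * dy k :> R by rewrite mulr_ge0// ltW.
  have -> : ((idx k t - idx k s) + (idx k s - idx k t))%:R * dy k
     = `|(idx k t)%:R * dy k - (idx k s)%:R * dy k| :> R.
    rewrite -mulrBl normrM (gtr0_norm d0); congr (_ * _).
    have [ts|/ltnW ts] := leqP (idx k s) (idx k t).
      have /eqP -> : (idx k s - idx k t == 0)%N by rewrite subn_eq0.
      by rewrite addn0 -natrB// ger0_norm.
    have /eqP -> : (idx k t - idx k s == 0)%N by rewrite subn_eq0.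
    by rewrite add0n distrC -natrB// ger0_norm.
  move=> *; split; first by rewrite ler_norml /T; lra.
  rewrite (le_trans (ler_dist_dist _ _))// ler_norml; lra.
apply: (tends_uniq (tendsD e1 e2)).
apply: (@tends_ext _ _ (fun k => 2 *: Ck k t (Ck k s u))).
  by exists 0%N => k _; rewrite cheb_mul_dist.
apply: tendsZ; have [K' K'1 [k0 hk]] := goodP T.
apply: (@tends_lip _ _ _ (fun k => Ck k t) (fun k => Ck k s u) (C s u) _ K').
- by exists k0 => k kk a b; rewrite /Ck -chebB; exact: Ck_bound (hk _ kk) tT.
- exact: CP.
- exact: CP.
Qed.

Lemma C_mul t s x : C (t + s) x + C (t - s) x = 2 *: C t (C s x).
Proof.
rewrite -C_mul_pos.
have Cn u v : `|u| = `|v| -> C u x = C v x by move=> h; rewrite -(C_norm u) h C_norm.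
have [t0|t0] := ger0P t; have [s0|s0] := ger0P s.
- by [].
- by rewrite opprK addrC.
- rewrite addrC (Cn (t - s) (- t + s)) ?(Cn (t + s) (- t - s))// -normrN; congr `|_|; ring.
- by rewrite (Cn (t - s) (- t - - s)) ?(Cn (t + s) (- t + - s))// -normrN; congr `|_|; ring.
Qed.

Lemma C_lip T x y : 0 <= T -> A (x, y) ->
  exists2 L : R, 0 <= L & forall t s, `|t| <= T -> `|s| <= T ->
    nm (C t x - C s x) <= `|t - s| * L.
Proof.
move=> T0 Axy; have [K K1 [k0 hk]] := goodP T.
pose L := 2 * K * T * (Jbr * nm y).
have L0 : 0 <= L by rewrite !mulr_ge0 ?nm_ge0//; lra.
exists L => // t s tT sT; apply/ler_addgt0Pr => e e0.
have e4 : 0 < e / 4 by rewrite divr_gt0.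
have [k1 h1] := CP t x e4; have [k2 h2] := CP s x e4.
have [k3 h3] := dy_small (2 * L) e4.
pose k := maxn (maxn k0 k1) (maxn k2 k3).
have kk0 : (k0 <= k)%N by rewrite /k !leq_max leqnn.
have kk1 : (k1 <= k)%N by rewrite /k !leq_max leqnn orbT.
have kk2 : (k2 <= k)%N by rewrite /k !leq_max leqnn !orbT.
have kk3 : (k3 <= k)%N by rewrite /k !leq_max leqnn !orbT.
have a1 := h1 _ kk1; have a2 := h2 _ kk2; have a3 := h3 _ kk3.
have := cheb_index K1 (hk _ kk0) (le_trans (idx_le k t) tT) (le_trans (idx_le k s) sT) Axy.
rewrite -/(Ck k t x) -/(Ck k s x) -/L => a4.
have a5 : `|(idx k t)%:R * dy k - (idx k s)%:R * dy k| <= `|t - s| + dy k.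
  rewrite (le_trans _ (lerD (ler_dist_dist t s) (lexx _)))//.
  have := idx_le k t; have := idx_gt k t; have := idx_le k s; have := idx_gt k s.
  have := ler_norm (`|t| - `|s|); have := lerNnormlW (lexx `| `|t| - `|s| |).
  by move=> *; rewrite ler_norml; lra.
have a6 := ler_wpM2r L0 a5; have d0 := dy_gt0 R k.
rewrite (le_trans (nm_tri (Ck k t x) _ _))// [nm (C t x - _)]nmBC.
have := nm_tri (Ck k s x) (Ck k t x) (C s x); have := mulr_ge0 (ltW d0) L0; lra.
Qed.

Lemma C_continuous x : continuous (fun t => C t x).
Proof.
move=> t; apply/cvg_nm => e e0; pose T := `|t| + 1.
have T0 : 0 <= T by rewrite addr_ge0.
have [K K1 bK] := C_bound T.
have K0 : 0 < 4 * K by lra.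
have [[x' y'] A' /= h] := rs_dense rs x (divr_gt0 e0 K0).
have [L L0 lip] := C_lip T0 A'.
have L1 : 0 < 2 * (L + 1) by lra.
apply/nbhs_ballP; exists (Num.min 1 (e / (2 * (L + 1)))).
  by rewrite /= lt_min ltr01 divr_gt0.
move=> s; rewrite /ball_ /= lt_min => /andP[st1 stL].
rewrite -/(C s x - C t x).
have tT : `|t| <= T by rewrite /T; lra.
have sT : `|s| <= T.
  by have := ler_normB t (t - s); rewrite opprB addrC subrK /T; lra.
have -> : C s x - C t x = C s (x - x') + (C s x' - C t x') - C t (x - x').
  by rewrite !(linearB (C _)); vec.
rewrite (le_trans (nmB _ _))//.
have := nmD (C s (x - x')) (C s x' - C t x').
have := bK _ (x - x') sT; have := bK _ (x - x') tT; have := lip s t sT tT.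
move: h stL; rewrite ler_pdivlMr// ltr_pdivlMr// [`|s - t|]distrC.
have := normr_ge0 (t - s); lra.
Qed.

Lemma C_sub1 : exists2 L : R, 0 <= L & forall t x y, `|t| <= 1 -> A (x, y) ->
  nm (C t x - x) <= t ^+ 2 * (L * nm y).
Proof.
have [K K1 [k0 hk]] := goodP 1; have K0 : 0 <= K by lra.
exists (2 * K ^+ 2 * Jbr); first by rewrite !mulr_ge0 ?exprn_ge0.
move=> t x y t1 Axy; apply: tends_le (CP t x) _; exists k0 => k kk.
have [d1 a b] := hk _ kk; have d0 := dy_gt0 R k; have it := idx_le k t.
rewrite (le_trans (cheb_sub1 x K1 (b _ (le_trans it t1))))//.
set n := idx k t in it *.
have k3 : 0 <= 4 * n%:R ^+ 2 * K ^+ 2 by rewrite !mulr_ge0 ?exprn_ge0.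
rewrite (le_trans (ler_wpM2l k3 (cosl_sub1 a Axy)))//.
have nt : (n%:R * dy k) ^+ 2 <= t ^+ 2.
  by rewrite -(real_normK (num_real t)) lerXn2r ?nnegrE// mulr_ge0// ltW.
have B0 : 0 <= 2 * K ^+ 2 * (Jbr * nm y).
  exact: mulr_ge0 (mulr_ge0 (ler0n R 2) (sqr_ge0 K)) (mulr_ge0 Jb0 (nm_ge0 y)).
by have := ler_wpM2r B0 nt; rewrite exprMn; lra.
Qed.

Lemma C_taylor : exists2 L : R, 0 <= L & forall t x y y2, `|t| <= 1 ->
  A (x, y) -> A (y, y2) ->
  nm (C t x - x + (t ^+ 2 / 2)%:C *: y) <= t ^+ 4 * (L * nm y2).
Proof.
have [K K1 [k0 hk]] := goodP 1; have K0 : 0 <= K by lra.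
exists (2 * K * Jbr); first by rewrite !mulr_ge0.
move=> t x y y2 t1 Axy Ay.
have -> : C t x - x + (t ^+ 2 / 2)%:C *: y = C t x - (x - (t ^+ 2 / 2)%:C *: y) by vec.
(* The discrete expansion has (n h)^2 in place of t^2; the difference costs at most h |y|, absorbed
   in [e]. *)
apply/ler_addgt0Pr => e e0; apply: tends_le (CP t x) _.
have [k1 h1] := dy_small (nm y) e0.
exists (maxn k0 k1) => k; rewrite geq_max => /andP[kk kk1].
have [d1 a b] := hk _ kk; have d0 := dy_gt0 R k; have it := idx_le k t.
have ig := idx_gt k t; have e1 := h1 _ kk1.
rewrite /Ck; set n := idx k t in it ig *; set h := dy k in d1 a b d0 it ig e1 *.
have nh0 : 0 <= n%:R * h by rewrite mulr_ge0// ltW.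
have := cheb_taylor K0 (divr_ge0 (sqr_ge0 h) (ler0n R 2)) (b _ (le_trans it t1))
  (cosl_taylor a Axy Ay) (cosl_sub1 a Ay).
set Z := cheb _ _ _.
have -> : Z - (x - (t ^+ 2 / 2)%:C *: y) = (Z - x + (n%:R ^+ 2 * (h ^+ 2 / 2))%:C *: y)
   + (t ^+ 2 / 2 - n%:R ^+ 2 * (h ^+ 2 / 2))%:C *: y.
  by rewrite rmorphB; vec.
move=> h2; rewrite (le_trans (nmD _ _))// lerD//; last first.
  apply: le_trans e1; rewrite nmZ nmC mulrC ler_wpM2l ?nm_ge0//.
  rewrite mulrA -mulrBl -exprMn -(real_normK (num_real t)) subr_sqr.
  have f1 : 0 <= `|t| - n%:R * h by rewrite subr_ge0.
  have f2 : 0 <= `|t| + n%:R * h by rewrite addr_ge0.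
  rewrite [leLHS]ger0_norm; last by rewrite divr_ge0 ?mulr_ge0.
  have : (`|t| - n%:R * h) * (`|t| + n%:R * h) <= h * 2.
    by rewrite ler_pM//; lra.
  lra.
apply: le_trans h2 _; have B0 : 0 <= K * (Jbr * nm y2) by rewrite !mulr_ge0 ?nm_ge0.
have [n0|n0] := eqVneq n 0%N.
  rewrite n0 expr0n !(mulr0, mul0r).
  have t4 : 0 <= t ^+ 4 by rewrite (exprM t 2 2) sqr_ge0.
  exact: mulr_ge0 t4 (mulr_ge0 (mulr_ge0 (mulr_ge0 (ler0n R 2) K0) Jb0) (nm_ge0 _)).
have n1 : 1 <= n%:R :> R by rewrite ler1n lt0n.
have nt : (n%:R * h) ^+ 4 <= t ^+ 4.
  rewrite (_ : t ^+ 4 = `|t| ^+ 4); last by rewrite -normrX ger0_norm// (exprM t 2 2) sqr_ge0.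
  by rewrite lerXn2r ?nnegrE.
(* Absorbs the term of order n^2 h^4 into (n h)^4 <= t^4; this is why n = 0 was set apart. *)
have n2 : n%:R ^+ 2 <= n%:R ^+ 4 :> R by rewrite ler_weXn2l.
have h4 := mulr_ge0 (exprn_ge0 4 (ltW d0)) B0.
have t4 : 0 <= t ^+ 4 by rewrite (exprM t 2 2) sqr_ge0.
have := mulr_ge0 t4 B0; have := ler_wpM2l h4 n2; have := ler_wpM2l B0 nt.
by rewrite exprMn; lra.
Qed.

Lemma C_generator x y e : A (x, y) -> 0 < e ->
  exists2 d : R, 0 < d & forall t, t != 0 -> `|t| < d ->
    nm ((2 / t ^+ 2)%:C *: (C t x - x) - - y) <= e.
Proof.
move=> Axy e0; have [L L0 s1] := C_sub1; have [L' L'0 s2] := C_taylor.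
have k0 : 0 < 2 * (2 * L + 1) by lra.
have [x' [y' [y2 [A' A2 _ hy]]]] := smooth_dense rs (divr_gt0 e0 k0) Axy.
have LL : 0 <= L' * nm y2 by rewrite mulr_ge0 ?nm_ge0.
pose B := 4 * (L' * nm y2) + 1; have B0 : 0 < B by rewrite /B; lra.
exists (Num.min 1 (e / B)); first by rewrite lt_min ltr01 divr_gt0.
move=> t t0; rewrite lt_min => /andP[/ltW t1 tB].
have tt : 0 < t ^+ 2 by rewrite lt_def sqrf_eq0 t0 sqr_ge0.
have q0 : 0 <= 2 / t ^+ 2 by rewrite divr_ge0// ltW.
have h1 := s1 t _ _ t1 (AB rs Axy A'); have h2 := s2 t _ _ _ t1 A' A2.
have -> : (2 / t ^+ 2)%:C *: (C t x - x) - - y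
   = (2 / t ^+ 2)%:C *: (C t (x - x') - (x - x'))
     + (2 / t ^+ 2)%:C *: (C t x' - x' + (t ^+ 2 / 2)%:C *: y') + (y - y').
  rewrite [(2 / t ^+ 2)%:C *: (_ + _ *: y')]scalerDr scalerA -rmorphM /=.
  rewrite (_ : 2 / t ^+ 2 * (t ^+ 2 / 2) = 1) ?scale1r; last by field.
  by rewrite (linearB (C t)); vec.
rewrite (le_trans (nmD _ _))//.
have := nmD ((2 / t ^+ 2)%:C *: (C t (x - x') - (x - x')))
            ((2 / t ^+ 2)%:C *: (C t x' - x' + (t ^+ 2 / 2)%:C *: y')).
rewrite !nmZ (nmC_ge0 q0).
have {}h1 : 2 / t ^+ 2 * nm (C t (x - x') - (x - x')) <= 2 * (L * nm (y - y')).
  by rewrite mulrAC ler_pdivrMr//; have := ler_wpM2l (ler0n R 2) h1; lra.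
have {}h2 : 2 / t ^+ 2 * nm (C t x' - x' + (t ^+ 2 / 2)%:C *: y') <= 2 * `|t| * (L' * nm y2).
  rewrite mulrAC ler_pdivrMr//; have := ler_wpM2l (ler0n R 2) h2.
  have e4 : t ^+ 4 = t ^+ 2 * `|t| ^+ 2 by rewrite real_normK ?num_real// -exprD.
  have : t ^+ 2 * `|t| ^+ 2 <= t ^+ 2 * `|t|.
    by rewrite ler_wpM2l ?(ltW tt)// expr2 ler_piMl.
  by move/(ler_wpM2r LL); rewrite e4; lra.
move: hy tB; rewrite ler_pdivlMr// ltr_pdivlMr// /B => hy tB.
by have := normr_ge0 t; lra.
Qed.

Theorem cosine_main : exists C : R -> {linear X -> X},
  cosine_function C /\ cosine_generator C = opp_op A.
Proof.
exists C; split.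
  split.
  - move=> t; have [K K1 bK] := C_bound `|t|.
    by apply: (@bounded_opP _ _ _ _ K) => x; exact: bK.
  - exact: C0.
  - by move=> s t x; rewrite C_mul.
  - exact: C_continuous.
apply/seteqP; split=> -[x y] /=; last first.
  move=> Axy; have {}Axy : A (x, - y) := Axy.
  apply/cvg_dnbhs0 => e e0; have [d d0 hd] := C_generator Axy e0.
  by exists d => // t t0 td; have := hd t t0 td; rewrite opprK.
move=> /= gy; rewrite /opp_op /=.
apply/(A_iff rs _ _ (adm_r rs) (r_neq0 rs)).
(* As for the semigroup, J(r) moves the difference quotient to D(A), where its limit is known. *)
set Jr := J r%:C; have r0 := r_neq0 rs.
suff h : Jr y = - (r%:C^-1 *: (x - Jr x)).
  rewrite linearD linearZ linearN /= -/Jr h opprK scalerA mulfV// scale1r.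
  by rewrite addrC subrK.
pose g t := (2 / t ^+ 2)%:C *: (C t x - x).
have h1 : Jr (g t) @[t --> 0^'] --> Jr y.
  apply/cvg_dnbhs0 => e e0; have J0 := Jb_gt0 rs.
  have /cvg_dnbhs0/(_ (e / Jbr)) := gy.
  case=> [|d d0 hd]; first by rewrite divr_gt0.
  exists d => // t t0 td; have := hd t t0 td; rewrite ler_pdivlMr// mulrC => h; apply: le_trans h.
  by rewrite -linearB (J_bound rs)// (adm_r rs).
have h2 : Jr (g t) @[t --> 0^'] --> - (r%:C^-1 *: (x - Jr x)).
  apply/cvg_dnbhs0 => e e0.
  have [d d0 hd] := C_generator (rs_ran rs x (adm_r rs) r0) e0.
  exists d => // t t0 td; have := hd t t0 td.
  have -> : Jr (g t) = (2 / t ^+ 2)%:C *: (C t (Jr x) - Jr x); last by [].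
  by rewrite C_J ?(adm_r rs)// /g linearZ linearB.
exact: (@cvg_unique _ (@norm_hausdorff _ X) _ _ _ _ h1 h2).
Qed.

End Cosine.

(** * Generation theorems for forms *)

Section FormGeneration.
Variables (R : realType) (E X : hilbertType R) (iota : {linear E -> X}).
Variables (f : E -> E -> R[i]) (M d om eps : R).
Hypothesis fb : form_bounds iota f M d om eps.
Hypothesis iota_dense : forall x (e : R), 0 < e -> exists u, nm (x - iota u) <= e.

Lemma form_resolvents (g : E -> E -> R[i]) (gb : form_bounds iota g M d om eps) :
  resolvents (assoc iota g) (res gb) eps (step_radius om) (2 * om).
Proof.
split.
- exact: (fb_eps0 gb).
- exact: step_radius_gt0 gb.
- by rewrite mulr_ge0// (fb_om0 gb).
- by move=> *; exact: (assocD gb).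
- by move=> *; exact: (assocZ gb).
- exact: res0.
- by move=> *; exact: res_fix.
- by move=> *; exact: res_ran.
- by move=> *; exact: res_bound.
- by move=> *; exact: (assoc_dense gb).
Qed.

Let rs := form_resolvents fb.

(** With step z/n, n times the modulus of the step is |z|, so the constant of [smoothing] does not
    depend on n. *)
Lemma form_smooth z : cone eps z -> z != 0 -> exists C : R, forall n,
  adm eps (step_radius om) ((n%:R^-1)%:C * z) -> forall x,
  n%:R * nm (iter n (res fb ((n%:R^-1)%:C * z)) x
    - iter n.+1 (res fb ((n%:R^-1)%:C * z)) x) <= C * nm x.
Proof.
move=> cz z0; pose K := expR (2 * om * nm z).
have M0 := fb_M0 fb; have d0 := fb_d0 fb; have o0 := fb_om0 fb.
pose C := 2 * M / d * (1 + 2 * om * nm z * K ^+ 2).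
have C0 : 0 <= C.
  apply: mulr_ge0; first by rewrite divr_ge0 ?mulr_ge0// ltW.
  by apply: addr_ge0 => //; apply: mulr_ge0 (sqr_ge0 _); rewrite !mulr_ge0 ?nm_ge0.
exists C => n az x; have [->|n0] := eqVneq n 0%N.
  by rewrite mul0r mulr_ge0 ?nm_ge0.
have nR : 0 < n%:R :> R by rewrite ltr0n lt0n.
set s := (n%:R^-1)%:C * z in az *.
have ns : n%:R * nm s = nm z.
  by rewrite /s nm_scale ?invr_ge0 ?(ltW nR)// mulrA mulfV ?mul1r// gt_eqF.
have s0 : s != 0 by rewrite mulf_neq0// posC_neq0// invr_gt0.
have bd g (gb : form_bounds iota g M d om eps) w : adm eps (step_radius om) w -> nm w = nm s ->
    forall k, (k <= n)%N -> forall y, nm (iter k (res gb w) y) <= K * nm y.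
  move=> aw ws k kn y; rewrite (le_trans (J_iter_bound (form_resolvents gb) k y aw))//.
  rewrite ler_wpM2r ?nm_ge0// ler_expR ler_wpM2l ?mulr_ge0// -ns ws.
  by rewrite ler_wpM2r ?nm_ge0// ler_nat.
have := @smoothing _ _ _ _ _ _ _ _ _ fb s x n K az s0 (bd f fb s az (erefl _)).
rewrite -[nm s *+ n]mulr_natl ns; apply; apply: bd; first by rewrite admJ.
exact: nmJ.
Qed.

(** A point of the graph close to (x, y) makes J(r)(x + r y) - x arbitrarily small, and [A_iff]
    concludes. *)
Lemma form_closed : closed_op (assoc iota f).
Proof.
move=> [x y] clA; apply/(A_iff rs _ _ (adm_r rs) (r_neq0 rs)).
have r0 := rs_r0 rs; set r := step_radius om in r0 *.
pose Jr := res fb r%:C; set B := Jb r (2 * om).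
have J0 : 0 < B := Jb_gt0 rs.
apply/eqP; rewrite -subr_eq0; apply/eqP; apply: nm_eq0.
apply/eqP; rewrite eq_le nm_ge0 andbT; apply/ler_addgt0Pr => e e0; rewrite add0r.
have D0 : 0 < B * (1 + r) + 1 by rewrite ltr_wpDl// mulr_ge0 ?(ltW J0)// addr_ge0// ltW.
pose d' := e / (B * (1 + r) + 1); have d'0 : 0 < d' by rewrite divr_gt0.
have : nbhs (x, y) [set q | nm (x - q.1) < d' /\ nm (y - q.2) < d'].
  exists ([set q | nm (x - q) < d'], [set q | nm (y - q) < d']) => /=.
    by split; apply/nbhs_nm; exists d'.
  by move=> [q1 q2] /= [].
move/clA => [[q1 q2] [Aq [/= h1 h2]]].
have Jq := rs_fix rs (adm_r rs) Aq; rewrite -/r -/Jr in Jq *.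
have -> : Jr (x + r%:C *: y) - x = Jr ((x - q1) + r%:C *: (y - q2)) - (x - q1).
  have -> : x + r%:C *: y = ((x - q1) + r%:C *: (y - q2)) + (q1 + r%:C *: q2) by vec.
  by rewrite (linearD Jr) Jq; vec.
rewrite (le_trans (nmB _ _))//.
have := J_bound rs ((x - q1) + r%:C *: (y - q2)) (adm_r rs); rewrite -/Jr -/B => h3.
have := nmD (x - q1) (r%:C *: (y - q2)); rewrite nmZ (nmC_ge0 (ltW r0)) => h4.
have h5 := ler_wpM2l (ltW J0) h4.
have h6 := ler_wpM2l (ltW J0) (lerD (ltW h1) (ler_wpM2l (ltW r0) (ltW h2))).
have : d' * (B * (1 + r) + 1) = e by rewrite mulfVK// gt_eqF.
lra.
Qed.

Lemma form_semigroup : exists T : R -> {linear X -> X},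
  [/\ analytic_semigroup T, semigroup_generator T = opp_op (assoc iota f)
    & (forall u, 0 <= complex.Re (f u u)) -> contractive T].
Proof.
have [T [h1 h2 h3]] := semigroup_main rs form_smooth; exists T; split=> // acc.
apply: h3 => u x /andP[u0 ur]; apply: res_contractive => //; first by rewrite ler0c.
by rewrite adm_pos// ltW// (fb_eps0 fb).
Qed.

Lemma form_cosine (mb : R) : 0 <= mb ->
    (forall u, `|complex.Im (f u u)| <= mb * nm (iota u) * nm u) ->
  exists C : R -> {linear X -> X},
    cosine_function C /\ cosine_generator C = opp_op (assoc iota f).
Proof.
move=> mb0 parab; apply: (cosine_main rs).
have [T [h1 [T0 h10 st]]] := cos_stability fb mb0 parab.
by exists T, h1, (16 * (1 + M / d)); split.
Qed.

End FormGeneration.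

(** * Norm bounds from continuity, and density in terms of distances *)

Section Bounded.
Variables (R : realType) (U V : normedModType R[i]).

Lemma continuous_linear_nm (j : {linear U -> V}) : continuous j ->
  exists2 K : R, 0 <= K & forall u, nm (j u) <= K * nm u.
Proof.
move=> cj; have /cvg_nm/(_ 1 ltr01)/nbhs_nm[e e0 he] := cj 0.
exists (2 / e); first by rewrite divr_ge0// ltW.
move=> u; have [u0|u0] := eqVneq (nm u) 0.
  by rewrite u0 (nm_eq0 u0) linear0 nm0 mulr0.
have up : 0 < nm u by rewrite lt_def u0 nm_ge0.
pose s := e / 2 / nm u; have s0 : 0 < s by rewrite !divr_gt0.
have ns : nm (s%:C *: u) = e / 2 by rewrite nmZ nmC_ge0 ?(ltW s0)// mulfVK.
have := he (s%:C *: u); rewrite nmBC subr0 ns => /(_ ltac:(lra)) /=.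
rewrite linear0 subr0 linearZ /= nmZ nmC_ge0 ?(ltW s0)// => h.
rewrite -(ler_pM2l s0) (le_trans h)// le_eqVlt; apply/orP; left; apply/eqP.
by rewrite /s; field; rewrite u0 gt_eqF.
Qed.

Lemma continuous_sesq_bounded (f : U -> U -> R[i]) : sesq f ->
  continuous (fun p : U * U => f p.1 p.2 : R[i]^o) ->
  exists2 K : R, 0 <= K & forall u v, nm (f u v) <= K * nm u * nm v.
Proof.
move=> sf cf; have /cvg_nm/(_ 1 ltr01) := cf (0, 0).
move=> [[B1 B2] /= [/nbhs_nm[e1 e10 h1] /nbhs_nm[e2 e20 h2]] hB].
pose e := Num.min e1 e2; have e0 : 0 < e by rewrite lt_min e10.
exists ((2 / e) ^+ 2); first by rewrite sqr_ge0.
move=> u v; have [u0|u0] := eqVneq (nm u) 0.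
  by rewrite u0 (nm_eq0 u0) sesq0l// nm0 mulr0 mul0r.
have [v0|v0] := eqVneq (nm v) 0.
  by rewrite v0 (nm_eq0 v0) sesq0r// nm0 mulr0.
have up : 0 < nm u by rewrite lt_def u0 nm_ge0.
have vp : 0 < nm v by rewrite lt_def v0 nm_ge0.
pose s := e / 2 / nm u; have s0 : 0 < s by rewrite !divr_gt0.
pose t := e / 2 / nm v; have t0 : 0 < t by rewrite !divr_gt0.
have ns : nm (s%:C *: u) = e / 2 by rewrite nmZ nmC_ge0 ?(ltW s0)// mulfVK.
have nt : nm (t%:C *: v) = e / 2 by rewrite nmZ nmC_ge0 ?(ltW t0)// mulfVK.
have ee : e / 2 < e by lra.
have Bst : (B1 `*` B2) (s%:C *: u, t%:C *: v).
  split=> /=; [apply: h1|apply: h2]; rewrite nmBC subr0 ?ns ?nt (lt_le_trans ee)//.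
    by rewrite ge_min lexx.
  by rewrite ge_min lexx orbT.
have := hB _ Bst; rewrite /= sesq0l// subr0 !(sesqE sf) conjCr !nmM.
rewrite !nmC_ge0 ?(ltW s0) ?(ltW t0)// => h.
rewrite -(ler_pM2l (mulr_gt0 s0 t0)) -mulrA (le_trans h)// le_eqVlt; apply/orP; left; apply/eqP.
by rewrite /s /t; field; rewrite u0 v0 gt_eqF.
Qed.

Lemma bounded_op_nm (f : U -> V) : bounded_op f ->
  exists2 K : R, 0 <= K & forall u, nm (f u) <= K * nm u.
Proof.
move=> [K hK]; exists `|K| => // u; have := hK u; rewrite !nmE -rmorphM lecR.
by move/le_trans; apply; rewrite ler_wpM2r ?nm_ge0// ler_norm.
Qed.

Lemma dense_nm (S : set U) x (e : R) : dense S -> 0 < e ->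
  exists2 y, S y & nm (x - y) <= e.
Proof.
move=> dS e0; pose B := [set y | nm (x - y) < e].
have Bx : nbhs x B by apply/nbhs_nm; exists e.
have B0 : interior B !=set0 by exists x.
have [y [yB Sy]] := dS _ B0 (@open_interior _ B).
by exists y => //; apply/ltW; exact: interior_subset yB.
Qed.

End Bounded.

Section HprodNorm.
Variables (R : realType) (U V : hilbertType R).

Lemma sqr_nm_hprod (x : hprod U V) : nm x ^+ 2 = nm x.1 ^+ 2 + nm x.2 ^+ 2.
Proof. by rewrite !sqr_nm /rip -cReD. Qed.

Lemma nm_hprod1 (x : hprod U V) : nm x.1 <= nm x.
Proof.
by rewrite -(@ler_pXn2r _ 2) ?nnegrE ?nm_ge0// sqr_nm_hprod lerDl sqr_ge0.
Qed.

Lemma nm_hprod2 (x : hprod U V) : nm x.2 <= nm x.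
Proof.
by rewrite -(@ler_pXn2r _ 2) ?nnegrE ?nm_ge0// sqr_nm_hprod lerDr sqr_ge0.
Qed.

End HprodNorm.

(** * The damped wave equation *)

Section DampedWave.
Variables (R : realType) (V H dH : hilbertType R).
Variables (j : {linear V -> H}) (L : {linear V -> dH}) (a b : V -> V -> R[i]).

Local Notation E := (hprod V V).
Local Notation X := (hprod (hprod V H) dH).

(* The third component of [calV] is determined by the second one, so that the
   form is transported to the whole Hilbert space [V * V]. *)
Definition wave_emb (u : E) : X := ((u.1, j u.2), L u.2).

Lemma wave_emb_linear : linear wave_emb.
Proof.
by move=> c u v; rewrite /wave_emb /= !linearP.
Qed.

HB.instance Definition _ :=
  GRing.isLinear.Build R[i] E X *:%R wave_emb wave_emb_linear.

Definition wave_iota : {linear E -> X} := wave_emb.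

Definition wave_form (u v : E) : R[i] := - inner u.2 v.1 + a u.1 v.2 + b u.2 v.2.

Lemma wave_assoc :
  associated_op (calV L) (calV_emb j) (a_frak a b) = assoc wave_iota wave_form.
Proof.
apply/seteqP; split=> -[x y] /=.
  move=> [[u l] [/= ul <-] uP]; exists u => /=.
    by rewrite /wave_emb /calV_emb /= ul.
  by move=> v; rewrite -(uP (v, L v.2)).
move=> [u /= <- uP]; exists (u, L u.2); first by split.
by move=> [v l] /= vl; rewrite [LHS]uP /calV_emb /= /wave_emb /= vl.
Qed.

Hypotheses (sa : sesq a) (sb : sesq b).

Lemma sesq_wave : sesq wave_form.
Proof.
by split=> *; rewrite /wave_form /= !(innerE, sesqE sa, sesqE sb); ring.
Qed.

Lemma sqr_wave_iota u :
  nm (wave_iota u) ^+ 2 = nm u.1 ^+ 2 + nm (j u.2) ^+ 2 + nm (L u.2) ^+ 2.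
Proof. by rewrite !sqr_nm_hprod. Qed.

Lemma wave_iota1 u : nm u.1 <= nm (wave_iota u).
Proof. exact: le_trans (nm_hprod1 (wave_iota u).1) (nm_hprod1 (wave_iota u)). Qed.

Lemma wave_iota2 u : nm (j u.2) <= nm (wave_iota u).
Proof. exact: le_trans (nm_hprod2 (wave_iota u).1) (nm_hprod1 (wave_iota u)). Qed.

(** First v is chosen to match the boundary component; a vector of ker L then corrects the H
    component without changing L v. *)
Lemma wave_dense : dense (range L) -> dense (j @` [set u | L u = 0]) ->
  forall x (e : R), 0 < e -> exists u, nm (x - wave_iota u) <= e.
Proof.
move=> dL dk [[x1 x2] x3] e e0; have e2 : 0 < e / 2 by rewrite divr_gt0.
have [_ [v _ <-] hv] := dense_nm x3 dL e2.
have [_ [k Lk <-] hk] := dense_nm (x2 - j v) dk e2.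
exists ((x1, v + k) : E).
rewrite -(@ler_pXn2r _ 2) ?nnegrE ?nm_ge0 ?(ltW e0)// !sqr_nm_hprod /=.
rewrite subrr nm0 expr0n add0r (linearD j) (linearD L) Lk addr0 opprD addrA.
have h1 : nm (x2 - j v - j k) ^+ 2 <= (e / 2) ^+ 2.
  by rewrite lerXn2r ?nnegrE ?nm_ge0 ?(ltW e2).
have h2 : nm (x3 - L v) ^+ 2 <= (e / 2) ^+ 2.
  by rewrite lerXn2r ?nnegrE ?nm_ge0 ?(ltW e2).
by have := sqr_ge0 e; lra.
Qed.

Variables (Ma Mb Mj ML : R).
Hypotheses (Ma0 : 0 <= Ma) (Mb0 : 0 <= Mb) (Mj0 : 0 <= Mj) (ML0 : 0 <= ML).
Hypothesis aM : forall u v, nm (a u v) <= Ma * nm u * nm v.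
Hypothesis bM : forall u v, nm (b u v) <= Mb * nm u * nm v.
Hypothesis jM : forall u, nm (j u) <= Mj * nm u.
Hypothesis LM : forall u, nm (L u) <= ML * nm u.

(** The coupling of u_1 and u_2 is at most (1 + Ma) |u_1| |u_2|. Young's inequality takes half of
    the ellipticity in u_2 and leaves |u_1|^2, which is part of the norm of V x H x dH and goes into
    [om]. *)
Lemma wave_form_bounds (de w : R) : 0 < de -> 0 <= w ->
    (forall v, de * nm v ^+ 2
       <= complex.Re (b v v) + w * (nm (j v) ^+ 2 + nm (L v) ^+ 2)) ->
  exists M d om eps, form_bounds wave_iota wave_form M d om eps.
Proof.
move=> de0 w0 ell; pose M := 1 + Ma + Mb + Mj + ML; pose d := de / 2.
pose om := w + (1 + Ma) ^+ 2 / (2 * de) + de / 2.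
have M0 : 0 <= M by rewrite !addr_ge0.
have d0 : 0 < d by rewrite divr_gt0.
have M1 : 0 < 2 * (M + 1) by lra.
pose eps := Num.min 1 (d / (2 * (M + 1))).
have q0 : 0 <= (1 + Ma) ^+ 2 / (2 * de) by rewrite divr_ge0 ?sqr_ge0//; lra.
exists M, d, om, eps; split => //.
- exact: sesq_wave.
- by rewrite /om !addr_ge0// divr_ge0// ltW.
- by rewrite lt_min ltr01 divr_gt0.
- by rewrite ge_min lexx.
- have eM : eps * (2 * (M + 1)) <= d by rewrite -ler_pdivlMr// ge_min lexx orbT.
  have e0 : 0 <= eps by rewrite le_min ler01 divr_ge0// ltW.
  by lra.
- move=> u; have n0 := nm_ge0 u; have n1 := nm_hprod1 u; have n2 := nm_hprod2 u.
  rewrite -(@ler_pXn2r _ 2) ?nnegrE ?nm_ge0 ?mulr_ge0// sqr_wave_iota.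
  have h1 : nm u.1 ^+ 2 <= nm u ^+ 2 by rewrite lerXn2r ?nnegrE ?nm_ge0.
  have h2 : nm (j u.2) ^+ 2 <= (Mj * nm u) ^+ 2.
    rewrite lerXn2r ?nnegrE ?nm_ge0 ?mulr_ge0//.
    by rewrite (le_trans (jM _))// ler_wpM2l.
  have h3 : nm (L u.2) ^+ 2 <= (ML * nm u) ^+ 2.
    rewrite lerXn2r ?nnegrE ?nm_ge0 ?mulr_ge0//.
    by rewrite (le_trans (LM _))// ler_wpM2l.
  have : 1 + Mj ^+ 2 + ML ^+ 2 <= M ^+ 2.
    have q1 := mulr_ge0 Mj0 ML0; have q2 := mulr_ge0 (addr_ge0 Ma0 Mb0) (addr_ge0 Mj0 ML0).
    have q3 := sqr_ge0 (Ma + Mb); rewrite /M -subr_ge0.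
    have -> : (1 + Ma + Mb + Mj + ML) ^+ 2 - (1 + Mj ^+ 2 + ML ^+ 2) =
      (Ma + Mb) ^+ 2 + 2 * ((Ma + Mb) * (Mj + ML)) + 2 * (Mj * ML)
      + 2 * (Ma + Mb + Mj + ML) by ring.
    by rewrite !addr_ge0// !(mulr_ge0 (ler0n _ 2))// !addr_ge0.
  move/(ler_wpM2r (sqr_ge0 (nm u))); rewrite !exprMn in h2 h3 *; lra.
- move=> u v; have u1 := nm_hprod1 u; have u2 := nm_hprod2 u.
  have v1 := nm_hprod1 v; have v2 := nm_hprod2 v.
  have p1 : nm u.2 * nm v.1 <= nm u * nm v by rewrite ler_pM ?nm_ge0.
  have p2 : nm u.1 * nm v.2 <= nm u * nm v by rewrite ler_pM ?nm_ge0.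
  have p3 : nm u.2 * nm v.2 <= nm u * nm v by rewrite ler_pM ?nm_ge0.
  have uv : 0 <= nm u * nm v by rewrite mulr_ge0 ?nm_ge0.
  rewrite /wave_form (le_trans (nmD _ _))//.
  have := nmD (- inner u.2 v.1) (a u.1 v.2); rewrite nmN.
  have := nm_inner_le u.2 v.1; have := aM u.1 v.2; have := bM u.2 v.2.
  have := ler_wpM2l Ma0 p2; have := ler_wpM2l Mb0 p3.
  have := mulr_ge0 (addr_ge0 Mj0 ML0) uv; rewrite /M; lra.
move=> u; rewrite sqr_wave_iota sqr_nm_hprod /wave_form !cReD cReN.
have h1 := rip_le u.2 u.1; rewrite /rip in h1.
have h2 := le_trans (ler_norm _) (le_trans (Re_nm (- a u.1 u.2)) _).
have {}h2 : - complex.Re (a u.1 u.2) <= Ma * nm u.1 * nm u.2.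
  by rewrite -cReN; apply: h2; rewrite nmN aM.
have h3 := ell u.2.
have h4 : (1 + Ma) * (nm u.1 * nm u.2) <= (1 + Ma) ^+ 2 / (2 * de) * nm u.1 ^+ 2
    + de / 2 * nm u.2 ^+ 2.
  have : 0 <= ((1 + Ma) * nm u.1 - de * nm u.2) ^+ 2 / (2 * de).
    by rewrite divr_ge0 ?sqr_ge0//; lra.
  rewrite (_ : _ / _ = (1 + Ma) ^+ 2 / (2 * de) * nm u.1 ^+ 2 + de / 2 * nm u.2 ^+ 2
    - (1 + Ma) * (nm u.1 * nm u.2)); first by lra.
  by field; rewrite gt_eqF.
have s1 := sqr_ge0 (nm u.1).
have jL0 : 0 <= nm (j u.2) ^+ 2 + nm (L u.2) ^+ 2 by rewrite addr_ge0 ?sqr_ge0.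
have := mulr_ge0 q0 jL0; have := mulr_ge0 (ltW de0) jL0; have := mulr_ge0 w0 s1.
by rewrite /om /d; lra.
Qed.

(** The coupling terms satisfy the condition by themselves, because the V-norm of u_1 is part of the
    weaker norm; only [b] needs a hypothesis. *)
Lemma wave_parab (m : R) : 0 <= m ->
    (forall v, `|complex.Im (b v v)| <= m * nm (j v) * nm v) ->
  forall u, `|complex.Im (wave_form u u)| <= (1 + Ma + m) * nm (wave_iota u) * nm u.
Proof.
move=> m0 h u; have u2 := nm_hprod2 u.
have i1 := wave_iota1 u; have i2 := wave_iota2 u.
rewrite /wave_form !cImD cImN (le_trans (ler_normD _ _))//.
have := ler_normD (- complex.Im (inner u.2 u.1)) (complex.Im (a u.1 u.2)); rewrite normrN.
have := le_trans (Im_nm _) (nm_inner_le u.2 u.1); have := le_trans (Im_nm _) (aM u.1 u.2).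
have := h u.2.
have p1 : nm u.1 * nm u.2 <= nm (wave_iota u) * nm u by rewrite ler_pM ?nm_ge0.
have p2 : nm (j u.2) * nm u.2 <= nm (wave_iota u) * nm u by rewrite ler_pM ?nm_ge0.
have := ler_wpM2l Ma0 p1; have := ler_wpM2l m0 p2; lra.
Qed.

End DampedWave.

Theorem theorem4p2 (R : realType) (V H dH : hilbertType R)
    (V_separable : separable V) (H_separable : separable H)
    (j : {linear V -> H}) (j_inj : injective j) (j_cont : continuous j)
    (j_dense : dense (range j))
    (L : {linear V -> dH}) (L_bounded : bounded_op L)
    (L_dense : dense (range L)) (kerL_dense : dense (j @` [set u | L u = 0]))
    (a b : {bilinear V -> V -> R[i] | *%R & (Num.conj \; *%R)})
    (a_cont : continuous (fun p : V * V => a p.1 p.2 : R[i]^o))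
    (b_cont : continuous (fun p : V * V => b p.1 p.2 : R[i]^o))
    (b_elliptic : elliptic (W_space L) (W_emb j) (b_tilde b)) :
  let A := associated_op (calV L) (calV_emb j) (a_frak a b) in
  [/\ closed_op A,
      exists T : R -> {linear hprod (hprod V H) dH -> hprod (hprod V H) dH},
        [/\ analytic_semigroup T,
            semigroup_generator T = opp_op A
          & accretive (W_space L) (b_tilde b) ->
            (forall u v, 'Re (a u v) = 'Re (inner v u)) ->
            contractive T]
    & (exists2 Mb : R, 0 < Mb &
         forall u, `|'Im (b u u)| <= Mb%:C * `|j u| * `|u|) ->
      exists C : R -> {linear hprod (hprod V H) dH -> hprod (hprod V H) dH},
        cosine_function C /\ cosine_generator C = opp_op A].
Proof.
move=> A.
have bil_sesq (g : {bilinear V -> V -> R[i] | *%R & (Num.conj \; *%R)}) : sesq g.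
  by split=> *; rewrite ?linearDl ?linearDr ?linearZl_LR ?linearZr_LR.
have [sa sb] := (bil_sesq a, bil_sesq b).
have [Ma Ma0 aM] := continuous_sesq_bounded sa a_cont.
have [Mb Mb0 bM] := continuous_sesq_bounded sb b_cont.
have [Mj Mj0 jM] := continuous_linear_nm j_cont.
have [ML ML0 LM] := bounded_op_nm L_bounded.
have [de [w [de0 ell]]] := b_elliptic.
(* The shift becomes |w| to be nonnegative, and the boundary part of the norm of W is dropped on the
   left. *)
have ell' v : de * nm v ^+ 2
    <= complex.Re (b v v) + `|w| * (nm (j v) ^+ 2 + nm (L v) ^+ 2).
  have := ell (v, L v) (erefl _); rewrite /b_tilde /W_emb /= !nmE -complexRe.
  rewrite -!rmorphXn -!rmorphM -rmorphD lecR /= !sqr_nm_hprod /= => h.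
  have s0 : 0 <= nm (j v) ^+ 2 + nm (L v) ^+ 2 by rewrite addr_ge0 ?sqr_ge0.
  have := ler_wpM2r s0 (ler_norm w); have := mulr_ge0 (ltW de0) (sqr_ge0 (nm (L v))).
  lra.
have [M [d [om [eps fb]]]] := wave_form_bounds sa sb Ma0 Mb0 Mj0 ML0 aM bM jM LM
  de0 (normr_ge0 w) ell'.
have dn := wave_dense L_dense kerL_dense.
rewrite /A wave_assoc; split.
- exact: form_closed fb dn.
- have [T [T1 T2 T3]] := form_semigroup fb dn; exists T; split=> // acc reE.
  (* The real parts of -(u_2|u_1) and a(u_1, u_2) cancel by [reE], which leaves Re b(u_2, u_2). *)
  apply: T3 => u; rewrite /wave_form !cReD cReN.
  have := acc (u.2, L u.2) (erefl _); rewrite /b_tilde /= -complexRe ler0c.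
  have := reE u.1 u.2; rewrite -!complexRe => /complexI ->; lra.
- move=> [m m0 hm]; apply: (form_cosine fb dn (mb := 1 + Ma + m)).
    by rewrite !addr_ge0// ltW.
  apply: (wave_parab L Ma0 aM (ltW m0)) => v.
  have := hm v; rewrite !nmE -complexIm -!rmorphM.
  by rewrite nmC lecR.
Qed.
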